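(* Let $E=\{x_n\}\subseteq\mathbb{R}^d$ be a separated sequence, and let $\Lambda\subseteq\widehat{\mathbb{R}}^d$ be an S-set of strict multiplicity which is compact, convex, and symmetric about $0$. Let $G\in L^\infty(\widehat{\mathbb{R}}^d)$ be non-negative. If balayage is possible for $(E,\Lambda)$, then there exist $A,B>0$ such that for all $f\in PW_\Lambda\setminus\{0\}$, $F=\widehat f$, $$A\frac{\left(\int_\Lambda|F(\gamma)|^2G(\gamma)\,d\gamma\right)^2}{\int_\Lambda|F(\gamma)|^2\,d\gamma}\le\sum_{x\in E}|(FG)^\vee(x)|^2\le B\int_\Lambda|F(\gamma)|^2\,d\gamma.$$ Moreover $B$ can be taken as $B_1\|G\|_\infty^2$, where $B_1$ is a constant such that $\sum_{x\in E}|u(x)|^2\le B_1\|u\|_2^2$ for all $u\in PW_\Lambda$.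
   Context: Fourier transform $\widehat f(\gamma)=\int f(x)e^{-2\pi i x\cdot\gamma}dx$, inverse $F^\vee(x)=\int F(\gamma)e^{2\pi i x\cdot\gamma}d\gamma$; $\widehat{\mathbb{R}}^d$ is $\mathbb{R}^d$ as frequency domain; $F$ vanishes off $\Lambda$. $PW_\Lambda=\{f\in L^2(\mathbb{R}^d):\operatorname{supp}\widehat f\subseteq\Lambda\}$. $M_b(X)$: bounded complex Radon measures supported in closed $X$. $\mathcal{C}(\Lambda)=\{f\in C_b(\mathbb{R}^d):\operatorname{supp}\widehat f\subseteq\Lambda\}$. Balayage possible for $(E,\Lambda)$: every $\mu\in M_b(\mathbb{R}^d)$ has $\nu\in M_b(E)$ with $\widehat\mu=\widehat\nu$ on $\Lambda$. S-set: for all $f\in\mathcal{C}(\Lambda)$, $\mu\in M_b(\mathbb{R}^d)$ with $\widehat\mu=0$ on $\Lambda$, $\int f\,d\mu=0$. Strict multiplicity: some $\mu\in M_b(\Lambda)\setminus\{0\}$ with $|\mu^\vee(x)|\to0$ as $\|x\|\to\infty$. Separated: $\inf\{\|x-y\|:x\ne y\in E\}>0$ (for separated $E$, a constant $B_1$ as in the claim exists). *)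

(* Defs.v *)
From HB Require Import structures.
From mathcomp Require Import all_boot all_order all_algebra.
From mathcomp Require Import complex.
From mathcomp Require Import all_classical all_reals all_analysis ess_sup_inf.
Import Order.TTheory GRing.Theory Num.Theory.
Import numFieldNormedType.Exports.

Set Implicit Arguments.
Unset Strict Implicit.
Unset Printing Implicit Defensive.

Local Open Scope ring_scope.
Local Open Scope classical_set_scope.

Section Defs.
Variables (R : realType) (d : nat).

(** R^d (also used as the frequency domain \hat R^d), with its
    topology/max-norm from the matrix library. *)
Definition Vec := 'rV[R]_d.

Definition Rd := g_sigma_algebraType (@open Vec).

Definition dotp (x y : Vec) : R := \sum_(i < d) x ord0 i * y ord0 i.

Definition cRe (z : R[i]) : R := complex.Re z.
Definition cIm (z : R[i]) : R := complex.Im z.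
Definition cofR (r : R) : R[i] := Complex r 0.
Definition cI : R[i] := Complex 0 1.
Definition cmod (z : R[i]) : R := Num.sqrt (cRe z ^+ 2 + cIm z ^+ 2).
Definition expi (t : R) : R[i] := Complex (cos t) (sin t).

(** Lebesgue measure on the Borel sets of R^d: the measure giving every box
    prod_i [a_i, b_i) its volume (this determines it uniquely). *)
Definition is_lebesgue (lam : {measure set Rd -> \bar R}) : Prop :=
  forall a b : Vec, (forall i, a ord0 i <= b ord0 i) ->
    lam [set x : Rd | forall i, a ord0 i <= (x : Vec) ord0 i < b ord0 i]
    = (\prod_(i < d) (b ord0 i - a ord0 i))%:E.

Definition cint (mu : {measure set Rd -> \bar R}) (D : set Rd) (f : Rd -> R[i])
  : R[i] :=
  Complex (Rintegral mu D (fun x => cRe (f x)))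
          (Rintegral mu D (fun x => cIm (f x))).

(** Bounded complex (Radon) measures on R^d, represented as
    (m1 - m2) + i (m3 - m4) with m1..m4 finite positive Borel measures
    (every bounded complex Borel measure on R^d is Radon and has this form). *)
Record cmeasure := CMeasure {
  cm1 : {finite_measure set Rd -> \bar R};
  cm2 : {finite_measure set Rd -> \bar R};
  cm3 : {finite_measure set Rd -> \bar R};
  cm4 : {finite_measure set Rd -> \bar R} }.

Definition cm_val (mu : cmeasure) (A : set Rd) : R[i] :=
  Complex (fine (cm1 mu A) - fine (cm2 mu A)) (fine (cm3 mu A) - fine (cm4 mu A)).

Definition cm_int (mu : cmeasure) (f : Rd -> R[i]) : R[i] :=
  (cint (cm1 mu) setT f - cint (cm2 mu) setT f)
  + cI * (cint (cm3 mu) setT f - cint (cm4 mu) setT f).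

(** mu is supported in (the closed set) X: |mu|(R^d \ X) = 0. *)
Definition cm_supp (mu : cmeasure) (X : set Vec) : Prop :=
  forall A : set Rd, measurable A -> A `<=` ~` X -> cm_val mu A = 0.

Definition cm_nonzero (mu : cmeasure) : Prop :=
  exists A : set Rd, measurable A /\ cm_val mu A <> 0.

Definition cm_ft (mu : cmeasure) (gam : Vec) : R[i] :=
  cm_int mu (fun x : Rd => expi (- (2 * pi) * dotp x gam)).

Definition cm_ift (mu : cmeasure) (x : Vec) : R[i] :=
  cm_int mu (fun gam : Rd => expi (2 * pi * dotp x gam)).

Definition ft (lam : {measure set Rd -> \bar R}) (phi : Vec -> R[i]) (gam : Vec)
  : R[i] := cint lam setT (fun x : Rd => phi x * expi (- (2 * pi) * dotp x gam)).

Definition ift (lam : {measure set Rd -> \bar R}) (D : set Vec)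
  (H : Vec -> R[i]) (x : Vec) : R[i] :=
  cint lam D (fun gam : Rd => H gam * expi (2 * pi * dotp x gam)).

Fixpoint iterD (vs : seq Vec) (g : Vec -> R) : Vec -> R :=
  match vs with
  | [::] => g
  | v :: vs' => fun x => derive (iterD vs' g) x v
  end.

Definition smooth (g : Vec -> R) : Prop :=
  forall (vs : seq Vec) (x : Vec), differentiable (iterD vs g) x.

Definition test_fun_off (Lam : set Vec) (phi : Vec -> R[i]) : Prop :=
  smooth (fun x => cRe (phi x)) /\ smooth (fun x => cIm (phi x)) /\
  exists K : set Vec, compact K /\ K `<=` ~` Lam /\
    forall x, ~ K x -> phi x = 0.

(** C(Lam) = { f in C_b(R^d) : supp \hat f ⊆ Lam }, the support of \hat f being
    taken in the sense of (tempered) distributions: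
    <\hat f, phi> = int f \hat phi = 0 for every test function phi
    supported off Lam. *)
Definition in_CLam (lam : {measure set Rd -> \bar R}) (Lam : set Vec)
  (f : Vec -> R[i]) : Prop :=
  [/\ continuous (fun x => cRe (f x)), continuous (fun x => cIm (f x)),
      (exists M : R, forall x, cmod (f x) <= M) &
      forall phi, test_fun_off Lam phi ->
        cint lam setT (fun x : Rd => f x * ft lam phi x) = 0].

Definition S_set (lam : {measure set Rd -> \bar R}) (Lam : set Vec) : Prop :=
  forall f, in_CLam lam Lam f ->
  forall mu : cmeasure, (forall gam, Lam gam -> cm_ft mu gam = 0) ->
    cm_int mu f = 0.

Definition strict_multiplicity (Lam : set Vec) : Prop :=
  exists mu : cmeasure, cm_supp mu Lam /\ cm_nonzero mu /\
    forall eps : R, 0 < eps -> exists r : R, forall x : Vec,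
      r <= `|x| -> cmod (cm_ift mu x) <= eps.

Definition balayage_possible (E Lam : set Vec) : Prop :=
  forall mu : cmeasure, exists nu : cmeasure,
    cm_supp nu E /\ forall gam, Lam gam -> cm_ft mu gam = cm_ft nu gam.

Definition separated_set (E : set Vec) : Prop :=
  exists delta : R, 0 < delta /\
    forall x y, E x -> E y -> x <> y -> delta <= `|x - y|.

Definition convex_Rd (S : set Vec) : Prop :=
  forall x y t, S x -> S y -> 0 <= t <= 1 -> S (t *: x + (1 - t) *: y).

Definition symmetric_set (S : set Vec) : Prop := forall x, S x -> S (- x).

(** F in L^2(\hat R^d), vanishing off Lam (i.e. F = \hat f, f in PW_Lam). *)
Definition L2_on (lam : {measure set Rd -> \bar R}) (Lam : set Vec)
  (F : Vec -> R[i]) : Prop :=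
  [/\ measurable_fun setT (fun x : Rd => cRe (F x)),
      measurable_fun setT (fun x : Rd => cIm (F x)),
      lam.-integrable setT (fun x : Rd => ((cmod (F x)) ^+ 2)%:E) &
      forall x, ~ Lam x -> F x = 0].

Definition L2sq (lam : {measure set Rd -> \bar R}) (Lam : set Vec)
  (F : Vec -> R[i]) : R :=
  Rintegral lam Lam (fun x : Rd => (cmod (F x)) ^+ 2).

Definition sample_energy (lam : {measure set Rd -> \bar R}) (Lam E : set Vec)
  (H : Vec -> R[i]) : \bar R :=
  \esum_(x in E) ((cmod (ift lam Lam H x)) ^+ 2)%:E.

Definition Linf_norm (lam : {measure set Rd -> \bar R}) (G : Vec -> R) : \bar R :=
  ess_sup lam (fun x : Rd => `|G x|%:E).

End Defs.

(* Main.v *)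
(** Let u be the inverse transform of FG, supported in the convex body Lambda. By
    Cauchy-Schwarz for [int |F|^2 G] it suffices to bound [sum_E |u|^2] above and below
    by multiples of [|| u ||_2^2]; if Lambda is a null set there is nothing to prove.

    Balayage gives, by a gliding hump on discrete measures, a constant K such that
    [sup |f| <= K sup_E |f|] for every f with spectrum in Lambda. Averaging
    contracted copies of f over many scales shows that the same holds, with 2K, for a
    slightly larger spectrum. This leaves room to multiply u by a translated kernel,
    and summing [|u(y)|^2 <= sup |u . ker(. - y)|^2 <= 4K^2 sup_E ...] over y yields
    [sum_{E2} |u|^2 <= C sum_{E1} |u|^2] whenever E1 is such a sampling set and E2 is
    separated. Apply this to E and a fine lattice in both orders: on the
    lattice, [sum |u|^2] is a multiple of [|| u ||_2^2] by Parseval for Fourier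
    series on a cube containing Lambda. The spectrum is handled by duality, through
    the inequalities [|sum c_k f(x_k)| <= M sup_Lambda |sum c_k e(x_k . g)|]. *)

Require Import Defs.
From HB Require Import structures.
From mathcomp Require Import all_boot all_order all_algebra.
From mathcomp Require Import complex.
From mathcomp Require Import all_classical all_reals all_analysis ess_sup_inf.
From mathcomp Require Import measurable_realfun ring lra.
Import Order.TTheory GRing.Theory Num.Theory.
Import numFieldNormedType.Exports.
Set Implicit Arguments.
Unset Strict Implicit.
Unset Printing Implicit Defensive.
Local Open Scope ring_scope.
Local Open Scope classical_set_scope.

(** * Complex exponentials *)

Section Complex.
Context {R : realType}.
Implicit Types (z w : R[i]) (t r : R).

(** All that is known a priori about an element of [spec L M f] is its mass [M], and no final
    constant may involve it. Constants are therefore tied to the supremum of |f| or of its samples.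
    [M] only makes the supremum finite, so that sup <= c + sup / 2 can be absorbed, and lets errors
    of size [M * e] vanish with e.

    Besides averaging over scales, both the enlarged spectrum and the lattice rely on a modulus of
    continuity that depends on the spectrum alone. It comes from an algebraic iteration on
    difference operators, which uses only their symbols and sup bounds.

    Convexity recombines a contracted frequency with a small one inside Lambda. Together with
    symmetry it also yields a cube inside Lambda, unless Lambda lies in a hyperplane and is null. *)

Lemma cmodE z : cmod z = Normc.normc z.
Proof. by case: z. Qed.

Lemma cmod_ge0 z : 0 <= cmod z.
Proof. exact: sqrtr_ge0. Qed.

Lemma cmodM z w : cmod (z * w) = cmod z * cmod w.
Proof. by rewrite !cmodE Normc.normcM. Qed.

Lemma cmodD z w : cmod (z + w) <= cmod z + cmod w.
Proof. by rewrite !cmodE le_normcD. Qed.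

Lemma cmodN z : cmod (- z) = cmod z.
Proof. by rewrite !cmodE normcN. Qed.

Lemma cmodB z w : cmod (z - w) <= cmod z + cmod w.
Proof. by rewrite -(cmodN w) cmodD. Qed.

Lemma cmod0 : cmod (0 : R[i]) = 0.
Proof. by rewrite cmodE Normc.normc0. Qed.

Lemma cmod_sum (I : Type) (s : seq I) (P : pred I) (F : I -> R[i]) :
  cmod (\sum_(i <- s | P i) F i) <= \sum_(i <- s | P i) cmod (F i).
Proof.
elim/big_ind2 : _ => //; first by rewrite cmod0.
by move=> z a w b za wb; rewrite (le_trans (cmodD _ _))// lerD.
Qed.

Lemma sqr_cmod z : cmod z ^+ 2 = cRe z ^+ 2 + cIm z ^+ 2.
Proof. by rewrite sqr_sqrtr// addr_ge0 ?sqr_ge0. Qed.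

Lemma cofRE r : cofR r = r%:C%C. Proof. by []. Qed.

Lemma cofRD r t : cofR (r + t) = cofR r + cofR t.
Proof. by rewrite !cofRE rmorphD. Qed.

Lemma cofRB r t : cofR (r - t) = cofR r - cofR t.
Proof. by rewrite !cofRE rmorphB. Qed.

Lemma cofRN r : cofR (- r) = - cofR r.
Proof. by rewrite !cofRE rmorphN. Qed.

Lemma cofRM r t : cofR (r * t) = cofR r * cofR t.
Proof. by rewrite !cofRE rmorphM. Qed.

Lemma cofR1 : cofR (1 : R) = 1. Proof. by []. Qed.

Lemma cmod_cofR r : cmod (cofR r) = `|r|.
Proof. by rewrite /cmod /= expr0n addr0 sqrtr_sqr. Qed.

Lemma cmod1 : cmod (1 : R[i]) = 1.
Proof. by rewrite -cofR1 cmod_cofR normr1. Qed.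

Lemma cReM z w : cRe (z * w) = cRe z * cRe w - cIm z * cIm w.
Proof. by case: z; case: w. Qed.

Lemma cImM z w : cIm (z * w) = cRe z * cIm w + cIm z * cRe w.
Proof. by case: z; case: w. Qed.

Lemma cReD z w : cRe (z + w) = cRe z + cRe w.
Proof. by case: z; case: w. Qed.

Lemma cImD z w : cIm (z + w) = cIm z + cIm w.
Proof. by case: z; case: w. Qed.

Lemma cReB z w : cRe (z - w) = cRe z - cRe w.
Proof. by case: z; case: w. Qed.

Lemma cImB z w : cIm (z - w) = cIm z - cIm w.
Proof. by case: z; case: w. Qed.

Lemma cRe_sum (I : Type) (s : seq I) (P : pred I) (F : I -> R[i]) :
  cRe (\sum_(i <- s | P i) F i) = \sum_(i <- s | P i) cRe (F i).
Proof. exact: (big_morph (@cRe R) cReD). Qed.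

Lemma cIm_sum (I : Type) (s : seq I) (P : pred I) (F : I -> R[i]) :
  cIm (\sum_(i <- s | P i) F i) = \sum_(i <- s | P i) cIm (F i).
Proof. exact: (big_morph (@cIm R) cImD). Qed.

Lemma Re_le_cmod z : `|cRe z| <= cmod z.
Proof.
by rewrite -sqrtr_sqr ler_wsqrtr// lerDl sqr_ge0.
Qed.

Lemma Im_le_cmod z : `|cIm z| <= cmod z.
Proof.
by rewrite -sqrtr_sqr ler_wsqrtr// lerDr sqr_ge0.
Qed.

Lemma cmod_le_ReIm z : cmod z <= `|cRe z| + `|cIm z|.
Proof.
rewrite -ler_sqr ?nnegrE ?addr_ge0 ?cmod_ge0// sqr_cmod sqrrD !real_normK ?num_real//.
by rewrite addrAC lerDl mulrn_wge0 ?mulr_ge0.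
Qed.

Lemma expiD t r : expi (t + r) = expi t * expi r.
Proof. by rewrite /expi cosD sinD; apply/eqP; rewrite eq_complex /= !eqxx /= addrC. Qed.

Lemma expi0 : expi (0 : R) = 1.
Proof. by rewrite /expi cos0 sin0. Qed.

Lemma cmod_expi t : cmod (expi t) = 1.
Proof. by rewrite /cmod /= cos2Dsin2 sqrtr1. Qed.

Lemma expi_add_opp t : expi t + expi (- t) = cofR (2 * cos t).
Proof.
apply/eqP; rewrite eq_complex /= cosN sinN subrr eqxx andbT; apply/eqP.
by rewrite mulr_natl mulr2n.
Qed.

End Complex.

(** * Scalar product and max-norm *)

Section Dotp.
Context {R : realType} {d : nat}.
Implicit Types (x y : Vec R d) (a : R).

Lemma dotpC x y : dotp x y = dotp y x.
Proof. by apply: eq_bigr => i _; rewrite mulrC. Qed.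

Lemma dotpDl x y z : dotp (x + y) z = dotp x z + dotp y z.
Proof. by rewrite -big_split; apply: eq_bigr => i _; rewrite !mxE mulrDl. Qed.

Lemma dotpDr x y z : dotp z (x + y) = dotp z x + dotp z y.
Proof. by rewrite dotpC dotpDl !(dotpC z). Qed.

Lemma dotpZl a x y : dotp (a *: x) y = a * dotp x y.
Proof. by rewrite mulr_sumr; apply: eq_bigr => i _; rewrite !mxE mulrA. Qed.

Lemma dotpZr a x y : dotp x (a *: y) = a * dotp x y.
Proof. by rewrite dotpC dotpZl dotpC. Qed.

Lemma dotpNl x y : dotp (- x) y = - dotp x y.
Proof. by rewrite -scaleN1r dotpZl mulN1r. Qed.

Lemma dotpNr x y : dotp x (- y) = - dotp x y.
Proof. by rewrite dotpC dotpNl dotpC. Qed.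

Lemma dotp0l y : dotp 0 y = 0.
Proof. by rewrite -(scale0r 0) dotpZl mul0r. Qed.

Lemma coord_le_norm x i : `|x ord0 i| <= `|x|.
Proof. rewrite [leRHS]/Num.norm/= mx_normrE; apply/bigmax_geP; right => /=.
by exists (ord0, i). Qed.

Lemma norm_le_coord x a : 0 <= a -> (forall i, `|x ord0 i| <= a) -> `|x| <= a.
Proof.
move=> a0 xa; rewrite [leLHS]/Num.norm/= mx_normrE; apply: bigmax_le => // -[j i] _ /=.
by rewrite (ord1 j).
Qed.

Lemma dotp_le x y : `|dotp x y| <= d%:R * (`|x| * `|y|).
Proof.
rewrite (le_trans (ler_norm_sum _ _ _))//.
rewrite (_ : d%:R * _ = \sum_(i < d) (`|x| * `|y|)); last first.
  by rewrite sumr_const card_ord -[RHS]mulr_natl.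
by apply: ler_sum => i _; rewrite normrM ler_pM// coord_le_norm.
Qed.

End Dotp.

(** * Functions with spectrum in a set *)

Section Trig.
Context {R : realType}.
Implicit Types t u : R.

Lemma sin_mvt u : exists2 c, `|c| <= `|u| & sin u = u * cos c.
Proof.
wlog u0 : u / 0 <= u.
  move=> H; have [/H//|u0] := leP 0 u.
  have [|c cu e] := H (- u); first by rewrite oppr_ge0 ltW.
  exists c; first by rewrite -(normrN u).
  by apply: oppr_inj; rewrite -sinN e mulNr.
have [c] := @MVT_segment R (@sin R) (@cos R) 0 u u0
  (fun x _ => is_derive_sin x) (continuous_subspaceT (@continuous_sin R)).
rewrite in_itv/= => /andP[c0 cu]; rewrite sin0 !subr0 => ->.
by exists c; rewrite ?(mulrC u)// !ger0_norm.
Qed.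

Lemma sin_le_norm u : `|sin u| <= `|u|.
Proof.
have [c _ ->] := sin_mvt u.
by rewrite normrM ler_piMr// cos_max.
Qed.

Lemma one_sub_cos u : 1 - cos u = 2 * sin (u / 2) ^+ 2.
Proof.
have {1}-> : u = (u / 2) *+ 2 by rewrite -mulr_natr; field.
by rewrite cos_mulr2n sin2cos2; ring.
Qed.

Lemma one_sub_cos_le u : 1 - cos u <= u ^+ 2 / 2.
Proof.
rewrite one_sub_cos -real_normK ?num_real//.
have := sin_le_norm (u / 2); rewrite normrM (ger0_norm (_ : 0 <= 2^-1))// => h.
have h0 := normr_ge0 (sin (u / 2)); rewrite -(real_normK (num_real u)).
by nra.
Qed.

Lemma sin_sub_le u : `|sin u - u| <= `|u| ^+ 3.
Proof.
have [c cu ->] := sin_mvt u.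
rewrite -{2}(mulr1 u) -mulrBr normrM exprS ler_wpM2l// distrC ger0_norm; last first.
  by rewrite subr_ge0 cos_le1.
rewrite (le_trans (one_sub_cos_le c))// -(real_normK (num_real c)).
by have := normr_ge0 c; nra.
Qed.

Definition sinc t : R := if t == 0 then 1 else sin t / t.

Lemma sinc_le1 t : `|sinc t| <= 1.
Proof.
rewrite /sinc; case: eqP => [_|/eqP t0]; first by rewrite normr1.
by rewrite normrM normfV ler_pdivrMr ?normr_gt0// mul1r sin_le_norm.
Qed.

Lemma sinc_le t : t != 0 -> `|sinc t| <= `|t|^-1.
Proof.
move=> t0; rewrite /sinc (negbTE t0) normrM normfV ler_piMl// ?invr_ge0//.
exact: sin_max.
Qed.

Lemma viete t n :
  (\prod_(k < n) cos (t / 2 ^+ k.+1)) * (sin (t / 2 ^+ n) * 2 ^+ n) = sin t.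
Proof.
elim: n => [|n IH]; first by rewrite big_ord0 expr0 divr1 mulr1 mul1r.
rewrite big_ord_recr/= -[RHS]IH -!mulrA; congr (_ * _).
have -> : t / 2 ^+ n = (t / 2 ^+ n.+1) *+ 2.
  by rewrite -mulr_natr exprSr; field; rewrite expf_neq0.
by rewrite sin_mulr2n exprS -mulr_natr; ring.
Qed.

Lemma cvg_half_pow : (fun n => 2 ^- n : R) @ \oo --> (0 : R).
Proof.
have := @cvg_geometric R 1 (2^-1) _; rewrite /geometric/=.
under eq_fun do rewrite mul1r exprVn.
by apply; rewrite ger0_norm// invf_lt1// ltr1n.
Qed.

(** A cosine is an average of two characters, so this limit places [sinc] in a spectral class
    without writing it as an integral over an interval. *)
Lemma viete_cvg t :
  (fun n => \prod_(k < n) cos (t / 2 ^+ k.+1)) @ \oo --> sinc t.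
Proof.
rewrite /sinc; case: eqP => [->|/eqP t0].
  rewrite (_ : (fun n => _) = cst 1); first exact: cvg_cst.
  by apply/funext => n; rewrite big1// => k _; rewrite mul0r cos0.
pose s n : R := sin (t / 2 ^+ n) * 2 ^+ n.
have s_t : s @ \oo --> t.
  apply/cvgrPdistC_le => e e0.
  have : (fun n => `|t| ^+ 3 * (2 ^- n * 2 ^- n)) @ \oo --> (`|t| ^+ 3 * (0 * 0)).
    by apply: cvgM; [exact: cvg_cst|apply: cvgM; exact: cvg_half_pow].
  rewrite !mulr0 => /cvgr_le /(_ _ e0); apply: filterS => n; apply: le_trans.
  have p0 : 0 < 2 ^+ n :> R by rewrite exprn_gt0.
  have -> : s n - t = (sin (t / 2 ^+ n) - t / 2 ^+ n) * 2 ^+ n.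
    by rewrite /s; field; rewrite gt_eqF.
  rewrite normrM (ger0_norm (ltW p0)) (le_trans (ler_wpM2r (ltW p0) (sin_sub_le _)))//.
  rewrite normrM normfV (ger0_norm (ltW p0)) le_eqVlt; apply/orP; left; apply/eqP.
  by field; rewrite gt_eqF.
(* Once [s n] is closer to t than |t| it is nonzero, and the telescoped identity can be divided by
   it. *)
have P_n : \forall n \near \oo, \prod_(k < n) cos (t / 2 ^+ k.+1) = sin t / s n.
  have nt0 : 0 < `|t| by rewrite normr_gt0.
  apply: filterS (cvgr_distC_lt _ _ s_t _ nt0) => n h; rewrite -(viete t n).
  by rewrite mulfK//; apply: contraTneq h => e; rewrite /s e sub0r normrN ltxx.
have : (fun n => sin t / s n) @ \oo --> sin t / t.
  by apply: cvgM; [exact: cvg_cst|exact: cvgV].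
apply: cvg_trans; apply: near_eq_cvg.
by apply: filterS P_n => n ->.
Qed.

End Trig.

(** * Spectral classes defined by duality *)

Section SpectralClass.
Context {R : realType} {d : nat}.
Local Notation V := (Vec R d).
Implicit Types (f : V -> R[i]) (g : V) (s : seq (R[i] * V)) (L : set V) (x y : V).

(** Pairing of [f] with the finitely supported measure whose weights and points are listed in
    [s]. *)
Definition papp s f : R[i] := \sum_(p <- s) p.1 * f p.2.

Definition chr (g x : V) : R[i] := expi (2 * pi * dotp x g).

(** [spec L M f] says that [f] is, in a dual sense, an integral of characters
    with frequencies in [L] against a measure of total mass at most [M]. It makes
    products, dilations and pointwise limits immediate. *)
Variant spec L (M : R) f : Prop := Spec of forall s (B : R), 0 <= B ->
  (forall g, L g -> cmod (papp s (chr g)) <= B) -> cmod (papp s f) <= M * B.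

Lemma spec_le L M f s (B : R) : spec L M f -> 0 <= B ->
  (forall g, L g -> cmod (papp s (chr g)) <= B) -> cmod (papp s f) <= M * B.
Proof. by case; exact. Qed.

Lemma cmod_chr g x : cmod (chr g x) = 1.
Proof. exact: cmod_expi. Qed.

Lemma chrDr g x y : chr g (x + y) = chr g x * chr g y.
Proof. by rewrite /chr dotpDl mulrDr expiD. Qed.

Lemma chrDl g h x : chr (g + h) x = chr g x * chr h x.
Proof. by rewrite /chr dotpDr mulrDr expiD. Qed.

Lemma chr0 g : chr g 0 = 1.
Proof. by rewrite /chr dotp0l mulr0 expi0. Qed.

Lemma papp_map s (a : V -> R[i]) (t : V -> V) f :
  papp [seq (p.1 * a p.2, t p.2) | p <- s] f = papp s (fun x => a x * f (t x)).
Proof. by rewrite /papp big_map; apply: eq_bigr => p _ /=; rewrite mulrA. Qed.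

Lemma eq_papp s f (g : V -> R[i]) : f =1 g -> papp s f = papp s g.
Proof. by move=> fg; apply: eq_bigr => p _; rewrite fg. Qed.

Lemma papp_cat s s' f : papp (s ++ s') f = papp s f + papp s' f.
Proof. by rewrite /papp big_cat. Qed.

Lemma papp1 (c : R[i]) x f : papp [:: (c, x)] f = c * f x.
Proof. by rewrite /papp big_seq1. Qed.

Lemma spec_bound L M f x : spec L M f -> cmod (f x) <= M.
Proof.
move=> /(@spec_le _ _ _ [:: (1, x)] 1)/(_ ler01); rewrite papp1 mul1r mulr1; apply => g _.
by rewrite papp1 mul1r cmod_chr.
Qed.

Lemma spec_ge0 L M f : spec L M f -> 0 <= M.
Proof. by move=> /(@spec_bound _ _ _ 0); apply: le_trans; exact: cmod_ge0. Qed.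

Lemma spec_sub L L' M f : spec L M f -> L `<=` L' -> spec L' M f.
Proof. by move=> Lf LL'; split=> s B B0 L'B; apply: spec_le Lf _ _ => // g /LL'; exact: L'B. Qed.

Lemma spec_eq L M f (g : V -> R[i]) : spec L M f -> f =1 g -> spec L M g.
Proof. by move=> Lf fg; split=> s B B0 /(spec_le Lf B0); rewrite (eq_papp _ fg). Qed.

Lemma spec_chr L g : L g -> spec L 1 (chr g).
Proof. by move=> Lg; split=> s B B0 /(_ _ Lg); rewrite mul1r. Qed.

(** Duality is used twice: with [g] absorbed in the coefficients, [f] is tested on characters [a] of
    [L1]; with [chr a] absorbed in turn, [g] is tested on [L2]. What remains are the characters
    [a + b]. *)
Lemma spec_mul L1 L2 L M1 M2 f (g : V -> R[i]) :
  spec L1 M1 f -> spec L2 M2 g -> (forall a b, L1 a -> L2 b -> L (a + b)) ->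
  spec L (M1 * M2) (fun x => f x * g x).
Proof.
move=> Lf Lg L12; have M20 := spec_ge0 Lg; split=> s B B0 LB.
rewrite (eq_papp _ (fun x => mulrC (f x) (g x))) -(papp_map _ g id f) -mulrA.
apply: (spec_le Lf); [exact: mulr_ge0|] => a L1a.
rewrite (papp_map s g id) (eq_papp _ (fun x => mulrC (g x) _)) -(papp_map s (chr a) id g).
apply: (spec_le Lg) => // b L2b; rewrite (papp_map s (chr a) id).
by rewrite -(eq_papp _ (chrDl a b)); exact: LB (L12 _ _ L1a L2b).
Qed.

Lemma spec_add L M1 M2 f (g : V -> R[i]) : spec L M1 f -> spec L M2 g ->
  spec L (M1 + M2) (fun x => f x + g x).
Proof.
move=> Lf Lg; split=> s B B0 LB; have -> : papp s (fun x => f x + g x) = papp s f + papp s g.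
  by rewrite /papp -big_split; apply: eq_bigr => p _; rewrite mulrDr.
by rewrite (le_trans (cmodD _ _))// mulrDl lerD//; [exact: (spec_le Lf)|exact: (spec_le Lg)].
Qed.

Lemma spec_scale L M f (c : R[i]) : spec L M f -> spec L (cmod c * M) (fun x => c * f x).
Proof.
move=> Lf; split=> s B B0 LB; have -> : papp s (fun x => c * f x) = c * papp s f.
  by rewrite /papp mulr_sumr; apply: eq_bigr => p _; rewrite mulrCA.
by rewrite cmodM -mulrA ler_wpM2l ?cmod_ge0//; exact: (spec_le Lf).
Qed.

Lemma spec0 L : spec L 0 (fun=> 0).
Proof.
by split=> s B B0 _; rewrite mul0r /papp big1 ?cmod0// => p _; rewrite mulr0.
Qed.

Lemma spec_sum L (I : Type) (r : seq I) (M : I -> R) (F : I -> V -> R[i]) :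
  (forall i, spec L (M i) (F i)) ->
  spec L (\sum_(i <- r) M i) (fun x => \sum_(i <- r) F i x).
Proof.
move=> LF; elim: r => [|i r IH].
  by rewrite big_nil; refine (spec_eq (@spec0 L) _) => x; rewrite big_nil.
by rewrite big_cons; refine (spec_eq (spec_add (LF i) IH) _) => x; rewrite big_cons.
Qed.

Lemma spec_affine L L' M f (a : V) (r : R) :
  spec L M f -> (forall g, L g -> L' (r *: g)) -> spec L' M (fun x => f (a + r *: x)).
Proof.
move=> Lf LL'; split=> s B B0 L'B.
have -> : papp s (fun x => f (a + r *: x)) =
    papp [seq (p.1 * (fun=> 1) p.2, a + r *: p.2) | p <- s] f.
  by rewrite (papp_map s (fun=> 1) (fun x => a + r *: x)); apply: eq_papp => x; rewrite mul1r.
apply: (spec_le Lf) => // g Lg; rewrite (papp_map s (fun=> 1) (fun x => a + r *: x)).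
suff -> : papp s (fun x => 1 * chr g (a + r *: x)) = chr g a * papp s (chr (r *: g)).
  by rewrite cmodM cmod_chr mul1r; exact/L'B/LL'.
rewrite [RHS]mulr_sumr; apply: eq_bigr => p _.
by rewrite mul1r chrDr {2}/chr dotpZl -dotpZr mulrCA.
Qed.

(** A test functional sees finitely many points, so pointwise convergence passes to the pairing. *)
Lemma spec_lim L M (F : nat -> V -> R[i]) f : (forall n, spec L M (F n)) ->
  (forall x, (fun n => cmod (F n x - f x)) @ \oo --> (0 : R)) -> spec L M f.
Proof.
move=> LF Ff; split=> s B B0 LB.
have lim : (fun n => \sum_(p <- s) cmod p.1 * cmod (F n p.2 - f p.2)) @ \oo --> (0 : R).
  elim: s {LB} => [|p s IH].
    by under eq_fun do rewrite big_nil; exact: cvg_cst.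
  under eq_fun do rewrite big_cons.
  suff : (fun n => cmod p.1 * cmod (F n p.2 - f p.2) +
      \sum_(q <- s) cmod q.1 * cmod (F n q.2 - f q.2)) @ \oo --> (cmod p.1 * 0 + 0).
    by rewrite mulr0 addr0.
  by apply: cvgD => //; apply: cvgM => //; exact: cvg_cst.
apply/ler_addgt0Pr => e e0.
have [n _ /(_ n)/(_ (leqnn _)) hn] := cvgr_le _ lim _ e0.
have -> : papp s f = papp s (F n) - papp s (fun x => F n x - f x).
  by rewrite /papp -sumrB; apply: eq_bigr => p _; ring.
rewrite (le_trans (cmodB _ _))// lerD//; first exact: (spec_le (LF n)).
rewrite (le_trans (cmod_sum _ _ _))// (le_trans _ hn)//.
by apply: ler_sum => p _; rewrite cmodM.
Qed.

Definition box (b : 'I_d -> R) : set V := [set g | forall i, `|g ord0 i| <= b i].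

Lemma spec_prod (I : Type) (r : seq I) (b : I -> 'I_d -> R) (F : I -> V -> R[i]) :
  (forall k, spec (box (b k)) 1 (F k)) ->
  spec (box (fun j => \sum_(k <- r) b k j)) 1 (fun x => \prod_(k <- r) F k x).
Proof.
move=> bF; elim: r => [|k r IH].
  have : spec (box (fun=> 0)) 1 (chr 0 : V -> R[i]).
    by apply: spec_chr => i; rewrite mxE normr0.
  move=> /spec_sub h; refine (spec_eq (h _ _) _) => [g b0 i|x]; rewrite big_nil//.
  by rewrite /chr dotpC dotp0l mulr0 expi0.
rewrite -(mulr1 1); refine (spec_eq (spec_mul (bF k) IH _) _) => [a c ha hc i|x]; last by rewrite big_cons.
by rewrite mxE big_cons (le_trans (ler_normD _ _))// lerD.
Qed.

Lemma spec_cos (w : V) : spec (box (fun j => `|w ord0 j|)) 1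
  (fun x => cofR (cos (2 * pi * dotp x w))).
Proof.
have h g : (g = w \/ g = - w) -> spec (box (fun j => `|w ord0 j|)) 1 (chr g).
  by move=> gw; apply: spec_chr => i; case: gw => ->; rewrite ?mxE ?normrN.
have := spec_scale (cofR 2^-1) (spec_add (h w (or_introl erefl)) (h (- w) (or_intror erefl))).
rewrite cmod_cofR ger0_norm// (_ : 2^-1 * (1 + 1) = 1); last by field.
move=> /spec_eq; apply => x; rewrite /chr dotpNr mulrN expi_add_opp -cofRM.
by congr cofR; field.
Qed.

Lemma spec_sinc (w : V) : spec (box (fun j => `|w ord0 j|)) 1
  (fun x => cofR (sinc (2 * pi * dotp x w))).
Proof.
refine (@spec_lim _ _ (fun n x => \prod_(k < n) cofR (cos (2 * pi * dotp x w / 2 ^+ k.+1))) _ _ _).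
  move=> n.
  have h (k : 'I_n) : spec (box (fun j => `|(2 ^- k.+1 *: w) ord0 j|)) 1
      (fun x => cofR (cos (2 * pi * dotp x w / 2 ^+ k.+1))).
    by refine (spec_eq (spec_cos _) _) => x; rewrite dotpZr; congr (cofR (cos _)); ring.
  refine (spec_sub (spec_prod (index_enum 'I_n) h) _) => g hg j.
  rewrite (le_trans (hg j))//.
  under eq_bigr do rewrite mxE normrM.
  rewrite -mulr_suml ler_piMl//.
  (* The frequencies w / 2^(k+1) add up to (1 - 2^-n) w, so every partial product keeps its spectrum
     in the box of [w]. *)
  suff -> : \sum_(i < n) `|2 ^- i.+1| = 1 - 2 ^- n :> R.
    by rewrite lerBlDr lerDl invr_ge0 exprn_ge0.
  elim: n {h hg} => [|n IH]; first by rewrite big_ord0 expr0 invr1 subrr.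
  rewrite big_ord_recr/= IH ger0_norm ?invr_ge0 ?exprn_ge0// !exprS.
  by field; rewrite expf_neq0.
move=> x; have := @viete_cvg R (2 * pi * dotp x w).
move/cvgr_dist_le => h; apply/cvgrPdistC_le => e /h.
apply: filterS => n; rewrite distrC subr0 (ger0_norm (cmod_ge0 _)).
have -> : \prod_(k < n) cofR (cos (2 * pi * dotp x w / 2 ^+ k.+1)) =
    cofR (\prod_(k < n) cos (2 * pi * dotp x w / 2 ^+ k.+1)).
  by rewrite (big_morph (@cofR R) cofRM cofR1).
by rewrite -cmod_cofR !cofRE rmorphB.
Qed.

Definition cube (s : R) : set V := [set g | forall i, `|g ord0 i| <= s].

(** For s > 0, the Fourier transform of the uniform probability measure on [cube s]. *)
Definition ker (s : R) (x : V) : R := \prod_(i < d) sinc (2 * pi * (s * x ord0 i)).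

Lemma spec_ker (s : R) : 0 <= s -> spec (cube s) 1 (fun x => cofR (ker s x)).
Proof.
move=> s0; have h (i : 'I_d) := spec_sinc (s *: delta_mx ord0 i : V).
have := spec_prod (index_enum 'I_d) h.
move=> /spec_sub h'; refine (spec_eq (h' _ _) _) => [g hg j|x].
  rewrite (le_trans (hg j))// (bigD1 j)//= big1 => [|k kj]; rewrite !mxE eqxx/=.
    by rewrite addr0 eqxx mulr1 ger0_norm.
  by rewrite eq_sym (negbTE kj) mulr0 normr0.
rewrite /ker (big_morph (@cofR R) cofRM cofR1).
apply: eq_bigr => i _; congr (cofR (sinc (_ * _))).
rewrite dotpZr; congr (_ * _); rewrite /dotp (bigD1 i)//= big1 ?addr0.
  by rewrite mxE !eqxx mulr1.
by move=> j ji; rewrite mxE eqxx (negbTE ji) mulr0.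
Qed.

Lemma ker0 (s : R) : ker s 0 = 1.
Proof. by rewrite /ker big1// => i _; rewrite mxE !mulr0 /sinc eqxx. Qed.

Lemma ker_le1 (s : R) x : `|ker s x| <= 1.
Proof.
rewrite /ker normr_prod prodr_ile1// => i _.
by rewrite normr_ge0 sinc_le1.
Qed.

(** Decay in one coordinate, multiplied out so that a zero coordinate is no exception. The other
    factors are at most 1, and 2 pi >= 1 is dropped. *)
Lemma ker_le (s : R) x i : 0 < s -> `|ker s x| * (s * `|x ord0 i|) <= 1.
Proof.
move=> s0; have [->|xi0] := eqVneq (x ord0 i) 0; first by rewrite normr0 !mulr0.
have p0 : 0 < s * `|x ord0 i| by rewrite mulr_gt0 ?normr_gt0.
rewrite -ler_pdivlMr// mul1r /ker (bigD1 i)//= normrM.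
rewrite (@le_trans _ _ `|sinc (2 * pi * (s * x ord0 i))|)//.
  rewrite ler_piMr// normr_prod prodr_ile1// => j _.
  by rewrite normr_ge0 sinc_le1.
rewrite (le_trans (sinc_le _))//.
  by rewrite !mulf_neq0// gt_eqF// pi_gt0.
rewrite lef_pV2 ?posrE ?normr_gt0//; last by rewrite !mulf_neq0// gt_eqF// pi_gt0.
rewrite !normrM (ger0_norm (ltW s0)) ler_peMl ?(ltW p0)//.
by have := pi_ge2 R; rewrite (ger0_norm (pi_ge0 R))// ger0_norm//; lra.
Qed.

End SpectralClass.

(** * Modulus of continuity *)

Section Modulus.
Context {R : realType} {d : nat}.
Local Notation V := (Vec R d).
Implicit Types (f : V -> R[i]) (g x y w : V) (s t : seq (R[i] * V)) (L : set V).

(** Characters are eigenfunctions of this difference operator; the eigenvalue [papp s (chr g)] is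
    its symbol. *)
Definition opl s f x : R[i] := \sum_(p <- s) p.1 * f (x + p.2).

Lemma opl0 s f : opl s f 0 = papp s f.
Proof. by apply: eq_bigr => p _; rewrite add0r. Qed.

Lemma opl_chr s g x : opl s (chr g) x = papp s (chr g) * chr g x.
Proof.
rewrite /papp mulr_suml; apply: eq_bigr => p _.
by rewrite chrDr -mulrA (mulrC (chr g x)).
Qed.

Lemma opl_cat s t f x : opl (s ++ t) f x = opl s f x + opl t f x.
Proof. by rewrite /opl big_cat. Qed.

Definition scl (c : R[i]) s := [seq (c * p.1, p.2) | p <- s].

Lemma opl_scl c s f x : opl (scl c s) f x = c * opl s f x.
Proof. by rewrite /opl big_map mulr_sumr; apply: eq_bigr => p _; rewrite mulrA. Qed.

Lemma papp_scl c s f : papp (scl c s) f = c * papp s f.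
Proof. by rewrite -!opl0 opl_scl. Qed.

Definition convl s t := [seq (p.1 * q.1, p.2 + q.2) | p <- s, q <- t].

Lemma opl_conv s t f x : opl (convl s t) f x = opl s (opl t f) x.
Proof.
rewrite /opl big_allpairs_dep; apply: eq_bigr => p _; rewrite mulr_sumr.
by apply: eq_bigr => q _; rewrite mulrA addrA.
Qed.

Lemma papp_conv s t g : papp (convl s t) (chr g) = papp s (chr g) * papp t (chr g).
Proof.
rewrite -!opl0 opl_conv opl0 [RHS]mulrC -opl0 /papp mulr_sumr.
apply: eq_bigr => p _; rewrite opl_chr opl0 mulrCA; congr (_ * _).
Qed.

Lemma spec_opl L M f s : spec L M f ->
  spec L (\sum_(p <- s) cmod p.1 * M) (opl s f).
Proof.
move=> Lf; refine (spec_sum s (F := fun p x => p.1 * f (x + p.2)) _) => p.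
apply: spec_scale; refine (spec_eq (spec_affine (L' := L) p.2 (r := 1) Lf _) _).
  by move=> g; rewrite scale1r.
by move=> x; rewrite scale1r addrC.
Qed.

Lemma spec_opl_dist L M f s t (e : R) x : spec L M f -> 0 <= e ->
  (forall g, L g -> cmod (papp s (chr g) - papp t (chr g)) <= e) ->
  cmod (opl s f x - opl t f x) <= M * e.
Proof.
move=> Lf e0 st.
have h u f' : opl u f' x = papp [seq (p.1, x + p.2) | p <- u] f'.
  by rewrite /papp big_map.
have -> : opl s f x - opl t f x = opl (s ++ scl (-1) t) f x.
  by rewrite opl_cat opl_scl mulN1r.
rewrite h; apply: spec_le Lf e0 _ => g Lg.
rewrite -h opl_cat opl_scl mulN1r !opl_chr -mulrBl cmodM cmod_chr mulr1.
exact: st.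
Qed.

(** Operator norm for the sup norm on functions with spectrum in [L]. [M] is quantified inside, so
    that [a] cannot depend on the mass. *)
Definition opn L s (a : R) := forall M f (N : R), spec L M f ->
  (forall x, cmod (f x) <= N) -> forall x, cmod (opl s f x) <= a * N.

(** A normalized second difference, with symbol sin^2(pi w.g). *)
Definition Uop w : seq (R[i] * V) :=
  [:: (cofR (2^-1), 0); (cofR (- 4^-1), w); (cofR (- 4^-1), - w)].

(** A centered difference, with symbol i sin(2 pi w.g); its norm is what controls the modulus of
    continuity. *)
Definition Sop w : seq (R[i] * V) := [:: (cofR (2^-1), w); (cofR (- 2^-1), - w)].

Lemma opl_U w f x : opl (Uop w) f x =
  cofR 2^-1 * f x - cofR 4^-1 * (f (x + w) + f (x - w)).
Proof.
rewrite /opl !big_cons big_nil /= !addr0 !cofRE !rmorphN !mulNr.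
by rewrite mulrDr opprD.
Qed.

Lemma opl_S w f x : opl (Sop w) f x = cofR 2^-1 * (f (x + w) - f (x - w)).
Proof.
rewrite /opl !big_cons big_nil /= !addr0 !cofRE !rmorphN !mulNr.
by rewrite mulrBr.
Qed.

Lemma papp_U w g :
  papp (Uop w) (chr g) = cofR (2^-1 * (1 - cos (2 * pi * dotp w g))).
Proof.
rewrite -opl0 opl_U add0r sub0r chr0 mulr1 /chr dotpNl mulrN expi_add_opp.
by rewrite !cofRE -rmorphM -rmorphB; congr (_%:C)%C; field.
Qed.

Lemma opn_U1 L w : opn L (Uop w) 1.
Proof.
move=> M f N _ fN x; rewrite opl_U (le_trans (cmodB _ _))// !cmodM !cmod_cofR.
rewrite !ger0_norm//.
have h1 := fN x; have h2 := le_trans (cmodD _ _) (lerD (fN (x + w)) (fN (x - w))).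
by move: h1 h2; lra.
Qed.

Lemma opn_S1 L w : opn L (Sop w) 1.
Proof.
move=> M f N _ fN x; rewrite opl_S cmodM cmod_cofR ger0_norm//.
have h2 := le_trans (cmodB _ _) (lerD (fN (x + w)) (fN (x - w))).
by move: h2; lra.
Qed.

(** With u = sin^2(2 theta) and v = sin^2(theta) one has v = u / 4 + v^2; iterating
    this equation from 0 expresses the multiplier v as a limit of polynomials in u
    with nonnegative coefficients. *)
Fixpoint Titer w n : seq (R[i] * V) :=
  if n is m.+1 then scl (cofR 4^-1) (Uop w) ++ convl (Titer w m) (Titer w m)
  else [::].

Lemma TiterS w n :
  Titer w n.+1 = scl (cofR 4^-1) (Uop w) ++ convl (Titer w n) (Titer w n).
Proof. by []. Qed.

Lemma opn_T L w n (a b : R) : opn L (Uop w) a -> 0 <= b -> a / 4 + b ^+ 2 <= b ->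
  opn L (Titer w n) b.
Proof.
move=> Ua b0 ab; elim: n => [|n IH] M f N Lf fN x.
  by rewrite /opl big_nil cmod0 mulr_ge0// (le_trans (cmod_ge0 _) (fN 0)).
have N0 : 0 <= N by rewrite (le_trans (cmod_ge0 _) (fN 0)).
rewrite TiterS opl_cat opl_scl opl_conv (le_trans (cmodD _ _))//.
rewrite (le_trans _ (ler_wpM2r N0 ab))// mulrDl cmodM cmod_cofR ger0_norm//.
apply: lerD; first by rewrite mulrAC (mulrC _ 4^-1) ler_wpM2l// (Ua _ _ _ Lf).
rewrite expr2 -mulrA; apply: (IH _ _ _ (spec_opl (Titer w n) Lf)) => y.
exact: (IH _ _ _ Lf).
Qed.

Lemma symbol_T w g n : `|2 * pi * dotp w g| <= 1 ->
  let v := 2^-1 * (1 - cos (2 * pi * dotp w g)) in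
  exists2 t : R, papp (Titer (w + w) n) (chr g) = cofR t & t <= v /\ v - t <= 2^- n /\ 0 <= t.
Proof.
set th := 2 * pi * dotp w g => th1 v.
have th2 : th ^+ 2 <= 1 by rewrite -real_normK ?num_real// expr_le1.
(* From v <= 1/4 and t <= v, each iteration multiplies the error v - t by v + t <= 1/2. *)
have v4 : 0 <= v <= 4^-1.
  have := one_sub_cos_le th; have := cos_le1 th; rewrite /v.
  by move: th2; set q := th ^+ 2; lra.
have u4 : papp (Uop (w + w)) (chr g) = cofR (4 * (v - v ^+ 2)).
  have dd : 2 * pi * dotp (w + w) g = th *+ 2 by rewrite dotpDl mulrDr mulr2n.
  rewrite papp_U dd cos_mulr2n; congr cofR.
  by rewrite /v -mulr_natr; field.
elim: n => [|n [t e [tv [vt t0]]]].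
  exists 0; first by rewrite /papp big_nil.
  by rewrite expr0 invr1; lra.
exists (v - v ^+ 2 + t ^+ 2).
  rewrite TiterS papp_cat papp_scl papp_conv e u4 cofRD; congr (_ + _).
    by rewrite -cofRM; congr cofR; field.
  by rewrite -cofRM expr2.
rewrite (exprS 2 n) invfM.
move: vt; set z := 2 ^- n => vt.
by split; [|split]; nra.
Qed.

(** Carries a bound from step [w + w] to step [w]: the iterates have norm at most [b], and their
    symbols approach that of [Uop w] with an error [M * 2 ^- n] that vanishes. *)
Lemma opn_half L w (a b : R) : (forall g, L g -> `|2 * pi * dotp w g| <= 1) ->
  opn L (Uop (w + w)) a -> 0 <= b -> a / 4 + b ^+ 2 <= b -> opn L (Uop w) b.
Proof.
move=> Lw Ua b0 ab M f N Lf fN x; have M0 := spec_ge0 Lf.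
apply/ler_addgt0Pr => e e0.
have : (fun n => M * 2 ^- n) @ \oo --> (M * 0).
  by apply: cvgM; [exact: cvg_cst|exact: cvg_half_pow].
rewrite mulr0 => lim.
have [n _ /(_ n)/(_ (leqnn _)) hn] := cvgr_le _ lim _ e0.
rewrite -(subrK (opl (Titer (w + w) n) f x) (opl (Uop w) f x)).
rewrite (le_trans (cmodD _ _))// [leRHS]addrC lerD//; last first.
  exact: (@opn_T _ _ n _ _ Ua b0 ab _ _ _ Lf fN x).
rewrite (le_trans _ hn)//; apply: spec_opl_dist Lf _ _ => [|g /Lw h].
  by rewrite invr_ge0 exprn_ge0.
have [t -> [tv [vt _]]] := symbol_T n h.
rewrite papp_U -cofRB cmod_cofR ger0_norm//.
by rewrite subr_ge0.
Qed.

Definition dyad w n := 2 ^- n *: w.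

Lemma dyadS w n : dyad w n.+1 + dyad w n.+1 = dyad w n.
Proof.
by rewrite -scalerDl; congr (_ *: _); rewrite exprS; field; rewrite expf_neq0.
Qed.

(** The pairs (1, 1/2), (1/2, 1/6), (1/6, 1/6) are admissible for [opn_half]. Two halvings bring the
    norm below 1/4, the threshold under which [opl_S_split] contracts, and later ones keep it
    there. *)
Lemma opn_dyad L w n : (forall g, L g -> `|2 * pi * dotp w g| <= 2) ->
  opn L (Uop (dyad w n.+2)) 6^-1.
Proof.
move=> Lw; have Lk k g : L g -> `|2 * pi * dotp (dyad w k.+1) g| <= 1.
  move=> /Lw h; rewrite dotpZl mulrCA normrM.
  have := ler_wpM2l (normr_ge0 (2 ^- k.+1)) h => /le_trans; apply.
  rewrite ger0_norm ?invr_ge0 ?exprn_ge0// exprS invfM mulrAC mulVf// mul1r.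
  rewrite invf_le1 ?exprn_gt0//.
  by rewrite exprn_ege1// ler1n.
elim: n => [|n IH].
  apply: (@opn_half _ _ 2^-1); [exact: Lk| |by []|by lra].
  rewrite dyadS; apply: (@opn_half _ _ 1); [exact: Lk| |by []|by lra].
  exact: opn_U1.
apply: (@opn_half _ _ 6^-1); [exact: Lk| |by []|by lra].
by rewrite dyadS.
Qed.

(** On symbols: sin p = sin(2 p) / 2 + 2 sin(p) sin^2(p / 2). *)
Lemma opl_S_split w f x :
  opl (Sop w) f x = cofR 2^-1 * opl (Sop (w + w)) f x
                    + cofR 2 * opl (Sop w) (opl (Uop w) f) x.
Proof.
rewrite !opl_S !opl_U.
have -> : x + w + w = x + (w + w) by rewrite addrA.
have -> : x - w - w = x - (w + w) by rewrite opprD addrA.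
rewrite addrK subrK.
have -> : cofR 4^-1 = cofR 2^-1 * cofR 2^-1 :> R[i] by rewrite -cofRM; congr cofR; field.
have e2 : cofR 2 * cofR 2^-1 = 1 :> R[i] by rewrite -cofRM divff.
move: e2; move: (cofR 2) (cofR 2^-1) => b c e2.
have -> : c * (f (x + w) - f (x - w)) = b * c * (c * (f (x + w) - f (x - w))).
  by rewrite e2 mul1r.
have -> : c * (c * (f (x + (w + w)) - f (x - (w + w)))) =
  b * c * (c * (c * (f (x + (w + w)) - f (x - (w + w))))) by rewrite e2 mul1r.
by ring.
Qed.

(** In the splitting the coarser step contributes a factor 1/2 and the finer one 2 * 1/6, in all
    5/6. *)
Lemma opn_S_dyad L w n k : (forall g, L g -> `|2 * pi * dotp w g| <= 2) -> (n < k)%N ->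
  opn L (Sop (dyad w k)) ((5 / 6) ^+ n).
Proof.
move=> Lw; elim: n k => [|n IH] [|k] //; first by move=> _; exact: opn_S1.
rewrite ltnS => nk M f N Lf fN x.
rewrite opl_S_split dyadS (le_trans (cmodD _ _))// !cmodM !cmod_cofR !ger0_norm//.
have h1 := IH _ nk _ _ _ Lf fN x.
case: k nk h1 => // k nk h1.
have h2 := IH k.+2 (leqW nk) _ _ _ (spec_opl _ Lf) (opn_dyad k Lw Lf fN) x.
by move: h1 h2; rewrite exprS mulrA; lra.
Qed.

(** A qualitative form of Bernstein's inequality. *)
Lemma spec_modulus (sg e : R) : 0 <= sg -> 0 < e -> exists2 al : R, 0 < al &
  forall M f (N : R), spec (cube sg) M f -> (forall x, cmod (f x) <= N) ->
  forall x w, `|w| <= al -> cmod (f (x + w) - f x) <= e * N.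
Proof.
move=> sg0 e0.
have lim : (fun n => 2 * (5 / 6) ^+ n : R) @ \oo --> (2 * 0 : R).
  apply: cvgM; first exact: cvg_cst.
  by apply: cvg_expr; rewrite ger0_norm; lra.
have e0' : 2 * 0 < e by rewrite mulr0.
have [n _ /(_ n)/(_ (leqnn _)) hn] := cvgr_le _ lim _ e0'.
have D0 : 0 < pi * 2 ^+ n * (d%:R * sg + 1) :> R.
  by rewrite !mulr_gt0 ?pi_gt0 ?exprn_gt0// ltr_wpDl// mulr_ge0.
(* f (x + w) - f x is twice the centered difference of step w / 2 at the midpoint, and w / 2 is the
   dyadic fraction of order n + 1 of 2^n w. The radius gives |2 pi (2^n w).g| <= 2 on the cube; the
   [+ 1] keeps the denominator positive. *)
exists (pi * 2 ^+ n * (d%:R * sg + 1))^-1; first by rewrite invr_gt0.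
move=> M f N Lf fN x w wal; have N0 := le_trans (cmod_ge0 _) (fN 0).
have Lw g : cube sg g -> `|2 * pi * dotp (2 ^+ n *: w) g| <= 2.
  move=> /(norm_le_coord sg0) gsg; rewrite dotpZl -mulrA normrM (ger0_norm (_ : 0 <= 2))//.
  rewrite -[leRHS]mulr1 ler_wpM2l// !normrM ger0_norm ?pi_ge0// ger0_norm ?exprn_ge0//.
  rewrite (@le_trans _ _ (pi * (2 ^+ n * (d%:R * (`|w| * `|g|)))))//.
    by rewrite ler_wpM2l ?pi_ge0// ler_wpM2l ?exprn_ge0// dotp_le.
  rewrite (@le_trans _ _ (pi * 2 ^+ n * (d%:R * sg + 1) * `|w|))//; last first.
    by rewrite mulrC -ler_pdivlMr// div1r.
  rewrite -!mulrA ler_wpM2l ?pi_ge0// ler_wpM2l ?exprn_ge0//.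
  have : d%:R * (`|w| * `|g|) <= d%:R * (`|w| * sg).
    by rewrite ler_wpM2l// ler_wpM2l.
  by have := normr_ge0 w; lra.
have := opn_S_dyad Lw (leqnn n.+1) Lf fN (x + 2^-1 *: w).
have -> : dyad (2 ^+ n *: w) n.+1 = 2^-1 *: w.
  by rewrite /dyad scalerA exprS invfM -mulrA mulVf ?mulr1// expf_neq0.
rewrite opl_S addrK -addrA -scalerDl (_ : 2^-1 + 2^-1 = 1); last by field.
rewrite scale1r cmodM cmod_cofR ger0_norm// => h.
rewrite (@le_trans _ _ (2 * (5 / 6) ^+ n * N))//; first by lra.
by rewrite ler_wpM2r.
Qed.

End Modulus.

(** * Sup-norm sampling sets *)

Section Sampling.
Context {R : realType} {d : nat}.
Local Notation V := (Vec R d).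
Implicit Types (f : V -> R[i]) (g x y w : V) (L E : set V).

Definition samp E L (K : R) := forall M f (S : R), spec L M f -> 0 <= S ->
  (forall x, E x -> cmod (f x) <= S) -> forall y, cmod (f y) <= K * S.

Definition fat L (e : R) : set V := [set g | exists a b, [/\ L a, cube e b & g = a + b]].

(** Absorption without a supremum: the improvement N -> c + N / 2 is iterated from the a priori
    bound and tends to its fixed point 2 c. *)
Lemma bound_half f (c N : R) : 0 <= c ->
  (forall N, (forall x, cmod (f x) <= N) -> forall x, cmod (f x) <= c + N / 2) ->
  (forall x, cmod (f x) <= N) -> forall x, cmod (f x) <= 2 * c.
Proof.
move=> c0 h fN x.
have h' n : forall x, cmod (f x) <= 2 * c + N * 2 ^- n.
  elim: n => [|n IH] z; first by rewrite expr0 invr1 mulr1 (le_trans (fN z))// lerDr mulr_ge0.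
  apply: le_trans (h _ IH z) _; rewrite (exprS 2 n) invfM; set q := 2 ^- n; lra.
apply/ler_addgt0Pr => e e0.
have : (fun n => N * 2 ^- n) @ \oo --> (N * 0).
  by apply: cvgM; [exact: cvg_cst|exact: cvg_half_pow].
rewrite mulr0 => lim.
have [n _ /(_ n)/(_ (leqnn _)) hn] := cvgr_le _ lim _ e0.
by rewrite (le_trans (h' n x))// lerD2l.
Qed.

Lemma sum_at_most_one n (P : pred 'I_n) : (forall j k, P j -> P k -> j = k) ->
  \sum_(j < n) (P j)%:R <= 1 :> R.
Proof.
move=> PP; have [/existsP[j Pj]|/existsPn nP] := boolP [exists j, P j].
  rewrite (bigD1 j)//= big1 ?addr0 ?Pj// => k kj.
  by case: (boolP (P k)) => // Pk; move: kj; rewrite (PP _ _ Pk Pj) eqxx.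
by rewrite big1 ?ler01// => j _; rewrite (negbTE (nP j)).
Qed.

Lemma ker_le_norm (s : R) x : 0 < s -> `|ker s x| * (s * `|x|) <= 1.
Proof.
move=> s0; have s0' := ltW s0.
rewrite (_ : _ * _ = `|(`|ker s x| * s) *: x|); last first.
  by rewrite normrZ ger0_norm ?mulr_ge0// mulrA.
apply: norm_le_coord => // i; rewrite mxE normrM ger0_norm ?mulr_ge0//.
by rewrite -mulrA ker_le.
Qed.

Lemma ker_shift_spec (s : R) y : 0 <= s ->
  spec (cube s) 1 (fun x => cofR (ker s (x - y))).
Proof.
move=> s0; refine (spec_eq (spec_affine (L' := cube s) (- y) (r := 1) (spec_ker s0) _) _).
  by move=> g; rewrite scale1r.
by move=> x; rewrite scale1r addrC.
Qed.

(** The spectrum of [f] is slightly too large for the hypothesis. Contracting [f]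
    towards [y] by a factor [1 - t] and multiplying by a kernel decaying at scale
    [1 / t] brings the spectrum back into [L], at the price of an error which is
    not small only at distance about [1 / t] from [y]. Averaging over [J] very
    different scales [t] makes the error small everywhere. *)
Lemma samp_fat E L (rho sg K : R) : convex_Rd L -> 0 < rho -> cube rho `<=` L ->
  0 <= sg -> L `<=` cube sg -> 0 < K -> samp E L K ->
  exists2 e : R, 0 < e & samp E (fat L e) (2 * K).
Proof.
move=> Lcvx rho0 rhoL sg0 Lsg K0 EL.
(* The final estimate is K (S + et N + N / J) with 1 / J <= et; this choice leaves K S + N / 2 for
   [bound_half]. *)
pose et := (4 * K)^-1; have et0 : 0 < et by rewrite invr_gt0 mulr_gt0.
have [al al0 fal] := @spec_modulus R d (sg + rho) et (addr_ge0 sg0 (ltW rho0)) et0.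
(* At distance be / tau from [y] the kernel of parameter rho tau / 2 has dropped to 2 / (rho be) =
   et. *)
pose be := 2 / (rho * et); have be0 : 0 < be by rewrite divr_gt0// mulr_gt0.
have D0 : 0 < be + 2 * al by lra.
(* As q be <= al, the windows al < tau |x - y| < be of different scales tau = q^j are disjoint. *)
pose q := al / (be + 2 * al).
have q0 : 0 < q by rewrite divr_gt0.
have qbe : q * be <= al.
  by rewrite /q mulrAC ler_pdivrMr// ler_wpM2l ?(ltW al0)// lerDl mulr_ge0 ?ltW.
have q1 : q <= 2^-1.
  by rewrite /q ler_pdivrMr//; move: al0 be0; lra.
have [J0 J0K] : exists n : nat, et^-1 <= n%:R.
  exists (Num.bound et^-1); apply: ltW; apply: archi_boundP.
  by rewrite invr_ge0 ltW.
pose J := J0.+1.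
have J_gt0 : 0 < J%:R :> R by rewrite ltr0n.
have JK : J%:R^-1 <= et.
  have iet0 : 0 < et^-1 by rewrite invr_gt0.
  rewrite -[leRHS]invrK lef_pV2 ?posrE//.
  by rewrite (le_trans J0K)// ler_nat.
pose tau (j : 'I_J) := q ^+ j.+1.
have tau0 j : 0 < tau j by rewrite exprn_gt0.
have tau1 j : tau j <= 2^-1.
  rewrite (le_trans _ q1)// /tau exprS ler_piMr ?(ltW q0)//.
  by rewrite exprn_ile1 ?(ltW q0)//; move: q1; lra.
(* Half of rho tau at the smallest scale, so that every scale can absorb the excess spectrum; the
   other half goes to the kernel. *)
pose e := rho * q ^+ J / 2.
have e0 : 0 < e by rewrite divr_gt0// mulr_gt0// exprn_gt0.
have etau j : e <= rho * tau j / 2.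
  rewrite ler_wpM2r// ler_wpM2l ?(ltW rho0)//.
  by apply: ler_wiXn2l; [exact: ltW|move: q1; lra|exact: ltn_ord].
exists e; first exact: e0.
move=> M f S Lf S0 fS.
have erho : e <= rho.
  by have := etau ord0; have := tau1 ord0; move: rho0; nra.
have Lf' : spec (cube (sg + rho)) M f.
  apply: (spec_sub Lf) => g [a [b [/Lsg ha hb ->]]] i.
  by rewrite mxE (le_trans (ler_normD _ _))// lerD// (le_trans (hb i)).
rewrite -mulrA => y; apply: (bound_half (N := M)) => [||x]; last exact: spec_bound Lf.
  by rewrite mulr_ge0// ltW.
move=> {}N fN {}y; have N0 := le_trans (cmod_ge0 _) (fN 0).
pose s j := rho * tau j / 2.
have s0 j : 0 < s j by rewrite divr_gt0// mulr_gt0.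
pose G j x := f (y + (1 - tau j) *: (x - y)) * cofR (ker (s j) (x - y)).
have LG j : spec L (M * 1) (G j).
  have r0 : 0 <= 1 - tau j by have := tau1 j; lra.
  apply: (@spec_mul _ _ [set (1 - tau j) *: g | g in fat L e] (cube (s j))).
  - refine (spec_eq (spec_affine (L' := [set (1 - tau j) *: g | g in fat L e])
      (y - (1 - tau j) *: y) (r := 1 - tau j) Lf _) _); first by move=> g Lg; exists g.
    by move=> x; rewrite scalerBr addrA addrAC.
  - exact: ker_shift_spec (ltW (s0 j)).
  move=> _ c [_ [a [b [La hb ->]] <-]] hc.
  (* The perturbation (1 - tau) b + c is at most rho tau in each coordinate, that is, tau times a
     point of the cube inside [L]; the frequency is thus a convex combination. *)
  have -> : (1 - tau j) *: (a + b) + c = (1 - tau j) *: a +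
      (1 - (1 - tau j)) *: ((tau j)^-1 *: ((1 - tau j) *: b + c)).
    rewrite subKr scalerA mulfV ?scale1r ?gt_eqF//.
    by rewrite scalerDr addrA.
  apply: Lcvx => //; last by have := tau1 j; have := tau0 j; lra.
  apply: rhoL => i; rewrite !mxE normrM ger0_norm ?invr_ge0 ?(ltW (tau0 j))//.
  rewrite mulrC ler_pdivrMr// (le_trans (ler_normD _ _))//.
  have hb' : `|(1 - tau j) * b ord0 i| <= rho * tau j / 2.
    rewrite normrM (ger0_norm r0) (le_trans _ (etau j))//.
    rewrite (le_trans _ (hb i))// ler_piMl//.
    by have := tau0 j; lra.
  by have := hc i; rewrite /s; lra.
have G_y j : G j y = f y.
  by rewrite /G subrr scaler0 addr0 ker0 cofR1 mulr1.
pose bad x j := (al < tau j * `|x - y|) && (tau j * `|x - y| < be).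
have bad1 x (j k : 'I_J) : bad x j -> bad x k -> j = k.
  have H (a b : 'I_J) : bad x a -> bad x b -> ~ (a < b)%N.
    move: a b => {}j {}k; move=> /andP[_ jbe] /andP[kal _] jk.
    have : tau k <= q * tau j.
      rewrite -exprS; apply: ler_wiXn2l; [exact: ltW|move: q1; lra|by []].
    have := normr_ge0 (x - y); set D := `|x - y| in kal jbe * => DD0 tkj.
    have : tau k * D <= q * (tau j * D) by rewrite mulrA ler_wpM2r.
    by move: kal qbe; have : q * (tau j * D) < q * be; [rewrite ltr_pM2l//|lra].
  move=> bj bk; apply: contrapT => /eqP; rewrite neq_ltn => /orP[|].
    exact: (H _ _ bj bk).
  exact: (H _ _ bk bj).
have G_E x j : E x -> cmod (G j x) <= S + et * N + (bad x j)%:R * N.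
  move=> Ex; rewrite cmodM cmod_cofR.
  have etN0 : 0 <= et * N by rewrite mulr_ge0// ltW.
  have [bx|] := boolP (bad x j).
    rewrite mul1r ler_wpDl ?addr_ge0// -[leRHS]mulr1 ler_pM ?cmod_ge0//.
    exact: ker_le1.
  (* Close to [y] the contraction moves [x] by at most [al] and the modulus of continuity applies;
     far away the kernel is at most [et]. *)
  rewrite negb_and -!leNgt mul0r addr0 => /orP[h|h].
    rewrite -[leRHS]mulr1 ler_pM ?cmod_ge0//; last exact: ker_le1.
    have -> : y + (1 - tau j) *: (x - y) = x + (- tau j) *: (x - y).
      by rewrite scalerBl scale1r scaleNr addrA [y + _]addrC subrK.
    have -> : f (x + (- tau j) *: (x - y)) = f x + (f (x + (- tau j) *: (x - y)) - f x).
      by rewrite [RHS]addrC subrK.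
    rewrite (le_trans (cmodD _ _))// lerD//; first exact: fS.
    by apply: (fal M) => //; rewrite normrZ normrN ger0_norm// ltW.
  rewrite ler_wpDl// mulrC ler_pM ?cmod_ge0//.
  have := ker_le_norm (x - y) (s0 j); set k := `|ker _ _|; set D := `|x - y| in h * => hk.
  have k0 : 0 <= k by exact: normr_ge0.
  have : k * (rho * be / 2) <= 1.
    apply: le_trans hk; rewrite ler_wpM2l// /s.
    have : rho * be <= rho * (tau j * D) by rewrite ler_wpM2l// ltW.
    lra.
  rewrite (_ : rho * be / 2 = et^-1); last first.
    by rewrite /be; field; rewrite !gt_eqF.
  by rewrite ler_pdivrMr// mul1r.
have LH := @spec_scale _ _ _ _ _ (cofR J%:R^-1) (spec_sum (M := fun=> M * 1) (F := G) (index_enum 'I_J) LG).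
have h := EL _ _ (S + et * N + J%:R^-1 * N) LH.
have -> : f y = cofR J%:R^-1 * \sum_(j <- index_enum 'I_J) G j y.
  under eq_bigr do rewrite G_y.
  rewrite sumr_const card_ord -(mulr_natl (f y)) mulrA.
  have -> : (J%:R : R[i]) = cofR J%:R by rewrite cofRE rmorph_nat.
  by rewrite -cofRM mulVf ?mul1r ?gt_eqF.
apply: le_trans (h _ _ y) _.
- by rewrite !addr_ge0// mulr_ge0// ltW// invr_gt0.
- move=> x Ex; rewrite cmodM cmod_cofR ger0_norm ?invr_ge0//.
  rewrite ler_pdivrMl// (le_trans (cmod_sum _ _ _))//.
  rewrite (le_trans (ler_sum _ (fun j _ => G_E x j Ex)))//.
  rewrite big_split/= sumr_const card_ord -mulr_suml mulrDr -(mulr_natl (S + et * N)).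
  rewrite lerD2l mulrA mulfV ?gt_eqF// ler_wpM2r// sum_at_most_one//.
  exact: bad1.
have : K * (et * N) = N / 4 by rewrite /et; field; rewrite gt_eqF.
have : K * (J%:R^-1 * N) <= K * (et * N) by rewrite ler_wpM2l ?(ltW K0)// ler_wpM2r.
lra.
Qed.

Definition lattice (T : R) : set V :=
  [set x | exists n : 'I_d -> int, forall i, x ord0 i = (n i)%:~R / T].

(** The mesh is finer than a radius on which [f] varies by at most half its supremum, and
    [bound_half] turns that half into the constant 2. *)
Lemma samp_lattice (sg : R) : 0 <= sg -> exists2 T0 : R, 0 < T0 &
  forall T, T0 <= T -> samp (lattice T) (cube sg) 2.
Proof.
move=> sg0; have [al al0 fal] := @spec_modulus R d sg 2^-1 sg0 (ltac:(by [])).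
exists al^-1; first by rewrite invr_gt0.
move=> T T0 M f S Lf S0 fS; have Tgt0 : 0 < T by rewrite (lt_le_trans _ T0)// invr_gt0.
apply: (bound_half (N := M)) => [//||x]; last exact: spec_bound Lf.
move=> N fN y; pose x : V := \row_i ((Num.floor (T * y ord0 i))%:~R / T).
have xy : `|y - x| <= al.
  apply: norm_le_coord => [|i]; first exact: ltW.
  rewrite !mxE; have h1 := floor_le (T * y ord0 i); have h2 := floorD1_gt (T * y ord0 i).
  rewrite intrD in h2.
  have -> : y ord0 i - (Num.floor (T * y ord0 i))%:~R / T =
    (T * y ord0 i - (Num.floor (T * y ord0 i))%:~R) / T by field; rewrite gt_eqF.
  rewrite ger0_norm; last by rewrite divr_ge0 ?subr_ge0// ltW.
  rewrite ler_pdivrMr//; apply: (@le_trans _ _ 1); first by move: h2; lra.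
  by rewrite mulrC -ler_pdivrMr// div1r.
have := fal M f N Lf fN x (y - x) xy; rewrite [x + _]addrC subrK => h.
rewrite -(subrK (f x) (f y)) (le_trans (cmodD _ _))// [leRHS]addrC lerD//; last first.
  by apply: fS; exists (fun i => Num.floor (T * y ord0 i)) => i; rewrite mxE.
by rewrite mulrC.
Qed.

End Sampling.

(** * Comparison of sampled energies *)

Section Energy.
Context {R : realType} {d : nat}.
Local Notation V := (Vec R d).
Implicit Types (f u : V -> R[i]) (g x y w : V) (L E : set V).

Lemma esum_seq_le (T : choiceType) (E : set T) (a : T -> \bar R) (Y : seq T) :
  (forall x : T, (0 <= a x)%E) -> uniq Y -> (forall y : T, y \in Y -> E y) ->
  (\sum_(y <- Y) a y <= \esum_(y in E) a y)%E.
Proof.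
move=> a0 uY YE; apply: esum_ge; exists [set` Y]; last by rewrite fsbig_seq.
by split => // y /= /YE.
Qed.

Lemma esum_le_seq (T : choiceType) (E : set T) (a : T -> \bar R) (z : \bar R) :
  (forall Y : seq T, uniq Y -> (forall y : T, y \in Y -> E y) -> (\sum_(y <- Y) a y <= z)%E) ->
  (\esum_(y in E) a y <= z)%E.
Proof.
move=> h; apply: ge_ereal_sup => _ [A [Afin AE] <-].
rewrite fsbig_finite//=; apply: h => // y.
by rewrite in_fset_set// inE => /AE.
Qed.

Lemma esum_scale_le (T : choiceType) (E : set T) (a : T -> \bar R) (c : R) : 0 <= c ->
  (forall x : T, (0 <= a x)%E) ->
  (\esum_(y in E) (c%:E * a y) <= c%:E * \esum_(y in E) a y)%E.
Proof.
move=> c0 a0; apply: esum_le_seq => Y uY YE.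
rewrite -ge0_sume_distrr; last by move=> i _.
by apply: lee_wpmul2l; rewrite ?lee_fin//; exact: esum_seq_le.
Qed.

Definition energy E u : \bar R := \esum_(x in E) (cmod (u x) ^+ 2)%:E.

Definition ker_bessel E (e C : R) := forall x (Y : seq V), uniq Y ->
  (forall y, y \in Y -> E y) -> \sum_(y <- Y) ker e (x - y) ^+ 2 <= C.

(** Sampling is applied to [u] times the kernel centred at [y], a product equal to [u y] at [y].
    Bounding each sample by the l^2 sum of all of them makes the estimate summable in [y], thanks to
    the decay of the kernel. *)
Lemma samp_energy_pt E L (e K M : R) u y : 0 < e -> 0 < K -> samp E (fat L e) K -> spec L M u ->
  ((cmod (u y) ^+ 2)%:E <=
    (K ^+ 2)%:E * \esum_(x in E) (ker e (x - y) ^+ 2 * cmod (u x) ^+ 2)%:E)%E.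
Proof.
move=> e0 K0 EL Lu.
have a0 x : (0 <= (ker e (x - y) ^+ 2 * cmod (u x) ^+ 2)%:E)%E.
  by rewrite lee_fin mulr_ge0 ?sqr_ge0.
have := esum_ge0 (S := E) (fun x _ => a0 x).
case es : (esum _ _) => [s| |]//; last by move=> _; rewrite gt0_muley ?lte_fin ?exprn_gt0// leey.
rewrite lee_fin => s0; rewrite -EFinM lee_fin.
rewrite -(sqr_sqrtr s0) -exprMn ler_sqr ?nnegrE ?cmod_ge0 ?mulr_ge0 ?sqrtr_ge0 ?(ltW K0)//.
have Luk : spec (fat L e) (M * 1) (fun x => u x * cofR (ker e (x - y))).
  apply: spec_mul Lu (ker_shift_spec y (ltW e0)) _ => a b La eb.
  by exists a, b.
have h := EL _ _ (Num.sqrt s) Luk (sqrtr_ge0 s).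
have := h _ y; rewrite subrr ker0 cofR1 mulr1; apply => x Ex.
rewrite cmodM cmod_cofR -ler_sqr ?nnegrE ?sqrtr_ge0 ?mulr_ge0 ?cmod_ge0//.
rewrite sqr_sqrtr// exprMn real_normK ?num_real// mulrC -lee_fin -es.
have := @esum_seq_le _ E (fun x => (ker e (x - y) ^+ 2 * cmod (u x) ^+ 2)%:E) [:: x] a0.
rewrite big_seq1; apply => // z; by rewrite inE => /eqP ->.
Qed.

(** The pointwise estimates are summed over [E2] and the sums exchanged; at each point of [E1] the
    kernels centred on [E2] have square sum at most [C]. *)
Lemma energy_le E1 E2 L (e K C M : R) u : 0 < e -> 0 < K -> 0 <= C ->
  samp E1 (fat L e) K -> ker_bessel E2 e C -> spec L M u ->
  (energy E2 u <= (K ^+ 2 * C)%:E * energy E1 u)%E.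
Proof.
move=> e0 K0 C0 EL E2C Lu; apply: esum_le_seq => Y uY YE.
apply: (@le_trans _ _ (\sum_(y <- Y) (K ^+ 2)%:E *
   \esum_(x in E1) (ker e (x - y) ^+ 2 * cmod (u x) ^+ 2)%:E)%E).
  by apply: lee_sum => y _; exact: samp_energy_pt Lu.
rewrite -ge0_sume_distrr; last first.
  by move=> y _; apply: esum_ge0 => x _; rewrite lee_fin mulr_ge0 ?sqr_ge0.
rewrite (EFinM (K ^+ 2) C) -muleA; apply: lee_wpmul2l; first by rewrite lee_fin sqr_ge0.
rewrite -esum_sum; last by move=> x y _ _; rewrite lee_fin mulr_ge0 ?sqr_ge0.
apply: le_trans (esum_scale_le _ C0 _); last by move=> x; rewrite lee_fin sqr_ge0.
apply: le_esum => x _; rewrite sumEFin -EFinM lee_fin -mulr_suml.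
by rewrite ler_wpM2r ?sqr_ge0//; exact: E2C.
Qed.

Lemma sum_inv_sq (n : nat) : \sum_(m < n) (1 + m%:R ^+ 2)^-1 <= 3 :> R.
Proof.
(* The claim is strengthened by a telescoping term, with equality at n = 0. *)
suff : \sum_(m < n.+1) (1 + m%:R ^+ 2)^-1 <= 3 - 2 / n.+1%:R :> R.
  rewrite big_ord_recr/= => h.
  have h1 : 0 <= (1 + n%:R ^+ 2)^-1 :> R by rewrite invr_ge0 addr_ge0 ?sqr_ge0.
  have h2 : 0 <= 2 / n.+1%:R :> R by rewrite divr_ge0.
  apply: le_trans (le_trans _ h) _; first by rewrite lerDl.
  by rewrite lerBlDr lerDl.
elim: n => [|n IH].
  by rewrite big_ord_recr big_ord0 /= expr0n/= addr0 invr1; lra.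
rewrite big_ord_recr/= (le_trans (lerD IH (lexx _)))//.
have t0 : 0 <= n%:R :> R by [].
have e1 : n.+1%:R = n%:R + 1 :> R by rewrite natr1.
have e2 : n.+2%:R = n%:R + 1 + 1 :> R by rewrite natr1 natr1.
rewrite e1 e2; move: t0; set t : R := n%:R => t0.
rewrite -subr_ge0.
have -> : 3 - 2 / (t + 1 + 1) - (3 - 2 / (t + 1) + (1 + (t + 1) ^+ 2)^-1) =
  (t ^+ 2 + t + 2) / ((t + 1 + 1) * (t + 1) * (1 + (t + 1) ^+ 2)).
  field; rewrite !gt_eqF//; nra.
by apply: divr_ge0; [nra|]; rewrite !mulr_ge0//; nra.
Qed.

Definition cell (dl : R) (y : V) (i : 'I_d) : int := Num.floor (y ord0 i / dl).

Lemma sep_cell_inj E (dl : R) x y : 0 < dl ->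
  (forall x y, E x -> E y -> x <> y -> 2 * dl <= `|x - y|) ->
  E x -> E y -> (forall i, cell dl x i = cell dl y i) -> x = y.
Proof.
move=> dl0 Esep Ex Ey xy; apply: contrapT => /(Esep _ _ Ex Ey).
apply/negP; rewrite -ltNge; apply: (@le_lt_trans _ _ dl); last by move: dl0; lra.
apply: norm_le_coord => [|i]; first exact: ltW.
have := xy i; rewrite /cell => e; rewrite !mxE.
have h1 := floor_le (x ord0 i / dl); have h2 := floorD1_gt (x ord0 i / dl).
have h3 := floor_le (y ord0 i / dl); have h4 := floorD1_gt (y ord0 i / dl).
rewrite !intrD e in h1 h2 h3 h4.
have -> : x ord0 i - y ord0 i = (x ord0 i / dl - y ord0 i / dl) * dl.
  by field; rewrite gt_eqF.
rewrite normrM (ger0_norm (ltW dl0)) -[leRHS]mul1r ler_wpM2r ?(ltW dl0)//.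
by rewrite ler_norml; apply/andP; split; move: h1 h2 h3 h4; lra.
Qed.

Lemma sinc_cell_le (e dl t : R) : 0 < e -> 0 < dl ->
  sinc (2 * pi * (e * t)) ^+ 2 <=
  (2 + 2 / (e * dl) ^+ 2) / (1 + `|Num.floor (t / dl)|%N%:R ^+ 2).
Proof.
move=> e0 dl0; set k := `|_|%N.
have ed0 : 0 < (e * dl) ^+ 2 by rewrite exprn_gt0// mulr_gt0.
have k1 : 0 < 1 + k%:R ^+ 2 :> R by rewrite ltr_wpDr ?sqr_ge0.
have s0 : 0 <= 2 / (e * dl) ^+ 2 by rewrite divr_ge0// ltW.
rewrite ler_pdivlMr//.
have s1 : sinc (2 * pi * (e * t)) ^+ 2 <= 1.
  by rewrite -real_normK ?num_real// expr_le1// sinc_le1.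
have [k2|k2] := ltnP k 2.
  have : k%:R ^+ 2 <= 1 :> R by case: k k2 {k1} => [|[|]]// _; rewrite ?expr0n ?expr1n.
  by have := sqr_ge0 (sinc (2 * pi * (e * t))); nra.
(* For negative t the floor overshoots in absolute value by less than 1, so |t| / dl >= k - 1 >= k /
   2 once k >= 2. *)
have tk : k%:R / 2 <= `|t| / dl.
  have h1 := floor_le (t / dl); have h2 := floorD1_gt (t / dl); rewrite intrD in h2.
  have -> : `|t| / dl = `|t / dl| by rewrite normrM normfV (ger0_norm (ltW dl0)).
  have k2' : 2 <= k%:R :> R by rewrite ler_nat.
  have : (Num.floor (t / dl))%:~R = k%:R :> R \/ (Num.floor (t / dl))%:~R = - k%:R :> R.
    rewrite /k; by case: (Num.floor _) => n; [left|right].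
  case=> hk; rewrite hk in h1 h2.
    by rewrite ger0_norm; move: h1 h2 k2'; lra.
  by rewrite ler0_norm; move: h1 h2 k2'; lra.
have t0 : t != 0.
  apply/eqP => t0; move: tk; rewrite t0 normr0 mul0r.
  by have : 2 <= k%:R :> R; [rewrite ler_nat|lra].
have pp : 1 <= pi :> R by have := pi_ge2 R; lra.
have nz : 2 * pi * (e * t) != 0 by rewrite !mulf_neq0// gt_eqF// pi_gt0.
have h := sinc_le nz.
have h' : `|2 * pi * (e * t)| * (`|sinc (2 * pi * (e * t))|) <= 1.
  by rewrite mulrC -ler_pdivlMr ?normr_gt0// div1r.
have big : e * dl * k%:R <= `|2 * pi * (e * t)|.
  rewrite !normrM (ger0_norm (ltW e0)) ger0_norm// ger0_norm ?pi_ge0//.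
  rewrite (@le_trans _ _ (2 * (e * `|t|)))//.
    by move: tk; rewrite ler_pdivlMr// => /(ler_wpM2l (ltW e0)); lra.
  by rewrite -mulrA ler_wpM2l// ler_peMl// mulr_ge0// ltW.
set S := sinc _ in h' s1 *.
have : (e * dl * k%:R) * `|S| <= 1 by rewrite (le_trans _ h')// ler_wpM2r.
rewrite -[S ^+ 2]real_normK ?num_real// in s1 *.
move: (normr_ge0 S); set s := `|S| in s1 * => s00 hs.
have : (e * dl) ^+ 2 * (k%:R ^+ 2 * s ^+ 2) <= 1.
  have -> : (e * dl) ^+ 2 * (k%:R ^+ 2 * s ^+ 2) = (e * dl * k%:R * s) ^+ 2 by ring.
  by rewrite expr_le1// !mulr_ge0// ltW.
move=> h3; have hh : k%:R ^+ 2 * s ^+ 2 <= ((e * dl) ^+ 2)^-1.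
  by rewrite -[leRHS]mul1r ler_pdivlMr// mulrC.
have : 0 <= ((e * dl) ^+ 2)^-1 by rewrite invr_ge0 ltW.
by move: hh s1; set z := _^-1; set kk := k%:R ^+ 2; set ss := s ^+ 2; lra.
Qed.

Lemma sum_uniq_le (I : finType) (T : eqType) (Y : seq T) (h : T -> I) (F : I -> R) :
  (forall i, 0 <= F i) -> uniq Y -> {in Y &, injective h} ->
  \sum_(y <- Y) F (h y) <= \sum_i F i.
Proof.
move=> F0 uY hY; rewrite -(big_map h predT F).
have uhY : uniq (map h Y) by rewrite map_inj_in_uniq.
rewrite (big_uniq _ uhY)/= [leRHS](bigID (mem (map h Y)))/= lerDl.
by apply: sumr_ge0.
Qed.

(** Separated points occupy distinct cells, so the sum is dominated by a sum over integer vectors of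
    products of one-variable weights, which factors over the coordinates. *)
Lemma sep_ker_bessel E (e : R) : 0 < e -> separated_set E ->
  exists2 C : R, 0 <= C & ker_bessel E e C.
Proof.
move=> e0 [dl2 [dl20 Esep]]; pose dl := dl2 / 2; have dl0 : 0 < dl by rewrite divr_gt0.
pose C0 := 2 + 2 / (e * dl) ^+ 2.
have C00 : 0 <= C0 by rewrite addr_ge0// divr_ge0// sqr_ge0.
exists ((C0 * 6) ^+ d); first by rewrite exprn_ge0// mulr_ge0.
move=> x Y uY YE.
pose N := (\max_(y <- Y) \max_(i < d) absz (cell dl (x - y)%R i)).+1%N.
(* A cell index is encoded by its sign and its absolute value below [N], which makes the range
   finite; each coordinate then contributes at most C0 * (3 + 3). *)
pose J : finType := (bool * 'I_N)%type.
pose W (j : J) : R := C0 / (1 + j.2%:R ^+ 2).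
have W0 j : 0 <= W j by rewrite divr_ge0// addr_ge0// sqr_ge0.
pose h (y : V) : {ffun 'I_d -> J} :=
  [ffun i => (0 <= cell dl (x - y) i, inord (absz (cell dl (x - y)%R i)))].
have hN y i : y \in Y -> (inord (absz (cell dl (x - y)%R i)) : 'I_N) = absz (cell dl (x - y)%R i) :> nat.
  move=> yY; rewrite inordK// ltnS.
  apply: (leq_trans _ (@leq_bigmax_seq _ Y predT
    (fun z => (\max_(i < d) absz (cell dl (x - z)%R i))%N) y yY erefl)).
  exact: (leq_bigmax (F := fun i => absz (cell dl (x - y)%R i))).
have hinj : {in Y &, injective h}.
  move=> y z yY zY hyz.
  have sepx a b : E (x - a) -> E (x - b) -> a <> b -> 2 * dl <= `|a - b|.
    move=> Ea Eb ab; have -> : a - b = (x - b) - (x - a) by rewrite opprB [RHS]addrC addrA subrK.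
    rewrite /dl mulrC divfK//; apply: Esep => // /(congr1 (fun v => x - v)).
    by rewrite !subKr => /esym.
  have := @sep_cell_inj [set a | E (x - a)] dl (x - y) (x - z) dl0 (fun a b => sepx a b).
  rewrite /= !subKr => /(_ (YE _ yY) (YE _ zY)) H.
  suff /H /(congr1 (fun v => x - v)) : forall i, cell dl (x - y) i = cell dl (x - z) i.
    by rewrite !subKr.
  move=> i; move/ffunP: hyz => /(_ i); rewrite !ffunE => -[sgn /(congr1 val)/=].
  rewrite !hN//; move: sgn; case: (cell _ _ _) => a; case: (cell _ _ _) => b //= _.
    by move=> ->.
  by case=> ->.
have le1 y : y \in Y -> ker e (x - y) ^+ 2 <= \prod_(i < d) W (h y i).
  move=> yY; rewrite /ker -prodrXl; apply: ler_prod => i _.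
  by rewrite sqr_ge0/= /W ffunE/= hN//; exact: sinc_cell_le.
rewrite big_seq (le_trans (ler_sum _ le1))// -big_seq.
rewrite (le_trans (@sum_uniq_le _ _ Y h (fun p => \prod_(i < d) W (p i)) _ uY hinj))//.
  by move=> p; apply: prodr_ge0.
rewrite -(bigA_distr_bigA (fun (i : 'I_d) j => W j))/= prodr_const card_ord.
rewrite lerXn2r ?nnegrE ?mulr_ge0//; first by apply: sumr_ge0.
rewrite -mulr_sumr ler_wpM2l//.
rewrite -(pair_bigA _ (fun (b : bool) (k : 'I_N) => (1 + k%:R ^+ 2)^-1))/= big_bool/=.
have := sum_inv_sq N; lra.
Qed.

Lemma separated_lattice (T : R) : 0 < T -> separated_set (lattice T : set V).
Proof.
move=> T0; exists T^-1; split; first by rewrite invr_gt0.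
move=> x y [n xn] [m ym] xy.
have [i nm] : exists i, n i != m i.
  apply: contrapT => /forallNP h; apply: xy; apply/rowP => i; rewrite xn ym.
  by have /negP := h i; rewrite negbK => /eqP ->.
apply: le_trans (coord_le_norm _ i); rewrite !mxE xn ym -mulrBl -intrB normrM.
rewrite normfV (ger0_norm (ltW T0)) ler_peMl ?invr_ge0 ?(ltW T0)// -intr_norm.
by rewrite ler1z -gtz0_ge1 normr_gt0 subr_eq0.
Qed.

End Energy.

(** * Discrete measures and balayage *)

Section Borel.
Context {R : realType} {d : nat}.
Local Notation V := (Vec R d).
Local Notation B := (Rd R d).

Lemma open_Rd (A : set V) : open A -> measurable (A : set B).
Proof. by move=> oA; apply: sub_sigma_algebra. Qed.

Lemma closed_Rd (A : set V) : closed A -> measurable (A : set B).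
Proof.
move=> cA; rewrite -(setCK A); apply: measurableC; apply: open_Rd; exact: closed_openC.
Qed.

Lemma set1_Rd (x : V) : measurable ([set x] : set B).
Proof.
apply: closed_Rd; apply: accessible_closed_set1; apply: hausdorff_accessible.
exact: norm_hausdorff.
Qed.

Lemma continuous_Rd (f : V -> R) : continuous f -> measurable_fun setT (f : B -> R).
Proof.
move=> /continuousP cf; apply: (measurability _ (RGenOpens.measurableE R)).
move=> _ [_ [a [b ->] <-]]; rewrite setTI.
by apply: open_Rd; apply: cf; exact: interval_open.
Qed.

Lemma coord_Rd i : measurable_fun setT (fun x : B => (x : V) ord0 i).
Proof. by apply: continuous_Rd; exact: coord_continuous. Qed.

Lemma dotp_Rd (g : V) : measurable_fun setT (fun x : B => dotp x g).
Proof.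
rewrite /dotp; apply: measurable_sum => i.
by apply: measurable_funM; [exact: coord_Rd|exact: measurable_cst].
Qed.

Lemma Re_chr_Rd (g : V) : measurable_fun setT (fun x : B => cRe (chr g x)).
Proof.
apply: (measurableT_comp (continuous_measurable_fun (@continuous_cos R))).
by apply: measurable_funM; [exact: measurable_cst|exact: dotp_Rd].
Qed.

Lemma Im_chr_Rd (g : V) : measurable_fun setT (fun x : B => cIm (chr g x)).
Proof.
apply: (measurableT_comp (continuous_measurable_fun (@continuous_sin R))).
by apply: measurable_funM; [exact: measurable_cst|exact: dotp_Rd].
Qed.

End Borel.

Section BoundedIntegral.
Context {d} {T : measurableType d} {R : realType} (m : {measure set T -> \bar R}).

Lemma bounded_integrable (D : set T) (f : T -> R) (M : R) : measurable D -> (m D < +oo)%E ->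
  measurable_fun D f -> (forall x, `|f x| <= M) -> m.-integrable D (EFin \o f).
Proof.
move=> mD Dfin mf fM; apply: measurable_bounded_integrable => //.
exists M; split; first exact: num_real.
by move=> N MN x Ax /=; rewrite (le_trans (fM x))// ltW.
Qed.

Lemma Rintegral_bound (D : set T) (f : T -> R) (M : R) : measurable D -> (m D < +oo)%E ->
  measurable_fun D f -> (forall x, `|f x| <= M) ->
  `|Rintegral m D f| <= M * fine (m D).
Proof.
move=> mD Dfin mf fM; have fi := bounded_integrable mD Dfin mf fM.
rewrite (le_trans (le_normr_Rintegral mD fi))// -Rintegral_cst//.
apply: le_Rintegral => //.
- by apply: (bounded_integrable (M := M)) => //; [exact: measurableT_comp|move=> x; rewrite normr_id].
- by apply: (bounded_integrable (M := `|M|)).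
Qed.

Lemma Rintegral_point (x : T) (f : T -> R) : measurable [set x] -> (m [set x] < +oo)%E ->
  Rintegral m [set x] f = f x * fine (m [set x]).
Proof.
move=> mx xfin; rewrite -Rintegral_cst//.
by apply: eq_Rintegral => y /[!inE] ->.
Qed.

Lemma Rintegral_points (Y : seq T) (f : T -> R) (M : R) : (forall x : T, measurable [set x]) ->
  (m setT < +oo)%E -> measurable_fun setT f -> (forall x, `|f x| <= M) -> uniq Y ->
  measurable ([set` Y] : set T) /\ Rintegral m [set` Y] f = \sum_(y <- Y) f y * fine (m [set y]).
Proof.
move=> m1 mT mf fM; have fin A : measurable A -> (m A < +oo)%E.
  by move=> mA; rewrite (le_lt_trans _ mT)// le_measure// inE.
elim: Y => [_|y Y IH /= /andP[yY /IH [mY YE]]].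
  by rewrite set_nil big_nil Rintegral_set0.
have -> : [set` y :: Y] = [set y] `|` [set` Y].
  apply/seteqP; split => z /=; rewrite inE.
    by case/orP => [/eqP ->|]; [left|right].
  by case=> [->|->]; rewrite ?eqxx ?orbT.
have mU := measurableU _ _ (m1 y) mY.
split => //; rewrite big_cons -YE -Rintegral_point//; last exact: fin.
rewrite Rintegral_setU//.
  by apply: (bounded_integrable (M := M)) => //; [exact: fin|exact: measurable_funS mf].
apply/disj_setPS => z [/= -> ]; by rewrite (negbTE yY).
Qed.

End BoundedIntegral.

(** * Truncation of complex measures to finitely many atoms *)

Section Discrete.
Context {R : realType} {d : nat}.
Local Notation V := (Vec R d).
Local Notation B := (Rd R d).
Implicit Types (m : {finite_measure set B -> \bar R}).

Lemma finite_lty m A : measurable A -> (m A < +oo)%E.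
Proof. by move=> mA; rewrite -ge0_fin_numE// fin_num_measure. Qed.

(** [m1] and [m2] may each charge the complement of [E]; only their difference vanishes there. These
    parts cancel, and the error comes from [E] outside [Y]. *)
Lemma discrete_diff m1 m2 (E : set V) (Y : seq V) (f : B -> R) (M : R) :
  measurable (E : set B) -> (forall A : set B, measurable A -> A `<=` ~` E -> m1 A = m2 A) ->
  uniq Y -> (forall y, y \in Y -> E y) ->
  measurable_fun setT f -> (forall x, `|f x| <= M) ->
  `|Rintegral m1 setT f - Rintegral m2 setT f -
     \sum_(y <- Y) f y * (fine (m1 [set y]) - fine (m2 [set y]))| <=
  M * (fine (m1 (E `\` [set` Y])) + fine (m2 (E `\` [set` Y]))).
Proof.
move=> mE m12 uY YE mf fM.
have mT m : (m setT < +oo)%E by exact: finite_lty.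
have split_ m : Rintegral m setT f = Rintegral m (~` E) f +
    (\sum_(y <- Y) f y * fine (m [set y]) + Rintegral m (E `\` [set` Y]) f).
  have [mY YI] := @Rintegral_points _ B R m Y f M (@set1_Rd R d) (mT m) mf fM uY.
  have mEY : measurable ((E `\` [set` Y]) : set B) by exact: measurableD.
  have mCE : measurable ((~` E) : set B) by exact: measurableC.
  have fi A : measurable A -> m.-integrable A (EFin \o f).
    by move=> mA; apply: (bounded_integrable (M := M)) => //;
      [exact: finite_lty|exact: measurable_funS mf].
  have dY : [disjoint ([set` Y] : set B) & (E `\` [set` Y] : set B)].
    by apply/disj_setPS => z [/= zY [_ /(_ zY)]].
  have dE : [disjoint (~` E : set B) & (E : set B)].
    by apply/disj_setPS => z [/= zY /zY].
  have YEU : [set` Y] `|` E `\` [set` Y] = E by apply: setDUK => y /YE.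
  rewrite -YI -(Rintegral_setU mY mEY (fi _ (measurableU _ _ mY mEY)) dY) YEU.
  rewrite -(Rintegral_setU mCE mE (fi _ (measurableU _ _ mCE mE)) dE).
  by rewrite setUC setUv.
rewrite !split_.
have -> : Rintegral m1 (~` E) f = Rintegral m2 (~` E) f.
  by congr fine; apply: eq_measure_integral.
rewrite (_ : \sum_(y <- Y) f y * (fine (m1 [set y]) - fine (m2 [set y])) =
  \sum_(y <- Y) f y * fine (m1 [set y]) - \sum_(y <- Y) f y * fine (m2 [set y])); last first.
  by rewrite -sumrB; apply: eq_bigr => y _; rewrite mulrBr.
set a := \sum_(y <- Y) _; set b := \sum_(y <- Y) _.
set I1 := Rintegral m1 (_ `\` _) f; set I2 := Rintegral m2 (_ `\` _) f.
set c := Rintegral m2 (~` _) f.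
have -> : c + (a + I1) - (c + (b + I2)) - (a - b) = I1 - I2 by ring.
have mEY : measurable ((E `\` [set` Y]) : set B).
  by apply: measurableD => //; have [] := @Rintegral_points _ B R m1 Y f M (@set1_Rd R d) (mT m1) mf fM uY.
rewrite (le_trans (ler_normB _ _))// mulrDr lerD//.
  by apply: Rintegral_bound => //; [exact: finite_lty|exact: measurable_funS mf].
by apply: Rintegral_bound => //; [exact: finite_lty|exact: measurable_funS mf].
Qed.

(** A majorant of the total variation of [nu] on [A], read off from the four positive parts. *)
Definition tail_mass (nu : cmeasure R d) (A : set B) : R :=
  fine (cm1 nu A) + fine (cm2 nu A) + (fine (cm3 nu A) + fine (cm4 nu A)).

Definition atoms (nu : cmeasure R d) (Y : seq V) : seq (R[i] * V) :=
  [seq (cm_val nu [set y], y) | y <- Y].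

Lemma cm_supp_eq (nu : cmeasure R d) (E : set V) : cm_supp nu E ->
  (forall A : set B, measurable A -> A `<=` ~` E -> cm1 nu A = cm2 nu A) /\
  (forall A : set B, measurable A -> A `<=` ~` E -> cm3 nu A = cm4 nu A).
Proof.
move=> nuE; split=> A mA AE; have [/eqP h1 /eqP h2] := nuE A mA AE.
  move: h1; rewrite subr_eq0 => /eqP h; rewrite -(fineK (fin_num_measure (cm1 nu) A mA)).
  by rewrite h fineK// fin_num_measure.
move: h2; rewrite subr_eq0 => /eqP h; rewrite -(fineK (fin_num_measure (cm3 nu) A mA)).
by rewrite h fineK// fin_num_measure.
Qed.

Lemma cm_int_discrete (nu : cmeasure R d) (E : set V) (Y : seq V) (f : V -> R[i]) (M : R) :
  measurable (E : set B) -> cm_supp nu E -> uniq Y -> (forall y, y \in Y -> E y) ->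
  measurable_fun setT (fun x : B => cRe (f x)) -> measurable_fun setT (fun x : B => cIm (f x)) ->
  (forall x, cmod (f x) <= M) ->
  cmod (cm_int nu f - papp (atoms nu Y) f) <= 2 * (M * tail_mass nu (E `\` [set` Y])).
Proof.
move=> mE /cm_supp_eq[h12 h34] uY YE mRe mIm fM.
have Re_M x := le_trans (Re_le_cmod (f x)) (fM x).
have Im_M x := le_trans (Im_le_cmod (f x)) (fM x).
have r12 := discrete_diff mE h12 uY YE mRe Re_M.
have i12 := discrete_diff mE h12 uY YE mIm Im_M.
have r34 := discrete_diff mE h34 uY YE mRe Re_M.
have i34 := discrete_diff mE h34 uY YE mIm Im_M.
have RP : cRe (papp (atoms nu Y) f) =
    \sum_(y <- Y) cRe (f y) * (fine (cm1 nu [set y]) - fine (cm2 nu [set y])) -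
    \sum_(y <- Y) cIm (f y) * (fine (cm3 nu [set y]) - fine (cm4 nu [set y])).
  rewrite /papp big_map cRe_sum -sumrB; apply: eq_bigr => y _ /=.
  by rewrite cReM /cRe /cIm /=; ring.
have IP : cIm (papp (atoms nu Y) f) =
    \sum_(y <- Y) cIm (f y) * (fine (cm1 nu [set y]) - fine (cm2 nu [set y])) +
    \sum_(y <- Y) cRe (f y) * (fine (cm3 nu [set y]) - fine (cm4 nu [set y])).
  rewrite /papp big_map cIm_sum -big_split; apply: eq_bigr => y _ /=.
  by rewrite cImM /cRe /cIm /=; ring.
rewrite (le_trans (cmod_le_ReIm _))// cReB cImB RP IP.
rewrite /cm_int /cint cReD cImD cReM cImM !cReB !cImB /= !mul0r !mul1r sub0r add0r.
move: r12 i12 r34 i34; rewrite /tail_mass.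
set a1 := Rintegral _ _ _; set a2 := Rintegral _ _ _.
set s1 := \sum_(y <- Y) _.
set t1 := M * (_ + _).
move=> r12.
set b1 := Rintegral _ _ _; set b2 := Rintegral _ _ _.
set s2 := \sum_(y <- Y) _.
move=> i12.
set a3 := Rintegral _ _ _; set a4 := Rintegral _ _ _.
set s3 := \sum_(y <- Y) _.
set t2 := M * (_ + _).
move=> r34.
set b3 := Rintegral _ _ _; set b4 := Rintegral _ _ _.
set s4 := \sum_(y <- Y) _.
move=> i34.
rewrite mulrDr -/t1 -/t2.
have -> : a1 - a2 + - (b3 - b4) - (s1 - s4) = (a1 - a2 - s1) - (b3 - b4 - s4) by ring.
have -> : b1 - b2 + (a3 - a4) - (s2 + s3) = (b1 - b2 - s2) + (a3 - a4 - s3) by ring.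
have n1 := ler_normB (a1 - a2 - s1) (b3 - b4 - s4).
have n2 := ler_normD (b1 - b2 - s2) (a3 - a4 - s3).
by move: r12 i12 r34 i34 n1 n2; lra.
Qed.

Lemma papp_atoms_le (nu : cmeasure R d) (Y : seq V) (f : V -> R[i]) (S : R) : uniq Y ->
  0 <= S -> (forall y, y \in Y -> cmod (f y) <= S) ->
  cmod (papp (atoms nu Y) f) <= tail_mass nu setT * S.
Proof.
move=> uY S0 fS; rewrite /papp big_map (le_trans (cmod_sum _ _ _))//=.
rewrite (@le_trans _ _ (\sum_(y <- Y) tail_mass nu [set y] * S))//.
  rewrite big_seq [leRHS]big_seq; apply: ler_sum => y yY.
  rewrite cmodM ler_pM ?cmod_ge0//; last exact: fS.
  rewrite (le_trans (cmod_le_ReIm _))// /tail_mass /= lerD//.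
    by rewrite (le_trans (ler_normB _ _))// !ger0_norm ?fine_ge0.
  by rewrite (le_trans (ler_normB _ _))// !ger0_norm ?fine_ge0.
rewrite -mulr_suml ler_wpM2r// /tail_mass !big_split/=.
have h m : \sum_(y <- Y) fine (m [set y]) <= fine (m setT).
  have mT : (m setT < +oo)%E by exact: finite_lty.
  have mc : measurable_fun setT (cst 1 : B -> R) by exact: measurable_cst.
  have c1 (x : B) : `|cst 1 x : R| <= 1 by rewrite /= normr1.
  have [mY] := @Rintegral_points _ B R m Y _ 1 (@set1_Rd R d) mT mc c1 uY.
  rewrite Rintegral_cst// mul1r => e.
  have -> : \sum_(y <- Y) fine (m [set y]) = \sum_(y <- Y) cst 1 y * fine (m [set y]).
    by apply: eq_bigr => y _; rewrite /= mul1r.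
  by rewrite -e fine_le ?fin_num_measure// le_measure ?inE.
by rewrite !lerD.
Qed.

End Discrete.

(** * Measures given by a rapidly convergent series of point masses *)

Section SeriesMeasure.
Context {R : realType} {d : nat}.
Local Notation V := (Vec R d).
Local Notation B := (Rd R d).
Variables (c : nat -> R) (y : nat -> V).
Hypotheses (c0 : forall k, 0 <= c k) (c8 : forall k, c k <= 8 ^- k).

Definition atomic_series : set B -> \bar R :=
  mseries (fun k => mscale (NngNum (c0 k)) (@dirac _ B (y k) R)) 0.

HB.instance Definition _ := Measure.on atomic_series.

Lemma sum_pow8 n N : (n <= N)%N -> \sum_(n <= k < N) 8 ^- k <= 8 / 7 * 8 ^- n :> R.
Proof.
move=> nN; suff -> : \sum_(n <= k < N) 8 ^- k = 8 / 7 * (8 ^- n - 8 ^- N) :> R.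
  have h1 : 0 <= 8 ^- N :> R by rewrite invr_ge0 exprn_ge0.
  have h2 : 0 <= 8 ^- n :> R by rewrite invr_ge0 exprn_ge0.
  by move: h1 h2; lra.
elim: N nN => [|N IH]; first by rewrite leqn0 => /eqP ->; rewrite big_geq// subrr mulr0.
rewrite leq_eqVlt => /orP[/eqP <-|]; first by rewrite big_geq// subrr mulr0.
rewrite ltnS => nN; rewrite big_nat_recr//= IH// (exprS 8 N) invfM.
by set a := 8 ^- n; set b := 8 ^- N; field.
Qed.

(** The range [0, 2] is that of 1 + r with |r| <= 1: bounded real integrands are recovered by
    subtracting the integral of 1, so only nonnegative series occur. *)
Lemma atomic_series_int (g : B -> R) n : measurable_fun setT g ->
  (forall x, 0 <= g x <= 2) ->
  exists2 L : R, (\int[atomic_series]_x (g x)%:E = L%:E)%E &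
    \sum_(k < n) c k * g (y k) <= L <= \sum_(k < n) c k * g (y k) + 4 * 8 ^- n.
Proof.
move=> mg g02; have mg' : measurable_fun setT (EFin \o g) by exact/measurable_EFinP.
have g0 x : (0 <= (g x)%:E)%E by rewrite lee_fin; case/andP: (g02 x).
have -> : (\int[atomic_series]_x (g x)%:E = \sum_(k <oo) (c k * g (y k))%:E)%E.
  rewrite ge0_integral_measure_series//; apply: eq_eseriesr => k _.
  by rewrite ge0_integral_mscale// integral_dirac// diracT mul1e -EFinM.
have cg0 k : (0 <= (c k * g (y k))%:E)%E.
  by rewrite lee_fin mulr_ge0//; case/andP: (g02 (y k)).
have lo : ((\sum_(k < n) c k * g (y k))%:E <= \sum_(k <oo) (c k * g (y k))%:E)%E.
  rewrite -sumEFin -(big_mkord predT (fun k => (c k * g (y k))%:E)).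
  by apply: nneseries_lim_ge => k _ _.
have up : (\sum_(k <oo) (c k * g (y k))%:E <= (\sum_(k < n) c k * g (y k) + 4 * 8 ^- n)%:E)%E.
  apply: lime_le; first by apply: is_cvg_nneseries => k _ _.
  exists n => // N /= nN; rewrite sumEFin lee_fin (big_cat_nat (n := n))//= big_mkord.
  rewrite lerD2l (@le_trans _ _ (\sum_(n <= k < N) 2 * 8 ^- k))//.
    apply: ler_sum => k _; have /andP[h0 h2] := g02 (y k).
    by rewrite mulrC ler_pM.
  have h0 : 0 <= 8 ^- n :> R by rewrite invr_ge0 exprn_ge0.
  by rewrite -mulr_sumr; have := sum_pow8 nN; lra.
move: lo up; case: (\sum_(k <oo) _)%E => [L| |]//; rewrite !lee_fin => lo up.
by exists L => //; rewrite lo up.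
Qed.

Lemma atomic_series_fin (A : set B) : measurable A -> (atomic_series A < +oo)%E.
Proof.
move=> mA; apply: (@le_lt_trans _ _ (atomic_series setT)).
  by apply: le_measure; rewrite ?inE.
have [|L e _] := @atomic_series_int (cst 1) 0 (measurable_cst _).
  by move=> x; rewrite /= ler01 ler1n.
have <- : (\int[atomic_series]_x (cst 1%:E x) = atomic_series setT)%E.
  by rewrite integral_cst// mul1e.
by rewrite [X in (X < _)%E]e ltry.
Qed.

Lemma atomic_series_Rint (r : B -> R) n : measurable_fun setT r -> (forall x, `|r x| <= 1) ->
  `|Rintegral atomic_series setT r - \sum_(k < n) c k * r (y k)| <= 4 * 8 ^- n.
Proof.
move=> mr r1; have mT : (atomic_series setT < +oo)%E by exact: atomic_series_fin.
have ri := bounded_integrable measurableT mT mr r1.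
have oi : atomic_series.-integrable setT (EFin \o (cst 1 : B -> R)).
  by apply: (bounded_integrable (M := 1)) => // x; rewrite /= normr1.
have [||L1 e1 b1] := @atomic_series_int (fun x => r x + 1) n.
- by apply: measurable_funD => //; exact: measurable_cst.
- by move=> x; have := r1 x; rewrite ler_norml => /andP[h1 h2]; apply/andP; split; lra.
have [||L2 e2 b2] := @atomic_series_int (cst 1) n; first exact: measurable_cst.
  by move=> x; rewrite /= ler01 ler1n.
have -> : Rintegral atomic_series setT r = L1 - L2.
  have -> : L1 = Rintegral atomic_series setT (fun x => r x + cst 1 x) by rewrite /Rintegral e1.
  have -> : L2 = Rintegral atomic_series setT (cst 1) by rewrite /Rintegral e2.
  by rewrite RintegralD// addrK.
have e3 : \sum_(k < n) c k * (r (y k) + 1) = \sum_(k < n) c k * r (y k) + \sum_(k < n) c k.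
  by rewrite -big_split; apply: eq_bigr => k _; rewrite mulrDr mulr1.
have e4 : \sum_(k < n) c k * cst 1 (y k) = \sum_(k < n) c k.
  by apply: eq_bigr => k _; rewrite mulr1.
rewrite e3 in b1; rewrite e4 in b2.
case/andP: b1 => b1 b1'; case/andP: b2 => b2 b2'.
by rewrite ler_norml; apply/andP; split; lra.
Qed.

Lemma atomic_series_finite : exists m : {finite_measure set B -> \bar R},
  forall A, measurable A -> m A = atomic_series A.
Proof.
have fin : fin_num_fun atomic_series.
  by move=> A mA; rewrite ge0_fin_numE// atomic_series_fin.
pose H := Measure_isFinite.Build _ B R atomic_series fin.
by exists (HB.pack_for (FiniteMeasure.type B R) atomic_series H).
Qed.

Definition fmzero : {finite_measure set B -> \bar R} := mzero.

Lemma atomic_cmeasure : exists mu : cmeasure R d, forall n (f : V -> R[i]),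
  measurable_fun setT (fun x : B => cRe (f x)) -> measurable_fun setT (fun x : B => cIm (f x)) ->
  (forall x, cmod (f x) <= 1) ->
  cmod (cm_int mu f - \sum_(k < n) cofR (c k) * f (y k)) <= 8 * 8 ^- n.
Proof.
have [m mE] := atomic_series_finite.
exists (CMeasure m fmzero fmzero fmzero) => n f mRe mIm f1.
have E r : Rintegral m setT r = Rintegral atomic_series setT r.
  by congr fine; apply: eq_measure_integral => A mA _; exact: mE.
have Z r : Rintegral fmzero setT r = 0 by rewrite /Rintegral integral_measure_zero.
have h1 := atomic_series_Rint n mRe (fun x => le_trans (Re_le_cmod (f x)) (f1 x)).
have h2 := atomic_series_Rint n mIm (fun x => le_trans (Im_le_cmod (f x)) (f1 x)).
rewrite (le_trans (cmod_le_ReIm _))// cReB cImB cRe_sum cIm_sum.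
rewrite /cm_int /cint cReD cImD cReM cImM !cReB !cImB /= !E !Z !subr0.
rewrite !(mulr0, mul0r, subr0, addr0).
have -> : \sum_(k < n) cRe (cofR (c k) * f (y k)) = \sum_(k < n) c k * cRe (f (y k)).
  by apply: eq_bigr => k _; rewrite cReM /= mul0r subr0.
have -> : \sum_(k < n) cIm (cofR (c k) * f (y k)) = \sum_(k < n) c k * cIm (f (y k)).
  by apply: eq_bigr => k _; rewrite cImM /= mul0r addr0.
have -> : 8 * 8 ^- n = 4 * 8 ^- n + 4 * 8 ^- n :> R by rewrite -mulrDl -natrD.
exact: lerD.
Qed.

End SeriesMeasure.

(** * From balayage to a sup-norm sampling inequality *)

Section Balayage.
Context {R : realType} {d : nat}.
Local Notation V := (Vec R d).
Local Notation B := (Rd R d).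
Implicit Types (f : V -> R[i]) (E L : set V).

(** The supremum may not be attained; the hump construction works with a point that reaches half of
    it. *)
Lemma near_max f (M : R) (y : V) : (forall x, cmod (f x) <= M) -> 0 < cmod (f y) ->
  exists y0, forall x, cmod (f x) <= 2 * cmod (f y0).
Proof.
move=> fM fy; pose A := range (fun x => cmod (f x)).
have A0 : A !=set0 by exists (cmod (f y)); exists y.
have Aub : has_ubound A by exists M => _ [x _ <-].
have As x : cmod (f x) <= sup A by apply: ub_le_sup => //; exists x.
have s0 : 0 < sup A by exact: lt_le_trans (As y).
have [_ [y0 _ <-] h] : exists2 z, A z & sup A / 2 < z.
  by apply: sup_gt => //; move: s0; lra.
by exists y0 => x; have := As x; move: h; lra.
Qed.

(** Gliding hump: the coefficients are chosen one after the other so that the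
    [n]-th functional is already large on the [n]-th partial sum. *)
Lemma hump (F : nat -> V -> R[i]) (y : nat -> V) : exists c : nat -> R,
  [/\ forall k, 0 <= c k, forall k, c k <= 8 ^- k &
    forall n, 8 ^- n * cmod (F n (y n)) / 2 <=
      cmod (\sum_(k < n.+1) cofR (c k) * F n (y k))].
Proof.
pose cc n (s : seq R) : R :=
  let p := \sum_(k < n) cofR (nth 0 s k) * F n (y k) in
  if 8 ^- n * cmod (F n (y n)) / 2 <= cmod p then 0 else 8 ^- n.
pose lst n := iteri n (fun k s => rcons s (cc k s)) [::].
have lstS n : lst n.+1 = rcons (lst n) (cc n (lst n)) by [].
have size_lst n : size (lst n) = n.
  by elim: n => // n IH; rewrite lstS size_rcons IH.
pose c n := cc n (lst n).
have nth_lst n k : (k < n)%N -> nth 0 (lst n) k = c k.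
  elim: n => // n IH; rewrite ltnS leq_eqVlt lstS nth_rcons size_lst.
  by case/orP => [/eqP ->|kn]; [rewrite ltnn eqxx|rewrite kn IH].
have p8 n : 0 <= 8 ^- n :> R by rewrite invr_ge0 exprn_ge0.
exists c; split=> n; [by rewrite /c /cc; case: ifP|by rewrite /c /cc; case: ifP|].
rewrite big_ord_recr /= {2}/c /cc.
have -> : \sum_(k < n) cofR (nth 0 (lst n) k) * F n (y k) = \sum_(k < n) cofR (c k) * F n (y k).
  by apply: eq_bigr => k _; rewrite nth_lst.
set p := \sum_(k < n) _; case: ifP => [h|/negbT]; first by rewrite (_ : cofR 0 = 0)// mul0r addr0.
(* The two candidates for the partial sum differ by 8^-n F_n(y_n), so if one is shorter than half of
   this, the other is not. *)
rewrite -ltNge => h; have := cmodB (p + cofR (8 ^- n) * F n (y n)) p.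
rewrite [p + _]addrC addrK cmodM cmod_cofR (ger0_norm (p8 n)).
by move: h; lra.
Qed.

Lemma separated_countable E : separated_set E -> countable E.
Proof.
move=> [dl2 [dl20 Esep]]; pose dl := dl2 / 2; have dl0 : 0 < dl by rewrite divr_gt0.
apply/countable_injP; exists (fun x => pickle [ffun i => cell dl x i]).
move=> x z; rewrite !inE => Ex Ez /(pcan_inj pickleK)/ffunP xz.
apply: (@sep_cell_inj _ _ E dl) => // [u v Eu Ev uv|i].
  by rewrite /dl mulrC divfK//; exact: Esep.
by have := xz i; rewrite !ffunE.
Qed.

(** An injection of [E] into the naturals gives finite initial pieces whose complements in [E]
    decrease to the empty set. *)
Lemma countable_exhaust E (nu : cmeasure R d) (e : R) : countable E -> 0 < e ->
  exists Y : seq V, [/\ uniq Y, forall y, y \in Y -> E y &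
    tail_mass nu (E `\` [set` Y]) <= e].
Proof.
move=> Ecount e0; have mE : measurable (E : set B).
  by apply: countable_measurable => //; exact: set1_Rd.
have /countable_injP[h hinj] := Ecount.
pose En n := [set x | E x /\ (h x < n)%N].
have Efin n : finite_set (En n).
  have : finite_set (h @` En n).
    by apply: (sub_finite_set _ (finite_II n)) => _ [x [_ hx] <-].
  rewrite (eq_finite_set (inj_card_eq (f := h) (A := En n) _))//.
  move=> x z /[!inE] -[Ex _] [Ez _]; apply: hinj; exact: mem_set.
pose F n : set B := E `\` En n.
have mF n : measurable (F n).
  apply: measurableD => //; apply: countable_measurable; first exact: set1_Rd.
  exact: finite_set_countable.
have F0 : \bigcap_n F n = set0.
  apply/seteqP; split => // x /= Fx; have [Ex _] := Fx 0%N I.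
  by have [_] := Fx (h x).+1 I; apply; split.
have Fdec : nonincreasing_seq F.
  move=> n m nm; apply/subsetPset => x [Ex nEx]; split => // -[_ hx]; apply: nEx.
  by split => //; exact: leq_trans nm.
have lim (m : {finite_measure set B -> \bar R}) : (fun n => fine (m (F n))) @ \oo --> (0 : R).
  have := @nonincreasing_cvg_mu _ B R m F; rewrite F0 measure0 => H.
  have := H (finite_lty m (mF 0%N)) mF measurable0 Fdec.
  by move/fine_cvgP => [].
have LL : (fun n => tail_mass nu (F n)) @ \oo --> (0 + 0 + (0 + 0) : R).
  by apply: cvgD; apply: cvgD.
rewrite !addr0 in LL.
have [n _ /(_ n)/(_ (leqnn _)) hn] := cvgr_le _ LL _ e0.
have memE z : (z \in finmap.enum_fset (fset_set (En n))) = (z \in En n).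
  by rewrite -in_fset_set.
exists (finmap.enum_fset (fset_set (En n))); split; first exact: finmap.fset_uniq.
  by move=> z; rewrite memE inE => -[].
have -> : [set` finmap.enum_fset (fset_set (En n))] = En n.
  by apply/seteqP; split => z; rewrite /= memE inE.
exact: hn.
Qed.

Lemma cm_ft_opp (mu : cmeasure R d) (g : V) : cm_ft mu (- g) = cm_int mu (chr g).
Proof.
rewrite /cm_ft; congr (cm_int mu _); apply/funext => x.
by rewrite /chr dotpNr mulrNN.
Qed.

(** If no constant works, some F_n are large at y_n and tiny on [E]. Their integrals against the
    swept measure [nu] are then tiny, while those against the atomic measure on the y_k are large by
    the hump. Since F_n has a spectrum only in the dual sense, the two are compared through finite
    truncations of both measures, whose difference is small on all characters of [L]. *)
Lemma balayage_samp E L : separated_set E -> symmetric_set L -> balayage_possible E L ->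
  exists2 K : R, 0 < K & samp E L K.
Proof.
move=> Esep Lsym bal; apply: contrapT => noK.
have Ecount := separated_countable Esep.
have mE : measurable (E : set B).
  by apply: countable_measurable => //; exact: set1_Rd.
(* 16 = 8 * 2: the factor 8^n undoes the weight of the n-th atom, and 2^n outgrows the mass of [nu],
   which is unknown at this point. *)
have bad n : exists p : (R * (V -> R[i])) * (R * V), [/\ spec L p.1.1 p.1.2, 0 <= p.2.1,
    forall x, E x -> cmod (p.1.2 x) <= p.2.1,
    forall x, cmod (p.1.2 x) <= 2 * cmod (p.1.2 p.2.2) &
    16 ^+ n * p.2.1 < cmod (p.1.2 p.2.2)].
  apply: contrapT => nex; apply: noK.
  exists (2 * 16 ^+ n); first by rewrite mulr_gt0// exprn_gt0.
  move=> M f S Lf S0 fS y; rewrite leNgt; apply/negP => fy.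
  have fy0 : 0 < cmod (f y).
    by rewrite (le_lt_trans _ fy)// mulr_ge0// mulr_ge0// exprn_ge0.
  have [y0 fy0'] := near_max (fun x => spec_bound x Lf) fy0.
  apply: nex; exists ((M, f), (S, y0)); split => //=.
  by have := fy0' y; move: fy; rewrite -mulrA; lra.
have [p pP] := choice bad.
pose F n := (p n).1.2; pose y n := (p n).2.2.
have [c [c0 c8 chump]] := hump F y.
have [mu muP] := atomic_cmeasure y c0 c8.
have [nu [nuE nuft]] := bal mu.
have [n hn] : exists n, 5 * (tail_mass nu setT) <= 2 ^+ n.
  have : (fun n => 5 * tail_mass nu setT * 2 ^- n) @ \oo --> (5 * tail_mass nu setT * 0).
    by apply: cvgM; [exact: cvg_cst|exact: cvg_half_pow].
  rewrite mulr0 => lim.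
  have [n _ /(_ n)/(_ (leqnn _)) h] := cvgr_le _ lim _ (@ltr01 R).
  by exists n; move: h; rewrite ler_pdivrMr ?exprn_gt0// mul1r.
have [Lf S0 fS f2 big] := pP n; rewrite -/(F n) -/(y n) in Lf fS f2 big.
set M := (p n).1.1 in Lf; set S := (p n).2.1 in S0 fS big.
set a := cmod (F n (y n)) in f2 big.
have M0 := spec_ge0 Lf.
have p8 k : 0 < 8 ^- k :> R by rewrite invr_gt0 exprn_gt0.
(* The hump gives 1/2, later terms take away at most 2/7, and 3/14 >= 1/5 is left. *)
have part N : (n < N)%N -> 8 ^- n * a / 5 <= cmod (\sum_(k < N) cofR (c k) * F n (y k)).
  move=> nN.
  have a0 : 0 <= a by exact: cmod_ge0.
  rewrite -(big_mkord predT (fun k => cofR (c k) * F n (y k))) (big_cat_nat (n := n.+1))//= big_mkord.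
  set q := \sum_(k < n.+1) _; set t := \sum_(n.+1 <= k < N) _.
  have : cmod t <= 8 ^- n * a * (2 / 7).
    rewrite (le_trans (cmod_sum _ _ _))//.
    rewrite (@le_trans _ _ (\sum_(n.+1 <= k < N) 8 ^- k * (2 * a)))//.
      apply: ler_sum => k _; rewrite cmodM cmod_cofR ger0_norm//.
      by rewrite ler_pM ?cmod_ge0.
    rewrite -mulr_suml.
    have -> : 8 ^- n * a * (2 / 7) = (8 / 7 * 8 ^- n.+1) * (2 * a).
      by rewrite (exprS 8 n) invfM; field; rewrite expf_neq0.
    by rewrite ler_wpM2r ?mulr_ge0//; exact: sum_pow8.
  have := chump n; rewrite -/a -/q.
  have := cmodB (q + t) t; rewrite addrK.
  have : 0 <= 8 ^- n * a by rewrite mulr_ge0// ltW.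
  by lra.
have key e : 0 < e -> 8 ^- n * a / 5 <= tail_mass nu setT * S + M * e.
  move=> e0.
  have : (fun N => 8 * 8 ^- N : R) @ \oo --> (8 * 0 : R).
    apply: cvgM; first exact: cvg_cst.
    under eq_fun do rewrite -exprVn.
    by apply: cvg_expr; rewrite ger0_norm// invf_lt1// ltr1n.
  rewrite mulr0 => lim; have e20 : 0 < e / 2 by rewrite divr_gt0.
  have [N0 _ N0P] := cvgr_le _ lim _ e20.
  pose N := maxn N0 n.+1.
  have nN : (n < N)%N by rewrite leq_maxr.
  have hN : 8 * 8 ^- N <= e / 2 :> R by apply: N0P => /=; exact: leq_maxl.
  have e40 : 0 < e / 4 by rewrite divr_gt0.
  have [Y [uY YE hY]] := countable_exhaust nu Ecount e40.
  pose s := [seq (cofR (c k), y k) | k <- index_iota 0 N].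
  have sE f : papp s f = \sum_(k < N) cofR (c k) * f (y k) by rewrite /papp big_map big_mkord.
  pose t := scl (-1) (atoms nu Y).
  have tE f : papp t f = - papp (atoms nu Y) f by rewrite papp_scl mulN1r.
  have st : cmod (papp (s ++ t) (F n)) <= M * e.
    apply: spec_le Lf (ltW e0) _ => g Lg; rewrite papp_cat tE sE.
    have h1 := muP N (chr g) (Re_chr_Rd g) (Im_chr_Rd g) (fun x => ltac:(by rewrite cmod_chr)).
    have h2 := cm_int_discrete mE nuE uY YE (Re_chr_Rd g) (Im_chr_Rd g)
      (fun x => ltac:(by rewrite cmod_chr)) (M := 1).
    have e12 : cm_int mu (chr g) = cm_int nu (chr g).
      (* The Fourier transform integrates the conjugate character, whence the use of symmetry. *)
      by rewrite -!cm_ft_opp; apply: nuft; exact: Lsym.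
    rewrite e12 in h1.
    set z := \sum_(k < N) _ in h1 *; set w := papp _ _ in h2 *.
    set j := cm_int nu _ in h1 h2.
    have -> : z - w = (j - w) - (j - z) by ring.
    rewrite (le_trans (cmodB _ _))//.
    by move: h1 h2 hN hY; lra.
  rewrite papp_cat tE sE in st.
  have hS := papp_atoms_le nu (f := F n) uY S0 (fun z zY => fS z (YE z zY)).
  have := part N nN; move: st hS.
  set z := \sum_(k < N) _; set w := papp _ _ => st hS.
  have -> : z = (z - w) + w by rewrite subrK.
  by have := cmodD (z - w) w; lra.
have fin : 8 ^- n * a / 5 <= tail_mass nu setT * S.
  apply/ler_addgt0Pr => e e0; have M1 : 0 < M + 1 by rewrite ltr_wpDl.
  apply: le_trans (key (e / (M + 1)) _) _; first by rewrite divr_gt0.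
  rewrite lerD2l mulrA ler_pdivrMr// mulrDr mulr1 (mulrC e) lerDl ltW//.
have : 8 ^+ n * (8 ^- n * a / 5) <= 8 ^+ n * (tail_mass nu setT * S).
  by rewrite ler_wpM2l// exprn_ge0.
rewrite -mulrA mulVKf ?expf_neq0//.
have : 8 ^+ n * (5 * tail_mass nu setT) * S <= 8 ^+ n * 2 ^+ n * S.
  by rewrite ler_wpM2r// ler_wpM2l// exprn_ge0.
rewrite -exprMn (_ : 8 * 2 = 16); last by ring.
by move: big; lra.
Qed.

End Balayage.

(** * Lebesgue measure on boxes *)

Section Boxes.
Context {R : realType} {d : nat}.
Local Notation V := (Vec R d).
Local Notation B := (Rd R d).

Definition hbox (a b : V) : set B :=
  [set x : B | forall i, a ord0 i <= (x : V) ord0 i < b ord0 i].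

(** Strict superlevel sets of cosines give open boxes, whereas [is_lebesgue] prescribes the measure
    of half-open ones; both families have to generate. *)
Definition obox (a b : V) : set B :=
  [set x : B | forall i, a ord0 i < (x : V) ord0 i < b ord0 i].

Lemma coords_Rd (A : 'I_d -> set R) : (forall i, measurable (A i)) ->
  measurable [set x : B | forall i, A i ((x : V) ord0 i)].
Proof.
move=> mA; rewrite (_ : [set _ | _] = \bigcap_(i in [set: 'I_d])
    ((fun x : B => (x : V) ord0 i) @^-1` A i)).
  apply: fin_bigcap_measurable; first exact: finite_finset.
  by move=> i _; rewrite -[X in measurable X]setTI; apply: coord_Rd.
by apply/seteqP; split=> x /= h i; [move=> _; exact: h|exact: h].
Qed.

Lemma hbox_Rd a b : measurable (hbox a b).
Proof.
apply: (@coords_Rd (fun i => `[a ord0 i, b ord0 i[%classic)) => i.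
exact: measurable_itv.
Qed.

Lemma obox_Rd a b : measurable (obox a b).
Proof.
apply: (@coords_Rd (fun i => `]a ord0 i, b ord0 i[%classic)) => i.
exact: measurable_itv.
Qed.

Lemma hboxI a b a' b' : hbox a b `&` hbox a' b' =
  hbox (\row_i Num.max (a ord0 i) (a' ord0 i)) (\row_i Num.min (b ord0 i) (b' ord0 i)).
Proof.
apply/seteqP; split=> x /=.
  by move=> [h h'] i; rewrite !mxE ge_max lt_min; case/andP: (h i) => -> ->;
     case/andP: (h' i) => -> ->.
move=> h; split=> i; have := h i; rewrite !mxE ge_max lt_min;
  by move=> /andP[/andP[h1 h2] /andP[h3 h4]]; rewrite ?h1 ?h2 ?h3 ?h4.
Qed.

Lemma oboxI a b a' b' : obox a b `&` obox a' b' =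
  obox (\row_i Num.max (a ord0 i) (a' ord0 i)) (\row_i Num.min (b ord0 i) (b' ord0 i)).
Proof.
apply/seteqP; split=> x /=.
  by move=> [h h'] i; rewrite !mxE gt_max lt_min; case/andP: (h i) => -> ->;
     case/andP: (h' i) => -> ->.
move=> h; split=> i; have := h i; rewrite !mxE gt_max lt_min;
  by move=> /andP[/andP[h1 h2] /andP[h3 h4]]; rewrite ?h1 ?h2 ?h3 ?h4.
Qed.

(** An open set is the union of the boxes of the family that it contains, because boxes of every
    scale cover the space and shrink; the family is countable. *)
Lemma gen_boxes (box : nat -> ('I_d -> int) -> set B) (G : set (set B)) :
  (forall k n, G (box k n)) -> (forall A, G A -> measurable A) ->
  (forall k x, box k (cell (2 ^- k) x) x) ->
  (forall k n x z, box k n x -> box k n z -> `|(x : V) - z| <= 2 * 2 ^- k) ->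
  @measurable _ B = <<s G >>.
Proof.
move=> Gbox Gm boxx boxd; apply/seteqP; split; last first.
  by apply: smallest_sub => //; exact: sigma_algebra_measurable.
apply: smallest_sub; first exact: smallest_sigma_algebra.
move=> O oO.
pose D : countType := (nat * {ffun 'I_d -> int})%type.
pose F (p : D) : set B := if `[< box p.1 p.2 `<=` (O : set B) >] then box p.1 p.2 else set0.
have -> : O = \bigcup_p F p.
  apply/seteqP; split => x.
    move=> Ox; have : nbhs x O by exact: open_nbhs_nbhs.
    move=> /nbhs_ballP[e e0 xe].
    have : (fun n => 2 * 2 ^- n : R) @ \oo --> (2 * 0 : R).
      by apply: cvgM; [exact: cvg_cst|exact: cvg_half_pow].
    rewrite mulr0 => lim; have e20 : 0 < e / 2 by rewrite divr_gt0.
    have [k _ /(_ k)/(_ (leqnn _)) hk] := cvgr_le _ lim _ e20.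
    pose n : {ffun 'I_d -> int} := [ffun i => cell (2 ^- k) x i].
    have nE : (n : 'I_d -> int) = cell (2 ^- k) x by apply/funext => i; rewrite ffunE.
    have h : box k n `<=` (O : set B).
      move=> z kz; apply: xe; rewrite -ball_normE /ball_/=.
      apply: le_lt_trans (boxd _ _ _ _ _ kz) _; first by rewrite nE; exact: boxx.
      by apply: le_lt_trans hk _; move: e0 => /=; lra.
    exists ((k, n) : D) => //; rewrite /F /= ifT; first by rewrite nE; exact: boxx.
    exact/asboolP.
  by case=> p _; rewrite /F; case: asboolP => // h /h.
rewrite -[<<s G >>]/(@measurable _ (g_sigma_algebraType G)).
apply: (@countable_bigcupT_measurable _ (g_sigma_algebraType G) D).
  exact: countableP.
move=> p; rewrite /F; case: ifP => _; last exact: measurable0.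
by apply: sub_sigma_algebra; exact: Gbox.
Qed.

Lemma cell_itv (dl : R) (x : V) i : 0 < dl ->
  dl * (cell dl x i)%:~R <= x ord0 i < dl * (cell dl x i)%:~R + dl.
Proof.
move=> dl0; have h1 := floor_le (x ord0 i / dl); have h2 := floorD1_gt (x ord0 i / dl).
rewrite ler_pdivlMr// in h1; rewrite ltr_pdivrMr// intrD in h2.
by rewrite /cell; apply/andP; split; lra.
Qed.

Lemma hbox_gen : @measurable _ B = <<s [set hbox p.1 p.2 | p in [set: V * V]] >>.
Proof.
have p2 k : 0 < 2 ^- k :> R by rewrite invr_gt0 exprn_gt0.
apply: (@gen_boxes (fun k n => hbox (\row_i (2 ^- k * (n i)%:~R))
    (\row_i (2 ^- k * (n i)%:~R + 2 ^- k)))).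
- move=> k n; by eexists (_, _).
- by move=> _ [p _ <-]; exact: hbox_Rd.
- by move=> k x i; rewrite !mxE; exact: cell_itv.
- move=> k n x z xk zk; apply: norm_le_coord => [|i]; first by rewrite mulr_ge0// ltW.
  have := xk i; have := zk i; rewrite !mxE => /andP[h1 h2] /andP[h3 h4].
  by have := p2 k; rewrite ler_norml => p0; apply/andP; split; lra.
Qed.

Lemma obox_gen : @measurable _ B = <<s [set obox p.1 p.2 | p in [set: V * V]] >>.
Proof.
have p2 k : 0 < 2 ^- k :> R by rewrite invr_gt0 exprn_gt0.
(* The left faces are moved out by half a cell so that the open boxes still cover; their side 3/2 *
   2^-k is below the allowed 2 * 2^-k. *)
apply: (@gen_boxes (fun k n => obox (\row_i (2 ^- k * (n i)%:~R - 2^-1 * 2 ^- k))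
    (\row_i (2 ^- k * (n i)%:~R + 2 ^- k)))).
- move=> k n; by eexists (_, _).
- by move=> _ [p _ <-]; exact: obox_Rd.
- move=> k x i; rewrite !mxE; have := cell_itv x i (p2 k) => /andP[h1 h2].
  by have := p2 k => p0; apply/andP; split; lra.
- move=> k n x z xk zk; apply: norm_le_coord => [|i]; first by rewrite mulr_ge0// ltW.
  have := xk i; have := zk i; rewrite !mxE => /andP[h1 h2] /andP[h3 h4].
  by have := p2 k; rewrite ler_norml => p0; apply/andP; split; lra.
Qed.

End Boxes.

(** * Translation invariance and null hyperplane slices *)

Section Lebesgue.
Context {R : realType} {d : nat}.
Local Notation V := (Vec R d).
Local Notation B := (Rd R d).
Variables (lam : {measure set B -> \bar R}) (Hlam : is_lebesgue lam).

Definition shift (s : V) (x : B) : B := (x : V) + s.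

Lemma shift_Rd s : measurable_fun setT (shift s).
Proof.
apply: (measurability _ hbox_gen) => _ [_ [p _ <-] <-]; rewrite setTI.
rewrite (_ : _ @^-1` _ = hbox (p.1 - s) (p.2 - s)); first exact: hbox_Rd.
by apply/seteqP; split=> x /= h i; have := h i; rewrite /shift !mxE lerBlDr ltrBrDr.
Qed.

Lemma hbox_empty (a b : V) i : b ord0 i < a ord0 i -> hbox a b = set0.
Proof.
move=> ba; apply/seteqP; split => // x /(_ i) /andP[h1 h2].
by have := lt_le_trans h2 (ltW ba); rewrite ltNge h1.
Qed.

Lemma lam_hbox_shift s (a b : V) : lam (hbox (a - s) (b - s)) = lam (hbox a b).
Proof.
have [ab|] := pselect (forall i, a ord0 i <= b ord0 i).
  rewrite /hbox !Hlam//; last by move=> i; rewrite !mxE lerD2r.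
  by congr EFin; apply: eq_bigr => i _; rewrite !mxE; ring.
move=> /existsNP[i /negP]; rewrite -ltNge => ba.
by rewrite !(@hbox_empty _ _ i)// !mxE ltrD2r.
Qed.

(** The pushforward agrees with [lam] on half-open boxes, a generator stable under intersection that
    exhausts the space by sets of finite measure. *)
Lemma lam_shift s (A : set B) : measurable A -> lam (shift s @^-1` A) = lam A.
Proof.
move=> mA; have ms := shift_Rd s.
pose mp : {measure set B -> \bar R} := pushforward lam (shift s).
rewrite -[LHS]/(mp ms A); apply/esym.
apply: (measure_unique [set hbox p.1 p.2 | p in [set: V * V]]
   (fun n => hbox (\row_i - n%:R) (\row_i n%:R))) => //.
- exact: hbox_gen.
- by move=> _ _ [p _ <-] [q _ <-]; rewrite hboxI; eexists (_, _).
- by move=> n; eexists (_, _).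
- apply/seteqP; split => // x _.
  have [n hn] : exists n : nat, `|(x : V)| < n%:R.
    by exists (Num.bound `|(x : V)|); exact: archi_boundP.
  exists n => // i; have := le_lt_trans (coord_le_norm (x : V) i) hn.
  by rewrite !mxE ltr_norml => /andP[/ltW -> ->].
- move=> _ [[a b] _ <-] /=; rewrite /mp /pushforward.
  rewrite (_ : _ @^-1` _ = hbox (a - s) (b - s)) ?lam_hbox_shift//.
  by apply/seteqP; split=> x /= h i; have := h i; rewrite /shift !mxE lerBlDr ltrBrDr.
- move=> n; rewrite /hbox Hlam ?ltry// => i; rewrite !mxE.
  by rewrite (@le_trans _ _ 0)// oppr_le0.
Qed.

Lemma lam_bounded (A : set B) (r : R) : (forall x, A x -> `|x : V| <= r) -> measurable A ->
  (lam A < +oo)%E.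
Proof.
move=> Ar mA; have [[x /Ar xr]|A0] := pselect (A !=set0); last first.
  rewrite (_ : A = set0) ?measure0//; apply/seteqP; split => // x Ax.
  by apply: A0; exists x.
have r0 : 0 <= r by exact: le_trans xr.
apply: (@le_lt_trans _ _ (lam (hbox (\row_i (- (r + 1))) (\row_i (r + 1))))).
  apply: le_measure; rewrite ?inE//; first exact: hbox_Rd.
  move=> z /Ar zr i; have := le_trans (coord_le_norm (z : V) i) zr.
  by rewrite !mxE ler_norml => /andP[h1 h2]; apply/andP; split; lra.
by rewrite /hbox Hlam ?ltry// => i; rewrite !mxE; lra.
Qed.

Lemma Rintegral_shift s (A : set B) (f : B -> R) : measurable A ->
  measurable_fun setT f -> lam.-integrable A (EFin \o f) ->
  lam.-integrable (shift s @^-1` A) (EFin \o (f \o shift s)) ->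
  Rintegral lam (shift s @^-1` A) (f \o shift s) = Rintegral lam A f.
Proof.
move=> mA mf fi fsi; have ms := shift_Rd s.
rewrite /Rintegral; congr fine.
have -> : (\int[lam]_(x in A) (f x)%:E = \int[pushforward lam (shift s)]_(x in A) (f x)%:E)%E.
  apply: eq_measure_integral => X mX _.
  by rewrite -[RHS]/(lam (shift s @^-1` X)) lam_shift.
rewrite (integral_pushforward ms)//; exact/measurable_EFinP.
Qed.

(** Translates of the slice by multiples of [w] are disjoint and stay bounded. *)
Lemma hyperplane_null (w : V) (L : set V) (r : R) : w != 0 -> measurable (L : set B) ->
  (forall x, L x -> `|x| <= r) -> (forall x, L x -> dotp x w = 0) -> lam L = 0%E.
Proof.
move=> w0 mL Lr Lw; pose t n : V := (n.+1%:R^-1) *: w.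
have ww : dotp w w != 0.
  apply: contra w0 => /eqP h; apply/eqP/rowP => i; rewrite mxE.
  have nn (j : 'I_d) : predT j -> 0 <= w ord0 j * w ord0 j by rewrite -expr2 sqr_ge0.
  have := psumr_eq0P nn h => /(_ i isT) /eqP.
  by rewrite mulf_eq0 orbb => /eqP.
pose F n : set B := shift (- t n) @^-1` (L : set B).
have mF n : measurable (F n).
  by rewrite -[X in measurable X]setTI; apply: shift_Rd.
have tF : trivIset setT F.
  move=> n m _ _ [x [/= Lx Lx']].
  have := Lw _ Lx; have := Lw _ Lx'; rewrite /shift /t !dotpDl !dotpNl !dotpZl => /subr0_eq h1 /subr0_eq h2.
  have /(mulIf ww) : n.+1%:R^-1 * dotp w w = m.+1%:R^-1 * dotp w w.
    by rewrite -h1 -h2.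
  by move=> /invr_inj /eqP; rewrite eqr_nat => /eqP [].
have Ffin : (lam (\bigcup_n F n) < +oo)%E.
  apply: (@lam_bounded _ (r + `|w|)); last exact: bigcupT_measurable.
  move=> x [n _ /Lr]; rewrite /shift => xr.
  rewrite -(subrK (t n) (x : V)) (le_trans (ler_normD _ _))// lerD//.
  rewrite normrZ ler_piMl// ger0_norm ?invr_ge0//.
  by rewrite invf_le1// ler1n.
have LF n : lam (F n) = lam L by exact: lam_shift.
have := @measure_semi_sigma_additive _ _ _ lam F mF tF (bigcupT_measurable _ mF).
move=> /cvg_lim => /(_ (@ereal_hausdorff R)) E.
apply/eqP; rewrite eq_le measure_ge0 andbT leNgt; apply/negP => L0.
have Lfin : (lam L < +oo)%E by exact: lam_bounded Lr mL.
have le_n n : (\sum_(0 <= i < n) lam L <= lam (\bigcup_n F n))%E.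
  rewrite -E (eq_bigr (fun i => lam (F i))); last by move=> i _; rewrite LF.
  by apply: nneseries_lim_ge.
have U0 : (0 <= lam (\bigcup_n F n))%E by exact: measure_ge0.
move: U0 Ffin L0 Lfin le_n.
case: (lam (\bigcup_n F n)) => [C| |]// C0 _; case: (lam L) => [l| |]// l0 _ le_n.
have l0' : 0 < l by rewrite -lte_fin.
have C0' : 0 <= C by rewrite -lee_fin.
have := le_n (Num.bound (C / l)); rewrite sumEFin lee_fin sumr_const_nat subn0.
rewrite leNgt -mulr_natl -ltr_pdivrMr//.
by rewrite archi_boundP// divr_ge0// ltW.
Qed.

End Lebesgue.

(** * Orthogonality of characters *)

Section ComplexIntegral.
Context {R : realType} {d : nat}.
Local Notation V := (Vec R d).
Local Notation B := (Rd R d).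
Variable lam : {measure set B -> \bar R}.
Implicit Types (D : set B) (h : B -> R[i]).

Definition cintegrable D h :=
  lam.-integrable D (EFin \o (fun x => cRe (h x))) /\
  lam.-integrable D (EFin \o (fun x => cIm (h x))).

Lemma integrable_eqR D (f g : B -> R) : f =1 g -> lam.-integrable D (EFin \o f) ->
  lam.-integrable D (EFin \o g).
Proof. by move=> /funext ->. Qed.

Lemma integrableZR D (c : R) (f : B -> R) : measurable D -> lam.-integrable D (EFin \o f) ->
  lam.-integrable D (EFin \o (fun x => c * f x)).
Proof. by move=> mD fi; exact: (integrableZl mD c fi). Qed.

Lemma integrableDR D (f g : B -> R) : measurable D -> lam.-integrable D (EFin \o f) ->
  lam.-integrable D (EFin \o g) -> lam.-integrable D (EFin \o (fun x => f x + g x)).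
Proof. by move=> mD fi gi; exact: (integrableD mD fi gi). Qed.

Lemma integrableBR D (f g : B -> R) : measurable D -> lam.-integrable D (EFin \o f) ->
  lam.-integrable D (EFin \o g) -> lam.-integrable D (EFin \o (fun x => f x - g x)).
Proof. by move=> mD fi gi; exact: (integrableB mD fi gi). Qed.

Lemma cintegrableD D h h' : measurable D -> cintegrable D h -> cintegrable D h' ->
  cintegrable D (fun x => h x + h' x) /\
  cint lam D (fun x => h x + h' x) = cint lam D h + cint lam D h'.
Proof.
move=> mD [hR hI] [hR' hI']; split.
  split; first by apply: integrable_eqR (integrableDR mD hR hR') => x; rewrite cReD.
  by apply: integrable_eqR (integrableDR mD hI hI') => x; rewrite cImD.
rewrite /cint; apply/eqP; rewrite eq_complex/= -!RintegralD//.
by apply/andP; split; apply/eqP; apply: eq_Rintegral => x _; rewrite ?cReD ?cImD.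
Qed.

Lemma cintegrableZ D (c : R[i]) h : measurable D -> cintegrable D h ->
  cintegrable D (fun x => c * h x) /\
  cint lam D (fun x => c * h x) = c * cint lam D h.
Proof.
move=> mD [hR hI]; split.
  split.
    by apply: integrable_eqR (integrableBR mD (integrableZR (cRe c) mD hR)
      (integrableZR (cIm c) mD hI)) => x; rewrite cReM.
  by apply: integrable_eqR (integrableDR mD (integrableZR (cRe c) mD hI)
    (integrableZR (cIm c) mD hR)) => x; rewrite cImM.
rewrite /cint; apply/eqP; rewrite eq_complex -/(cRe _) -/(cRe _) -/(cIm _) -/(cIm _).
rewrite cReM cImM /= -!RintegralZl//.
rewrite -RintegralB -?RintegralD//; [|exact: integrableZR..].
by apply/andP; split; apply/eqP; apply: eq_Rintegral => x _; rewrite ?cReM ?cImM.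
Qed.

Lemma cintegrable0 D : cintegrable D (fun=> 0) /\ cint lam D (fun=> 0) = 0.
Proof.
split; first by split; exact: integrable0.
by rewrite /cint /Rintegral /= integral0.
Qed.

Lemma cintegrable_sum D (I : Type) (r : seq I) (h : I -> B -> R[i]) : measurable D ->
  (forall i, cintegrable D (h i)) ->
  cintegrable D (fun x => \sum_(i <- r) h i x) /\
  cint lam D (fun x => \sum_(i <- r) h i x) = \sum_(i <- r) cint lam D (h i).
Proof.
move=> mD hi; elim: r => [|i r [IHi IHe]].
  rewrite big_nil; have -> : (fun x => \sum_(i <- [::]) h i x) = fun=> 0.
    by apply/funext => x; rewrite big_nil.
  exact: cintegrable0.
have -> : (fun x => \sum_(j <- i :: r) h j x) = fun x => h i x + \sum_(j <- r) h j x.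
  by apply/funext => x; rewrite big_cons.
by rewrite big_cons -IHe; exact: cintegrableD.
Qed.

Lemma cint_bound D h (g : B -> R) : measurable D -> cintegrable D h ->
  lam.-integrable D (EFin \o g) -> (forall x, D x -> cmod (h x) <= g x) ->
  cmod (cint lam D h) <= 2 * Rintegral lam D g.
Proof.
move=> mD [hR hI] gi hg; rewrite (le_trans (cmod_le_ReIm _))//=.
have key (f : B -> R) : lam.-integrable D (EFin \o f) -> (forall x, D x -> `|f x| <= g x) ->
    `|Rintegral lam D f| <= Rintegral lam D g.
  move=> fi fg; rewrite (le_trans (le_normr_Rintegral mD fi))//.
  by apply: le_Rintegral => //; exact: (integrable_abse fi).
have -> : 2 * Rintegral lam D g = Rintegral lam D g + Rintegral lam D g by ring.
apply: lerD; apply: key => // x Dx.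
  by rewrite (le_trans (Re_le_cmod _))// hg.
by rewrite (le_trans (Im_le_cmod _))// hg.
Qed.

Lemma cintegrable_le D h (g : B -> R) : measurable D ->
  measurable_fun D (fun x => cRe (h x)) -> measurable_fun D (fun x => cIm (h x)) ->
  lam.-integrable D (EFin \o g) -> (forall x, D x -> cmod (h x) <= g x) ->
  cintegrable D h.
Proof.
move=> mD mR mI gi hg; split; apply: (le_integrable mD _ _ gi).
- exact/measurable_EFinP.
- move=> x Dx /=; rewrite lee_fin (le_trans (Re_le_cmod _))//.
  by rewrite (le_trans (hg x Dx))// ler_norm.
- exact/measurable_EFinP.
- move=> x Dx /=; rewrite lee_fin (le_trans (Im_le_cmod _))//.
  by rewrite (le_trans (hg x Dx))// ler_norm.
Qed.

End ComplexIntegral.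

Section Orthogonality.
Context {R : realType} {d : nat}.
Local Notation V := (Vec R d).
Local Notation B := (Rd R d).
Variables (lam : {measure set B -> \bar R}) (Hlam : is_lebesgue lam).

(** The box is cut into 2 m strips of width [w] across direction [i]. A shift by [w] carries each
    strip to the next and changes the sign of the integrand, so the strips cancel in pairs.
    Translation invariance thus takes the place of iterated integration. *)
Lemma antiperiodic_int (a b : V) (i : 'I_d) (m : nat) (w : R) (r : B -> R) :
  0 <= w -> b ord0 i = a ord0 i + (2 * m)%:R * w ->
  measurable_fun setT r -> (forall x, `|r x| <= 1) ->
  (forall x, r (shift (w *: delta_mx ord0 i) x) = - r x) ->
  Rintegral lam (hbox a b) r = 0.
Proof.
move=> w0 bi mr r1; pose s : V := w *: delta_mx ord0 i; rewrite -/s => anti.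
pose P j : set B := hbox a b `&` [set x : B | (x : V) ord0 i < a ord0 i + j%:R * w].
pose S j : set B := hbox a b `&` [set x : B |
  a ord0 i + j%:R * w <= (x : V) ord0 i < a ord0 i + j.+1%:R * w].
have mcoord (A : set R) : measurable A -> measurable [set x : B | A ((x : V) ord0 i)].
  by move=> mA; rewrite -[X in measurable X]setTI; apply: coord_Rd.
have mP j : measurable (P j).
  apply: measurableI; first exact: hbox_Rd.
  apply: (mcoord `]-oo, (a ord0 i + j%:R * w)[%classic); exact: measurable_itv.
have mS j : measurable (S j).
  apply: measurableI; first exact: hbox_Rd.
  apply: (mcoord `[a ord0 i + j%:R * w, a ord0 i + j.+1%:R * w[%classic).
  exact: measurable_itv.
have box_bd (x : B) : hbox a b x -> `|(x : V)| <= `|a| + `|b|.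
  move=> xab; apply: norm_le_coord => [|k]; first by rewrite addr_ge0.
  have /andP[h1 h2] := xab k; have := coord_le_norm a k; have := coord_le_norm b k.
  by rewrite !ler_norml => /andP[h3 h4] /andP[h5 h6]; apply/andP; split; lra.
have fin (A : set B) : measurable A -> A `<=` hbox a b -> (lam A < +oo)%E.
  by move=> mA Aab; apply: (lam_bounded Hlam (r := `|a| + `|b|)) => // x /Aab /box_bd.
have ri (A : set B) : measurable A -> A `<=` hbox a b -> lam.-integrable A (EFin \o r).
  move=> mA Aab; apply: (bounded_integrable (M := 1)) => //; first exact: fin.
  exact: measurable_funS mr.
have step j : (j.+2 <= 2 * m)%N ->
    Rintegral lam (S j.+1) r = - Rintegral lam (S j) r.
  move=> jm.
  have pre : shift s @^-1` S j.+1 = S j.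
    have jw : j.+2%:R * w <= (2 * m)%:R * w by rewrite ler_wpM2r// ler_nat.
    have coordk (x : B) k : shift s x ord0 k = (x : V) ord0 k + (k == i)%:R * w.
      by rewrite /shift /s !mxE eqxx/= mulrC.
    have e1 : j.+1%:R = j%:R + 1 :> R by rewrite natr1.
    have e2 : j.+2%:R = j%:R + 1 + 1 :> R by rewrite -e1 natr1.
    have jw0 : 0 <= j%:R * w by rewrite mulr_ge0.
    rewrite e2 in jw.
    apply/seteqP; split => x [/= hx].
      have xi := coordk x i; rewrite eqxx mul1r in xi; rewrite xi e2 e1 => /andP[h1 h2].
      have hi : a ord0 i + j%:R * w <= (x : V) ord0 i < a ord0 i + (j%:R + 1) * w.
        by apply/andP; split; lra.
      split; last by rewrite /= e1.
      move=> k; case: (eqVneq k i) => [->|ki]; last first.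
        by have := hx k; rewrite coordk (negbTE ki) mul0r addr0.
      by rewrite bi; case/andP: hi => h3 h4; apply/andP; split; lra.
    rewrite e1 => /andP[h1 h2]; split => [k|/=]; last first.
      by rewrite coordk eqxx mul1r e2 e1; apply/andP; split; lra.
    rewrite coordk; case: (eqVneq k i) => [->|ki]; last by rewrite mul0r addr0; exact: hx.
    by rewrite mul1r bi; apply/andP; split; lra.
  have SS k : S k `<=` hbox a b by move=> x [].
  rewrite -(Rintegral_shift Hlam (s := s) (mS j.+1) mr (ri _ (mS _) (@SS _))); last first.
    rewrite pre; apply: integrable_eqR (integrableZR (-1) (mS j) (ri _ (mS j) (@SS j))).
    by move=> x /=; rewrite anti mulN1r.
  rewrite pre -mulN1r -RintegralZl//; last exact: ri.
  by apply: eq_Rintegral => x _ /=; rewrite anti mulN1r.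
have split_ j : Rintegral lam (P j.+1) r = Rintegral lam (P j) r + Rintegral lam (S j) r.
  have jw0 : j%:R * w <= j.+1%:R * w by rewrite ler_wpM2r// ler_nat.
  have PS : P j.+1 = P j `|` S j.
    apply/seteqP; split => x.
      move=> [hx /= h]; have [h'|h'] := ltP ((x : V) ord0 i) (a ord0 i + j%:R * w).
        by left.
      by right; split => //=; rewrite h'.
    case=> -[hx /= h]; split => //=; last by case/andP: h.
    by rewrite (lt_le_trans h)// lerD2l.
  rewrite PS Rintegral_setU//.
    by apply: ri; [exact: measurableU|by move=> x [[]|[]]].
  by apply/disj_setPS => x [[_ /= h1] [_ /= /andP[h2 _]]]; move: h1; rewrite ltNge h2.
have P0 l : (l <= m)%N -> Rintegral lam (P (2 * l)%N) r = 0.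
  elim: l => [|l IH] lm.
    rewrite (_ : P _ = set0) ?Rintegral_set0//; apply/seteqP; split => // x [hx /=].
    by rewrite muln0 mul0r addr0 ltNge; have /andP[-> _] := hx i.
  have -> : (2 * l.+1)%N = (2 * l).+2 by rewrite mulnS.
  rewrite !split_ IH ?(ltnW lm)// add0r step ?subrr//.
  by rewrite -[(2 * l).+2]/(2 + 2 * l)%N -mulnS leq_pmul2l.
rewrite -(P0 m (leqnn m)); congr (Rintegral lam _ r).
apply/seteqP; split => x; last by case.
by move=> hx; split => //=; have /andP[_] := hx i; rewrite bi.
Qed.

Definition Qbox (T : R) : set B := hbox (\row_i (- (T / 2))) (\row_i (T / 2)).

Lemma Qbox_Rd T : measurable (Qbox T).
Proof. exact: hbox_Rd. Qed.

Lemma lam_Qbox T : 0 <= T -> lam (Qbox T) = (T ^+ d)%:E.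
Proof.
move=> T0; rewrite /Qbox /hbox Hlam; last by move=> i; rewrite !mxE; lra.
rewrite (eq_bigr (fun=> T)) ?prodr_const ?card_ord// => i _.
by rewrite !mxE; field.
Qed.

Lemma chr_orth (T : R) (y : V) : 0 < T -> lattice T y -> y != 0 ->
  cint lam (Qbox T) (chr y : B -> R[i]) = 0.
Proof.
move=> T0 [n yn] y0.
have [i ni] : exists i, n i != 0.
  apply: contrapT => /forallNP h; move/eqP: y0; apply; apply/rowP => i.
  by rewrite yn mxE; have /negP := h i; rewrite negbK => /eqP ->; rewrite mul0r.
pose m := absz (n i); have m0 : (0 < m)%N by rewrite absz_gt0.
have mR : (m%:R : R) != 0 by rewrite pnatr_eq0 -lt0n.
(* Half a period of [chr y] in direction [i]: the phase of this shift is pi n_i / m, that is, pi or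
   - pi. *)
pose w := T / (2 * m)%:R.
have w0 : 0 <= w by rewrite divr_ge0// ltW.
have anti x : chr y (shift (w *: delta_mx ord0 i) x) = - chr y x.
  rewrite /shift chrDr; suff -> : chr y (w *: delta_mx ord0 i) = -1 by rewrite mulrN1.
  have -> : chr y (w *: delta_mx ord0 i) = expi (pi * ((n i)%:~R / m%:R)).
    rewrite /chr dotpZl; congr expi; rewrite /dotp (bigD1 i)//= big1 => [|j ji].
      rewrite addr0 mxE !eqxx mul1r yn /w natrM; field.
      by rewrite mR gt_eqF.
    by rewrite mxE eqxx (negbTE ji) mul0r.
  have : (n i)%:~R = m%:R :> R \/ (n i)%:~R = - m%:R :> R.
    by rewrite /m; case: (n i) => k; [left|right].
  case=> ->; rewrite ?mulNr divff// /expi ?mulrN mulr1 ?cosN ?sinN cospi sinpi ?oppr0.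
    by apply/eqP; rewrite eq_complex/= oppr0 !eqxx.
  by apply/eqP; rewrite eq_complex/= oppr0 !eqxx.
have bd : (\row_k (T / 2) : V) ord0 i = (\row_k (- (T / 2)) : V) ord0 i + (2 * m)%:R * w.
  by rewrite !mxE /w natrM; field; rewrite mR.
rewrite /cint /Qbox.
rewrite (antiperiodic_int w0 bd (Re_chr_Rd y)); last 2 first.
- by move=> x; rewrite (le_trans (Re_le_cmod _))// cmod_chr.
- by move=> x; rewrite anti; case: (chr y x).
rewrite (antiperiodic_int w0 bd (Im_chr_Rd y))//.
- by move=> x; rewrite (le_trans (Im_le_cmod _))// cmod_chr.
- by move=> x; rewrite anti; case: (chr y x).
Qed.

Lemma chr_int0 (T : R) : 0 <= T -> cint lam (Qbox T) (chr (0 : V) : B -> R[i]) = cofR (T ^+ d).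
Proof.
move=> T0; have c1 x : chr (0 : V) x = 1 by rewrite /chr dotpC dotp0l mulr0 expi0.
have -> : (chr (0 : V) : B -> R[i]) = cst 1 by apply/funext.
rewrite /cint /= Rintegral_cst; last exact: Qbox_Rd.
by rewrite Rintegral_cst ?lam_Qbox//= ?mul1r ?mul0r//; exact: Qbox_Rd.
Qed.

End Orthogonality.

(** * Bessel and Parseval *)

Lemma uniq_map_inj (A B : eqType) (f : A -> B) (s : seq A) :
  uniq (map f s) -> {in s &, injective f}.
Proof.
elim: s => //= a s IH /andP[/negP na us] x y; rewrite !inE.
move=> /orP[/eqP->|xs] /orP[/eqP->|ys]//; last exact: IH.
  by move=> e; case: na; rewrite e map_f.
by move=> e; case: na; rewrite -e map_f.
Qed.

Section Parseval.
Context {R : realType} {d : nat}.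
Local Notation V := (Vec R d).
Local Notation B := (Rd R d).
Variables (lam : {measure set B -> \bar R}) (Hlam : is_lebesgue lam).
Variables (T : R) (T0 : 0 < T).
Implicit Types (h g : B -> R[i]) (s : seq (R[i] * V)) (Y : seq V).

Let Q := Qbox T : set B.
Let mQ : measurable (Q : set B). Proof. exact: Qbox_Rd. Qed.

Definition cmeasf h := measurable_fun setT (fun x => cRe (h x)) /\
  measurable_fun setT (fun x => cIm (h x)).

Definition sq h := fun x : B => cmod (h x) ^+ 2.

(** The frequencies carry a minus sign because [hat], like the inverse Fourier transform, integrates
    against [chr y] and not its conjugate. *)
Definition tp s : B -> R[i] := fun x => papp s (fun y => chr (- y) x).

Definition hat h (y : V) : R[i] := cint lam (Qbox T) (fun x => h x * chr y x).

Lemma cmeasD h g : cmeasf h -> cmeasf g -> cmeasf (fun x => h x + g x).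
Proof.
move=> [h1 h2] [g1 g2]; split.
  by under eq_fun do rewrite cReD; exact: measurable_funD.
by under eq_fun do rewrite cImD; exact: measurable_funD.
Qed.

Lemma cmeasM h g : cmeasf h -> cmeasf g -> cmeasf (fun x => h x * g x).
Proof.
move=> [h1 h2] [g1 g2]; split.
  by under eq_fun do rewrite cReM; apply: measurable_funB; exact: measurable_funM.
by under eq_fun do rewrite cImM; apply: measurable_funD; exact: measurable_funM.
Qed.

Lemma cmeas_cst (c : R[i]) : cmeasf (fun=> c).
Proof. by split; exact: measurable_cst. Qed.

Lemma cmeas_chr (y : V) : cmeasf (chr y : B -> R[i]).
Proof. by split; [exact: Re_chr_Rd|exact: Im_chr_Rd]. Qed.

Lemma cmeasB h g : cmeasf h -> cmeasf g -> cmeasf (fun x => h x - g x).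
Proof.
move=> hm gm; have := cmeasD hm (cmeasM (cmeas_cst (-1)) gm).
by under eq_fun do rewrite mulN1r.
Qed.

Lemma cmeas_tp s : cmeasf (tp s).
Proof.
elim: s => [|p s IH].
  have -> : tp [::] = fun=> 0 by apply/funext => x; rewrite /tp /papp big_nil.
  exact: cmeas_cst.
have -> : tp (p :: s) = fun x => p.1 * chr (- p.2) x + tp s x.
  by apply/funext => x; rewrite /tp /papp big_cons.
by apply: cmeasD => //; apply: cmeasM; [exact: cmeas_cst|exact: cmeas_chr].
Qed.

Lemma sq_meas h : cmeasf h -> measurable_fun setT (sq h).
Proof.
move=> [h1 h2]; rewrite (_ : sq h = fun x => cRe (h x) ^+ 2 + cIm (h x) ^+ 2).
  by apply: measurable_funD; exact: measurable_funX.
by apply/funext => x; rewrite /sq sqr_cmod.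
Qed.

Lemma Q_fin : (lam Q < +oo)%E.
Proof. by rewrite /Q (lam_Qbox Hlam (ltW T0)) ltry. Qed.

Lemma cst_int (c : R) : lam.-integrable Q (EFin \o (fun=> c)).
Proof.
apply: (bounded_integrable mQ Q_fin (M := `|c|)) => //.
Qed.

Lemma L2_L1 h : cmeasf h -> lam.-integrable Q (EFin \o sq h) -> cintegrable lam Q h.
Proof.
move=> [h1 h2] hi; apply: (cintegrable_le (g := fun x => 1 + sq h x)) => //.
- exact: measurable_funS h1.
- exact: measurable_funS h2.
- exact: (integrableDR mQ (cst_int 1) hi).
by move=> x _; rewrite /sq; have := cmod_ge0 (h x); nra.
Qed.

Lemma chrP_int h y : cmeasf h -> lam.-integrable Q (EFin \o sq h) ->
  cintegrable lam Q (fun x => h x * chr y x).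
Proof.
move=> hm hi; have hcm := cmeasM hm (cmeas_chr y); apply: L2_L1 => //.
apply: integrable_eqR hi => x.
by rewrite /sq cmodM cmod_chr mulr1.
Qed.

Lemma cconj_mul (z : R[i]) : z * z^*%C = cofR (cmod z ^+ 2).
Proof.
case: z => a b; rewrite sqr_cmod; apply/eqP; rewrite eq_complex/= /cRe /cIm /=.
by apply/andP; split; apply/eqP; ring.
Qed.

Lemma chr_conj (y x : V) : (chr y x)^*%C = chr (- y) x.
Proof.
rewrite /chr dotpNr mulrN /expi cosN sinN; apply/eqP.
by rewrite eq_complex/= !eqxx.
Qed.

Lemma cint_chr_lattice (y z : V) : lattice T y -> lattice T z ->
  cint lam Q (chr (y - z) : B -> R[i]) = if y == z then cofR (T ^+ d) else 0.
Proof.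
move=> [n yn] [m zm]; case: eqVneq => [->|yz].
  by rewrite subrr /Q chr_int0// ltW.
apply: chr_orth => //; last by rewrite subr_eq0.
exists (fun i => n i - m i) => i.
by rewrite !mxE yn zm intrB mulrBl.
Qed.

Lemma chr_cint (y : V) : cintegrable lam Q (chr y : B -> R[i]).
Proof.
have [h1 h2] := cmeas_chr y.
apply: (cintegrable_le (g := fun=> 1)) => //; last 2 first.
- exact: cst_int.
- by move=> x _; rewrite cmod_chr.
- exact: measurable_funS h1.
- exact: measurable_funS h2.
Qed.

(** Lattice characters are orthogonal over [Q] with square norm T^d, so for distinct frequencies
    only the diagonal of the double sum survives. *)
Lemma int_sq_expand h s : cmeasf h -> lam.-integrable Q (EFin \o sq h) ->
  uniq (map snd s) -> (forall p, p \in s -> lattice T p.2) ->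
  lam.-integrable Q (EFin \o sq (fun x => h x - tp s x)) /\
  Rintegral lam Q (sq (fun x => h x - tp s x)) =
  Rintegral lam Q (sq h) - 2 * \sum_(p <- s) cRe (p.1^*%C * hat h p.2) +
  T ^+ d * \sum_(p <- s) cmod p.1 ^+ 2.
Proof.
move=> hm hi us sl.
pose X := fun x : B => \sum_(p <- s) p.1^*%C * (h x * chr p.2 x).
pose Z := fun x : B => \sum_(p <- s) \sum_(q <- s) (p.1 * q.1^*%C) * chr (q.2 - p.2) x.
have expand x : sq (fun x => h x - tp s x) x = sq h x - 2 * cRe (X x) + cRe (Z x).
  have tpc : (tp s x)^*%C = \sum_(p <- s) p.1^*%C * chr p.2 x.
    rewrite /tp /papp rmorph_sum; apply: eq_bigr => p _.
    rewrite rmorphM; congr (_ * _).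
    by rewrite -[LHS]/((chr (- p.2) x)^*%C) chr_conj opprK.
  have XE : X x = h x * (tp s x)^*%C.
    by rewrite tpc mulr_sumr; apply: eq_bigr => p _; rewrite mulrCA.
  have ZE : Z x = cofR (cmod (tp s x) ^+ 2).
    rewrite -cconj_mul tpc {1}/tp /papp mulr_suml; apply: eq_bigr => p _.
    rewrite mulr_sumr; apply: eq_bigr => q _.
    by rewrite (addrC q.2) chrDl -!mulrA; congr (_ * _); rewrite mulrCA.
  rewrite XE ZE /sq !sqr_cmod; case: (h x) => a b; case: (tp s x) => a' b'.
  by rewrite /cRe /cIm /=; ring.
have [Xi XE] : cintegrable lam Q X /\ cint lam Q X = \sum_(p <- s) p.1^*%C * hat h p.2.
  have pi (p : R[i] * V) := cintegrableZ p.1^*%C mQ (chrP_int p.2 hm hi).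
  have [Xi XE] := cintegrable_sum s mQ (fun p => (pi p).1).
  by split => //; rewrite XE; apply: eq_bigr => p _; rewrite (pi p).2.
have [Zi ZE] : cintegrable lam Q Z /\
    cint lam Q Z = cofR (T ^+ d * \sum_(p <- s) cmod p.1 ^+ 2).
  have qi (p q : R[i] * V) := cintegrableZ (p.1 * q.1^*%C) mQ (chr_cint (q.2 - p.2)).
  have pi (p : R[i] * V) := cintegrable_sum s mQ (fun q => (qi p q).1).
  have [Zi ZE] := cintegrable_sum s mQ (fun p => (pi p).1).
  split => //; rewrite ZE cofRM (big_morph (@cofR R) cofRD (erefl : cofR 0 = 0)) mulr_sumr.
  rewrite big_seq [RHS]big_seq; apply: eq_bigr => p ps.
  rewrite (pi p).2 big_seq.
  transitivity (\sum_(q <- s | q \in s) if q == p then p.1 * p.1^*%C * cofR (T ^+ d) else 0).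
    apply: eq_bigr => q qs; rewrite (qi p q).2 cint_chr_lattice; [|exact: sl..].
    case: (eqVneq q p) => [->|qp]; first by rewrite eqxx.
    case: eqP => [e|]; rewrite ?mulr0//; move/eqP: qp; case.
    exact: (uniq_map_inj us qs ps).
  rewrite -big_seq -big_mkcond/= big_const_seq.
  have -> : count (fun i => i == p) s = 1%N.
    rewrite -[LHS]/(count_mem p s) count_uniq_mem ?ps//.
    exact: map_uniq us.
  by rewrite /= addr0 cconj_mul mulrC.
have RX : Rintegral lam Q (fun x => cRe (X x)) = \sum_(p <- s) cRe (p.1^*%C * hat h p.2).
  by rewrite -cRe_sum -XE.
have RZ : Rintegral lam Q (fun x => cRe (Z x)) = T ^+ d * \sum_(p <- s) cmod p.1 ^+ 2.
  by rewrite -[LHS]/(cRe (cint lam Q Z)) ZE.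
have i1 := integrableBR mQ hi (integrableZR 2 mQ Xi.1).
have i2 := integrableDR mQ i1 Zi.1.
split; first by apply: integrable_eqR i2 => x; rewrite expand.
transitivity (Rintegral lam Q (fun x => (sq h x - 2 * cRe (X x)) + cRe (Z x))).
  by apply: eq_Rintegral => x _; exact: expand.
rewrite (RintegralD mQ i1 Zi.1) (RintegralB mQ hi (integrableZR 2 mQ Xi.1)).
by rewrite (RintegralZl _ mQ Xi.1) RX RZ.
Qed.

(** The expansion is nonnegative at the optimal coefficients T^-d hat h(y). *)
Lemma bessel h Y : cmeasf h -> lam.-integrable Q (EFin \o sq h) ->
  uniq Y -> (forall y, y \in Y -> lattice T y) ->
  \sum_(y <- Y) cmod (hat h y) ^+ 2 <= T ^+ d * Rintegral lam Q (sq h).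
Proof.
move=> hm hi uY YT; have Td : 0 < T ^+ d by rewrite exprn_gt0.
pose s := [seq (cofR (T ^+ d)^-1 * hat h y, y) | y <- Y].
have us : uniq (map snd s) by rewrite -map_comp map_id_in.
have sl p : p \in s -> lattice T p.2 by move=> /mapP[y yY ->]; exact: YT.
have [_] := int_sq_expand hm hi us sl.
have := @Rintegral_ge0 _ _ _ lam Q (sq (fun x => h x - tp s x)) (fun x _ => sqr_ge0 _).
move=> + E; rewrite E !big_map /=.
have -> : \sum_(y <- Y) cRe ((cofR (T ^+ d)^-1 * hat h y)^*%C * hat h y) =
    (T ^+ d)^-1 * \sum_(y <- Y) cmod (hat h y) ^+ 2.
  rewrite mulr_sumr; apply: eq_bigr => y _.
  rewrite sqr_cmod; case: (hat h y) => a b; rewrite /cRe /cIm /=; ring.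
have -> : \sum_(y <- Y) cmod (cofR (T ^+ d)^-1 * hat h y) ^+ 2 =
    (T ^+ d)^-1 ^+ 2 * \sum_(y <- Y) cmod (hat h y) ^+ 2.
  rewrite mulr_sumr; apply: eq_bigr => y _.
  by rewrite cmodM cmod_cofR exprMn ger0_norm// invr_ge0 ltW.
set S := \sum_(y <- Y) _; set I2 := Rintegral _ _ _ => pos.
rewrite mulrC -ler_pdivrMr// -subr_ge0; apply: le_trans pos _.
rewrite le_eqVlt; apply/orP; left; apply/eqP.
by field; rewrite gt_eqF.
Qed.

Lemma tp_uniq s : (forall p, p \in s -> lattice T p.2) -> exists s',
  [/\ uniq (map snd s'), forall p, p \in s' -> lattice T p.2 & tp s =1 tp s'].
Proof.
move=> sl; pose Y := undup (map snd s).
exists [seq (\sum_(p <- s | p.2 == y) p.1, y) | y <- Y]; split.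
- by rewrite -map_comp map_id_in ?undup_uniq.
- move=> _ /mapP[y yY ->] /=; move: yY; rewrite mem_undup => /mapP[p ps ->].
  exact: sl.
move=> x; rewrite /tp /papp big_map /=.
transitivity (\sum_(y <- Y) \sum_(p <- s | p.2 == y) p.1 * chr (- p.2) x); last first.
  by apply: eq_bigr => y _; rewrite mulr_suml; apply: eq_bigr => p /eqP ->.
rewrite (exchange_big_dep predT)//= big_seq [RHS]big_seq; apply: eq_bigr => p ps.
rewrite big_const_seq.
have -> : count (fun y => p.2 == y) Y = 1%N.
  rewrite (eq_count (a2 := pred1 p.2)); last by move=> y; rewrite /= eq_sym.
  by rewrite count_uniq_mem ?undup_uniq// mem_undup map_f.
by rewrite /= addr0.
Qed.

(** The integral is extended-valued, so closure properties can be proved without checking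
    integrability on the way. *)
Definition apx g := forall e : R, 0 < e -> exists2 s, (forall p, p \in s -> lattice T p.2) &
  (\int[lam]_(x in Q) (sq (fun x => g x - tp s x) x)%:E <= e%:E)%E.

(** The inequality 2 Re(conj(c) a) <= T^d |c|^2 + T^-d |a|^2 compares arbitrary coefficients with
    the optimal ones, so any approximant serves. *)
Lemma parseval_le h : cmeasf h -> lam.-integrable Q (EFin \o sq h) -> apx h ->
  forall e : R, 0 < e -> exists Y, [/\ uniq Y, forall y, y \in Y -> lattice T y &
    Rintegral lam Q (sq h) <= (T ^+ d)^-1 * \sum_(y <- Y) cmod (hat h y) ^+ 2 + e].
Proof.
move=> hm hi ah e e0; have [s0 s0l hs0] := ah e e0.
have [s [us sl ss0]] := tp_uniq s0l.
have Td : 0 < T ^+ d by rewrite exprn_gt0.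
exists (map snd s); split => //; first by move=> _ /mapP[p ps ->]; exact: sl.
have [si E] := int_sq_expand hm hi us sl.
have : Rintegral lam Q (sq (fun x => h x - tp s x)) <= e.
  rewrite -lee_fin fineK; last exact: (integrable_fin_num mQ si).
  rewrite (eq_integral (fun x => (sq (fun x => h x - tp s0 x) x)%:E))// => x _.
  by rewrite /sq ss0.
rewrite E big_map => le_e.
have : 2 * \sum_(p <- s) cRe (p.1^*%C * hat h p.2) <=
    T ^+ d * \sum_(p <- s) cmod p.1 ^+ 2 + (T ^+ d)^-1 * \sum_(p <- s) cmod (hat h p.2) ^+ 2.
  rewrite !mulr_sumr -big_split; apply: ler_sum => p _ /=.
  have := le_trans (ler_norm _) (Re_le_cmod (p.1^*%C * hat h p.2)).
  have -> : cmod (p.1^*%C * hat h p.2) = cmod p.1 * cmod (hat h p.2).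
    by rewrite cmodM; congr (_ * _); rewrite /cmod; case: p.1 => a b; rewrite /cRe /cIm /= sqrrN.
  set a := cmod p.1; set b := cmod _; set D := T ^+ d in Td *.
  have : 0 <= D * (a - D^-1 * b) ^+ 2 by rewrite mulr_ge0 ?sqr_ge0// ltW.
  have -> : D * (a - D^-1 * b) ^+ 2 = D * a ^+ 2 + D^-1 * b ^+ 2 - 2 * (a * b).
    by field; rewrite gt_eqF.
  by lra.
by move: le_e; lra.
Qed.

End Parseval.

(** * Completeness of the trigonometric system *)

Section Real.
Context {R : realType}.
Implicit Types (x r t u w : R).

Lemma bernoulli_le x n : 0 <= x <= 1 -> 1 - n%:R * x <= (1 - x) ^+ n.
Proof.
move=> /andP[x0 x1]; elim: n => [|n IH]; first by rewrite mul0r subr0 expr0.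
rewrite exprS; apply: le_trans (ler_wpM2l _ IH); last by rewrite subr_ge0.
have n0 : 0 <= n%:R :> R by [].
rewrite -natr1; set m : R := n%:R in n0 *.
by have := mulr_ge0 n0 (sqr_ge0 x); nra.
Qed.

Lemma bernoulli_inv x n : 0 <= x <= 1 -> (1 - x) ^+ n * (1 + n%:R * x) <= 1.
Proof.
move=> /andP[x0 x1]; elim: n => [|n IH]; first by rewrite mul0r addr0 expr0 mulr1.
apply: le_trans IH; rewrite exprSr -mulrA ler_wpM2l ?exprn_ge0 ?subr_ge0//.
have n0 : 0 <= n%:R :> R by [].
rewrite -natr1; set m : R := n%:R in n0 *.
by have := mulr_ge0 n0 (sqr_ge0 x); nra.
Qed.

(** With r = s^2, Bernoulli bounds n s^n and a second factor s^n is left to vanish. *)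
Lemma cvg_nat_geom r : 0 <= r < 1 -> (fun n => n%:R * r ^+ n) @ \oo --> (0 : R).
Proof.
move=> /andP[r0 r1]; pose s := Num.sqrt r.
have s0 : 0 <= s by exact: sqrtr_ge0.
have s1 : s < 1 by rewrite -[ltRHS]sqrtr1 ltr_sqrt.
have bd n : n%:R * s ^+ n <= (1 - s)^-1.
  have := @bernoulli_inv (1 - s) n; rewrite subKr => h.
  have h' : s ^+ n * (1 + n%:R * (1 - s)) <= 1 by apply: h; apply/andP; split; lra.
  rewrite -[leRHS]mul1r ler_pdivlMr ?subr_gt0//.
  have : 0 <= s ^+ n by rewrite exprn_ge0.
  by move: h'; lra.
apply/cvgrPdist_le => e e0.
have lim : (fun n => (1 - s)^-1 * s ^+ n) @ \oo --> ((1 - s)^-1 * 0).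
  apply: cvgM; first exact: cvg_cst.
  by apply: cvg_expr; rewrite ger0_norm.
rewrite mulr0 in lim.
apply: filterS (cvgr_le _ lim _ e0) => n hn.
rewrite sub0r normrN ger0_norm ?mulr_ge0 ?exprn_ge0// (le_trans _ hn)//.
have -> : r ^+ n = s ^+ n * s ^+ n by rewrite -exprMn -expr2 sqr_sqrtr.
by rewrite mulrA ler_wpM2r ?exprn_ge0.
Qed.

Definition qstep (n : nat) t : R := (1 - t ^+ n) ^+ (n * 2 ^ n).

Lemma qstep_bd n t : 0 <= t <= 1 -> 0 <= qstep n t <= 1.
Proof.
move=> /andP[t0 t1]; have tn : 0 <= t ^+ n <= 1 by rewrite exprn_ge0// exprn_ile1.
case/andP: tn => h1 h2; rewrite /qstep exprn_ge0 ?subr_ge0//= exprn_ile1 ?subr_ge0//.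
by rewrite lerBlDr lerDl.
Qed.

(** With outer exponent N = n 2^n one has N t^n = n (2 t)^n. Below 1/2 this tends to 0 and 1 - N x
    <= (1 - x)^N applies; from 1/2 on it is at least n and (1 - x)^N <= 1 / (1 + N x) applies. The
    extra factor n settles t = 1/2. *)
Lemma qstep_cvg t : 0 <= t <= 1 -> (fun n => qstep n t) @ \oo --> ((t < 2^-1)%R%:R : R).
Proof.
move=> t01; have /andP[t0 t1] := t01.
have tn n : 0 <= t ^+ n <= 1 by rewrite exprn_ge0// exprn_ile1.
have Nt n : (n * 2 ^ n)%:R * t ^+ n = n%:R * (2 * t) ^+ n.
  by rewrite natrM natrX exprMn mulrA.
have [th|th] := ltP t 2^-1; apply/cvgrPdist_le => e e0.
  have [] : 0 <= 2 * t /\ 2 * t < 1 by split; lra.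
  move=> a0 a1; have lim := @cvg_nat_geom (2 * t) (ltac:(by rewrite a0 a1)).
  apply: filterS (cvgr_le _ lim _ e0) => n hn.
  have /andP[q0 q1] := qstep_bd n t01.
  rewrite ger0_norm ?subr_ge0// (le_trans _ hn)// lerBlDr -lerBlDl.
  by rewrite -Nt; exact: bernoulli_le.
have lim : (fun n => n.+1%:R^-1 : R) @ \oo --> (0 : R) by exact: cvg_harmonic.
apply: filterS (cvgr_le _ lim _ e0) => n hn.
have /andP[q0 q1] := qstep_bd n t01.
rewrite sub0r normrN ger0_norm// (le_trans _ hn)// -[leRHS]mul1r ler_pdivlMr//.
apply: le_trans (bernoulli_inv (n * 2 ^ n) (tn n)); rewrite ler_wpM2l//.
rewrite Nt -natr1 addrC lerD2l ler_peMr// exprn_ege1//.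
by lra.
Qed.

(** 3 T / 4 is the largest distance from a point of the period cube to a centre within T / 4 of the
    origin. For |u| between T / 2 and 3 T / 4 the cosine of u is nonpositive, while that of w <= T /
    4 is nonnegative, so the periodic return of the arc is not met. *)
Lemma cos_arc (T u w : R) : 0 < T -> `|u| < T * (3 / 4) -> 0 <= w <= T / 4 ->
  (cos (2 * pi * (w / T)) < cos (2 * pi * (u / T))) = (`|u| < w).
Proof.
move=> T0 uT /andP[w0 wT]; have p0 := pi_gt0 R.
have cu : cos (2 * pi * (u / T)) = cos (2 * pi * (`|u| / T)).
  rewrite -[in LHS]cos_norm !normrM normfV (gtr0_norm T0) (gtr0_norm p0).
  by rewrite (ger0_norm (_ : 0 <= 2)).
have wT' : w / T <= 4^-1 by rewrite ler_pdivrMr//; lra.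
have w0' : 0 <= w / T by rewrite divr_ge0// ltW.
have u0' : 0 <= `|u| / T by rewrite divr_ge0// ltW.
have uT' : `|u| / T < 3 / 4 by rewrite ltr_pdivrMr// mulrC.
have -> : (`|u| < w) = (`|u| / T < w / T) by rewrite ltr_pM2r ?invr_gt0.
rewrite cu; move: w0' u0' wT' uT'; set a := w / T; set b := `|u| / T => a0 b0 a4 b4.
have [b2|b2] := leP b 2^-1.
  rewrite ltr_cos ?in_itv /=; last 2 first.
  - have h := ler_wpM2l (ltW p0) b2; have h' := mulr_ge0 (ltW p0) b0.
    by apply/andP; split; lra.
  - have h := ler_wpM2l (ltW p0) a4; have h' := mulr_ge0 (ltW p0) a0.
    by apply/andP; split; lra.
  by rewrite ltr_pM2l// mulr_gt0.
have -> : (b < a) = false by apply/negbTE; rewrite -leNgt; lra.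
apply/negbTE; rewrite -leNgt; apply: (@le_trans _ _ 0).
  have -> : 2 * pi * b = pi + (2 * pi * b - pi) by ring.
  rewrite addrC cosDpi oppr_le0; apply: cos_ge0_pihalf.
  have h1 := ler_wpM2l (ltW p0) (ltW b2); have h2 := ler_wpM2l (ltW p0) (ltW b4).
  by apply/andP; split; lra.
have h1 := ler_wpM2l (ltW p0) a4; have h2 := mulr_ge0 (ltW p0) a0.
by apply: cos_ge0_pihalf; apply/andP; split; lra.
Qed.

(** The count is the minimum of [N] and the integer part of [t]. *)
Lemma count_le (N : nat) (t : R) : 0 <= t ->
  let c := \sum_(k < N) ((k.+1%:R <= t)%R%:R : R) in
  [/\ c <= t, c <= N%:R & N%:R <= c \/ t - 1 <= c].
Proof.
move=> t0; elim: N => [|N [IH1 IH2 IH3]]; first by rewrite big_ord0; split => //; left.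
rewrite /= big_ord_recr/=; case: (leP N.+1%:R t) => h; last first.
  rewrite addr0; split => //; first by rewrite (le_trans IH2)// ler_nat.
  by right; case: IH3 => // IH3; rewrite (le_trans _ IH3)// lerBlDr natr1 ltW.
split.
- by rewrite (le_trans _ h)// -natr1 lerD2r.
- by rewrite -natr1 lerD2r.
left; rewrite -natr1 lerD2r; case: IH3 => // IH3.
by rewrite (le_trans _ IH3)// lerBrDr natr1.
Qed.

End Real.

(** * Density of lattice trigonometric polynomials *)

Section Completeness.
Context {R : realType} {d : nat}.
Local Notation V := (Vec R d).
Local Notation B := (Rd R d).
Variables (lam : {measure set B -> \bar R}) (Hlam : is_lebesgue lam).
Variables (T : R) (T0 : 0 < T).
Implicit Types (h g : B -> R[i]) (s : seq (R[i] * V)) (f : B -> R) (A : set B).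

Let Q := Qbox T : set B.
Let mQ : measurable (Q : set B). Proof. exact: Qbox_Rd. Qed.

Local Notation apx := (apx lam T).

Definition is_tp g := exists2 s, (forall p, p \in s -> lattice T p.2) & g =1 tp s.

Lemma is_tp_eq g g' : g =1 g' -> is_tp g -> is_tp g'.
Proof. by move=> gg' [s sl gs]; exists s => // x; rewrite -gg'. Qed.

Lemma lattice0 : lattice T (0 : V).
Proof. by exists (fun=> 0) => i; rewrite mxE mul0r. Qed.

Lemma latticeD (x y : V) : lattice T x -> lattice T y -> lattice T (x + y).
Proof.
move=> [n xn] [m ym]; exists (fun i => n i + m i) => i.
by rewrite mxE xn ym intrD mulrDl.
Qed.

Lemma latticeN (x : V) : lattice T x -> lattice T (- x).
Proof.
by move=> [n xn]; exists (fun i => - n i) => i; rewrite mxE xn rmorphN mulNr.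
Qed.

Lemma is_tp_chr (c : R[i]) (y : V) : lattice T y -> is_tp (fun x => c * chr y x).
Proof.
move=> ly; exists [:: (c, - y)].
  by move=> p; rewrite inE => /eqP ->; exact: latticeN.
by move=> x; rewrite /tp papp1 opprK.
Qed.

Lemma is_tp_cst (c : R[i]) : is_tp (fun=> c).
Proof.
apply: is_tp_eq (is_tp_chr c lattice0) => x.
by rewrite /chr dotpC dotp0l mulr0 expi0 mulr1.
Qed.

Lemma is_tp_add g g' : is_tp g -> is_tp g' -> is_tp (fun x => g x + g' x).
Proof.
move=> [s sl gs] [t tl gt]; exists (s ++ t).
  by move=> p; rewrite mem_cat => /orP[/sl|/tl].
by move=> x; rewrite /tp papp_cat gs gt.
Qed.

Lemma is_tp_mul g g' : is_tp g -> is_tp g' -> is_tp (fun x => g x * g' x).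
Proof.
move=> [s sl gs] [t tl gt]; exists (convl s t).
  by move=> p /allpairsP[[a b] [/= /sl la /tl lb ->]]; exact: latticeD.
move=> x; rewrite gs gt /tp /papp big_allpairs_dep mulr_suml; apply: eq_bigr => p _.
by rewrite mulr_sumr; apply: eq_bigr => q _ /=; rewrite opprD chrDl mulrACA.
Qed.

Lemma is_tp_exp g n : is_tp g -> is_tp (fun x => g x ^+ n).
Proof.
move=> tg; elim: n => [|n IH].
  by apply: is_tp_eq (is_tp_cst 1) => x; rewrite expr0.
by apply: is_tp_eq (is_tp_mul tg IH) => x; rewrite exprS.
Qed.

Lemma is_tp_prod (I : Type) (r : seq I) (G : I -> B -> R[i]) : (forall i, is_tp (G i)) ->
  is_tp (fun x => \prod_(i <- r) G i x).
Proof.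
move=> tG; elim: r => [|i r IH].
  by apply: is_tp_eq (is_tp_cst 1) => x; rewrite big_nil.
by apply: is_tp_eq (is_tp_mul (tG i) IH) => x; rewrite big_cons.
Qed.

Lemma is_tp_cos (c : R) (i : 'I_d) :
  is_tp (fun x : B => cofR (cos (2 * pi * (((x : V) ord0 i - c) / T)))).
Proof.
pose y : V := T^-1 *: delta_mx ord0 i.
have ly : lattice T y.
  exists (fun j => (j == i)%:Z) => j; rewrite !mxE eqxx/= mulrC.
  by case: (j == i).
have dy (x : V) : dotp x y = x ord0 i / T.
  rewrite /y dotpZr mulrC; congr (_ / _); rewrite /dotp (bigD1 i)//= big1 ?addr0.
    by rewrite mxE !eqxx mulr1.
  by move=> j ji; rewrite mxE eqxx (negbTE ji) mulr0.
pose e0 := expi (- (2 * pi * (c / T))).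
apply: is_tp_eq (is_tp_mul (is_tp_cst (cofR 2^-1))
  (is_tp_add (is_tp_chr e0 ly) (is_tp_chr (expi (2 * pi * (c / T))) (latticeN ly)))) => x.
rewrite /e0 /chr dotpNr mulrN -!expiD dy.
have -> : - (2 * pi * (c / T)) + 2 * pi * ((x : V) ord0 i / T) =
  2 * pi * (((x : V) ord0 i - c) / T) by ring.
have -> : 2 * pi * (c / T) - 2 * pi * ((x : V) ord0 i / T) =
  - (2 * pi * (((x : V) ord0 i - c) / T)) by ring.
by rewrite expi_add_opp -cofRM; congr cofR; field.
Qed.

Lemma is_tp_cmeas g : is_tp g -> cmeasf g.
Proof.
by move=> [s _ gs]; have -> : g = tp s; [exact/funext|exact: cmeas_tp].
Qed.

Definition dist2 g g' : \bar R := (\int[lam]_(x in Q) (sq (fun x => (g x - g' x)%R) x)%:E)%E.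

Lemma sq_measQ g : cmeasf g -> measurable_fun Q (EFin \o sq g).
Proof. by move=> /sq_meas gm; apply/measurable_EFinP; exact: measurable_funS gm. Qed.

Lemma dist2_lin (c : R[i]) g1 g2 (t1 t2 : B -> R[i]) : cmeasf g1 -> cmeasf g2 -> cmeasf t1 -> cmeasf t2 ->
  (dist2 (fun x => c * g1 x + g2 x)%R (fun x => c * t1 x + t2 x)%R <=
   (2 * cmod c ^+ 2)%:E * dist2 g1 t1 + 2%:E * dist2 g2 t2)%E.
Proof.
move=> m1 m2 n1 n2; rewrite /dist2.
have p1 := sq_measQ (cmeasB m1 n1); have p2 := sq_measQ (cmeasB m2 n2).
have p0 g x : (0 <= (sq g x)%:E)%E by rewrite lee_fin sqr_ge0.
have c0 : 0 <= 2 * cmod c ^+ 2 by rewrite mulr_ge0 ?sqr_ge0.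
rewrite -!ge0_integralZl//.
rewrite -ge0_integralD//; [|by move=> x _; rewrite mule_ge0|exact: measurable_funeM
  |by move=> x _; rewrite mule_ge0|exact: measurable_funeM].
apply: ge0_le_integral => //.
- apply: sq_measQ; apply: cmeasB; apply: cmeasD => //; exact: cmeasM (cmeas_cst _) _.
- by apply: emeasurable_funD; exact: measurable_funeM.
move=> x _; rewrite -!EFinM -EFinD lee_fin /sq.
have -> : c * g1 x + g2 x - (c * t1 x + t2 x) = c * (g1 x - t1 x) + (g2 x - t2 x) by ring.
have := cmodD (c * (g1 x - t1 x)) (g2 x - t2 x); rewrite cmodM.
have := cmod_ge0 (c * (g1 x - t1 x) + (g2 x - t2 x)); set z := cmod (_ + _).
have := cmod_ge0 c; have := cmod_ge0 (g1 x - t1 x); have := cmod_ge0 (g2 x - t2 x).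
set a := cmod (g2 x - t2 x); set b := cmod (g1 x - t1 x); set q := cmod c.
move=> a0 b0 q0 z0 zab.
have : z ^+ 2 <= (q * b + a) ^+ 2 by rewrite ler_sqr ?nnegrE// addr_ge0// mulr_ge0.
have := sqr_ge0 (q * b - a).
lra.
Qed.

Lemma apx_tp g : is_tp g -> apx g.
Proof.
move=> [s sl gs] e e0; exists s => //.
rewrite (eq_integral (cst 0%E)) ?integral0 ?lee_fin ?ltW// => x _.
by rewrite /sq gs subrr cmod0 expr0n.
Qed.

Lemma apx_eq g g' : g =1 g' -> apx g -> apx g'.
Proof. by move=> /funext ->. Qed.

Lemma apx_lin (c : R[i]) g1 g2 : cmeasf g1 -> cmeasf g2 -> apx g1 -> apx g2 ->
  apx (fun x => c * g1 x + g2 x).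
Proof.
move=> m1 m2 a1 a2 e e0.
have C0 : 0 < 4 * (1 + cmod c ^+ 2) by rewrite mulr_gt0// ltr_wpDr ?sqr_ge0.
have e1 : 0 < e / (4 * (1 + cmod c ^+ 2)) by rewrite divr_gt0.
have [s1 l1 h1] := a1 _ e1; have [s2 l2 h2] := a2 _ e1.
exists (scl c s1 ++ s2).
  by move=> p; rewrite mem_cat => /orP[/mapP[q /l1 lq ->]|/l2].
have tpE : tp (scl c s1 ++ s2) = fun x => c * tp s1 x + tp s2 x.
  by apply/funext => x; rewrite /tp papp_cat papp_scl.
rewrite tpE; apply: (le_trans (dist2_lin c m1 m2 (cmeas_tp s1) (cmeas_tp s2))).
set D := 4 * _ in C0 e1 h1 h2.
apply: (@le_trans _ _ ((2 * cmod c ^+ 2)%:E * (e / D)%:E + 2%:E * (e / D)%:E)%E).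
  by apply: leeD; apply: lee_wpmul2l => //; rewrite lee_fin mulr_ge0 ?sqr_ge0.
rewrite -!EFinM -EFinD lee_fin -mulrDl mulrA ler_pdivrMr//.
have := sqr_ge0 (cmod c); set q := cmod c ^+ 2 => q0.
by rewrite /D -/q; have : 0 <= e * q; [rewrite mulr_ge0// ltW|lra].
Qed.

Lemma apx_close g : cmeasf g ->
  (forall e : R, 0 < e -> exists g', [/\ cmeasf g', apx g' & (dist2 g g' <= e%:E)%E]) -> apx g.
Proof.
move=> mg H e e0; have e4 : 0 < e / 4 by rewrite divr_gt0.
have [g' [mg' ag' dg]] := H _ e4; have [s sl hs] := ag' _ e4.
exists s => //.
have := dist2_lin 1 (cmeasB mg mg') mg' (cmeas_cst 0) (cmeas_tp s).
rewrite /dist2 cmod1 expr1n mulr1 => D.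
rewrite [X in (X <= _)%E](_ : _ = \int[lam]_(x in Q)
    (sq (fun x0 => (1 * (g x0 - g' x0) + g' x0 - (1 * 0 + tp s x0))%R) x)%:E)%E; last first.
  apply: eq_integral => x _; congr EFin; rewrite /sq; congr (cmod _ ^+ 2).
  by rewrite !mul1r add0r subrK.
apply: (le_trans D).
apply: (@le_trans _ _ (2%:E * (e / 4)%:E + 2%:E * (e / 4)%:E)%E); last first.
  by rewrite -!EFinM -EFinD lee_fin; lra.
apply: leeD; apply: lee_wpmul2l => //.
apply: le_trans dg; rewrite /dist2 le_eqVlt; apply/orP; left; apply/eqP.
by apply: eq_integral => x _; rewrite /sq subr0.
Qed.

Lemma apx_lim (G : nat -> B -> R[i]) g (D : B -> R) : cmeasf g ->
  (forall n, cmeasf (G n)) -> (forall n, apx (G n)) ->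
  (forall x, Q x -> (fun n => cmod (g x - G n x)) @ \oo --> (0 : R)) ->
  (forall n x, Q x -> cmod (g x - G n x) ^+ 2 <= D x) ->
  lam.-integrable Q (EFin \o D) -> apx g.
Proof.
move=> mg mG aG lim dom Di; apply: (apx_close mg) => e e0.
have : (fun n => \int[lam]_(x in Q) (sq (fun x => (g x - G n x)%R) x)%:E)%E @ \oo -->
    (\int[lam]_(x in Q) (cst 0%E x))%E.
  apply: (dominated_cvg mQ (g := EFin \o D)) => //.
  - by move=> n; apply: sq_measQ; exact: cmeasB.
  - move=> x Qx; apply/fine_cvgP; split; first exact: nearW.
    have : (fun n => cmod (g x - G n x) * cmod (g x - G n x)) @ \oo --> (0 * 0 : R).
      by apply: cvgM; exact: lim.
    by rewrite mulr0; under eq_fun do rewrite -expr2.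
  - by move=> n x Qx; rewrite /= lee_fin /sq ger0_norm ?sqr_ge0//; exact: dom.
rewrite integral0 => /fine_cvgP[finG /cvgr_le /(_ _ e0) [n0 _ hn]].
have [n1 _ hfin] := finG; pose n := maxn n0 n1.
exists (G n); split => //.
rewrite /dist2 -(fineK (hfin n (leq_maxr _ _))) lee_fin.
exact: (hn n (leq_maxl _ _)).
Qed.

Definition ind A : B -> R[i] := fun x => cofR (\1_A x).

Lemma ind_meas A : measurable A -> cmeasf (ind A).
Proof.
move=> mA; split; last exact: measurable_cst.
exact: measurable_indic.
Qed.

Lemma ind_bd A x : cmod (ind A x) <= 1.
Proof. by rewrite cmod_cofR indicE; case: (x \in A); rewrite ?normr1 ?normr0. Qed.

(** Half the period cube: a box inside it has centre within T / 4 and half-sides at most T / 4, as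
    [cos_arc] demands. *)
Definition Qin : set B := obox (\row_i (- (T / 4))) (\row_i (T / 4)).

Lemma QinQ x : Qin x -> Q x.
Proof.
move=> h i; have := h i; rewrite !mxE => /andP[h1 h2].
by have T0' := T0; apply/andP; split; lra.
Qed.

(** Step functions are limits of polynomials in an affine function [t] of a cosine,
    since [(1 - t ^ n) ^ (n 2 ^ n)] tends to the indicator of [t < 1 / 2] on [[0, 1]].
    Inside [Qin], within one period, an interval is a superlevel set of a cosine. *)
Lemma apx_obox (a b : V) : (forall i, - (T / 4) <= a ord0 i) -> (forall i, b ord0 i <= T / 4) ->
  (forall i, a ord0 i < b ord0 i) -> apx (ind (obox a b)).
Proof.
move=> aT bT ab.
pose c i := (a ord0 i + b ord0 i) / 2; pose w i := (b ord0 i - a ord0 i) / 2.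
pose kap i := cos (2 * pi * (w i / T)).
(* Scaled to lie in [0, 1] and to be below 1/2 exactly where the cosine exceeds its value [kap i] at
   the end points of the interval. *)
pose tau i (x : B) := (2 - cos (2 * pi * (((x : V) ord0 i - c i) / T)) + kap i) / 4.
have tau01 i x : 0 <= tau i x <= 1.
  rewrite /tau /kap; set u := cos _; set v := cos _.
  have := cos_le1 (2 * pi * (((x : V) ord0 i - c i) / T)).
  have := cos_geN1 (2 * pi * (((x : V) ord0 i - c i) / T)).
  have := cos_le1 (2 * pi * (w i / T)); have := cos_geN1 (2 * pi * (w i / T)).
  by rewrite -/u -/v => *; apply/andP; split; lra.
have tauE i x : Q x -> (tau i x < 2^-1) = (a ord0 i < (x : V) ord0 i < b ord0 i).
  move=> Qx; have /andP[x1 x2] := Qx i; rewrite !mxE in x1 x2.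
  have h1 := aT i; have h2 := bT i; have h3 := ab i.
  have -> : (tau i x < 2^-1) =
      (cos (2 * pi * (w i / T)) < cos (2 * pi * (((x : V) ord0 i - c i) / T))).
    by rewrite /tau -/(kap i); apply/idP/idP; lra.
  rewrite cos_arc//.
  - by rewrite ltr_norml /c /w; apply/idP/idP => /andP[? ?]; apply/andP; split; lra.
  - by rewrite ltr_norml /c; apply/andP; split; lra.
  - by rewrite /w; apply/andP; split; lra.
pose G n (x : B) := cofR (\prod_(i < d) qstep n (tau i x)).
have tG n : is_tp (G n).
  apply: (@is_tp_eq (fun x => \prod_(i < d) (1 + (-1) * (cofR 4^-1 * (cofR (2 + kap i) +
     (-1) * cofR (cos (2 * pi * (((x : V) ord0 i - c i) / T))))) ^+ n) ^+ (n * 2 ^ n))).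
    move=> x; rewrite /G (big_morph (@cofR R) cofRM cofR1); apply: eq_bigr => i _.
    have cX (r : R) k : cofR (r ^+ k) = cofR r ^+ k by rewrite !cofRE rmorphXn.
    rewrite /qstep cX cofRB cX cofR1; congr ((1 + _) ^+ _).
    rewrite [LHS]mulN1r; congr (- (_ ^+ _)); rewrite mulN1r -cofRB -cofRM; congr cofR.
    by rewrite /tau; field.
  apply: is_tp_prod => i; apply: is_tp_exp; apply: is_tp_add; first exact: is_tp_cst.
  apply: is_tp_mul; first exact: is_tp_cst.
  apply: is_tp_exp; apply: is_tp_mul; first exact: is_tp_cst.
  apply: is_tp_add; first exact: is_tp_cst.
  by apply: is_tp_mul; [exact: is_tp_cst|exact: is_tp_cos].
have G01 n x : 0 <= \prod_(i < d) qstep n (tau i x) <= 1.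
  rewrite prodr_ge0 ?prodr_ile1// => i _; first exact: qstep_bd.
  by case/andP: (qstep_bd n (tau01 i x)).
have indE x : Q x -> \1_(obox a b) x = \prod_(i < d) ((tau i x < 2^-1)%R%:R : R).
  move=> Qx; rewrite indicE; have [h|h] := boolP (x \in obox a b).
    rewrite big1// => i _; rewrite tauE//.
    by move: h; rewrite inE => /(_ i) ->.
  have /existsNP[i /negP hi] : ~ (obox a b x) by move=> h'; move: h; rewrite mem_set.
  by rewrite (bigD1 i)//= tauE// (negbTE hi) mul0r.
apply: (apx_lim (G := G) (D := fun=> 4)).
- by apply: ind_meas; exact: obox_Rd.
- by move=> n; exact: is_tp_cmeas.
- by move=> n; exact: apx_tp.
- move=> x Qx; have lim : (fun n => \prod_(i < d) qstep n (tau i x)) @ \oo -->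
      \prod_(i < d) ((tau i x < 2^-1)%R%:R : R).
    by apply: cvg_big => [|i _]; [exact: mul_continuous|exact: qstep_cvg].
  apply/cvgrPdist_le => e e0; move/cvgrPdist_le: lim => /(_ _ e0).
  by apply: filterS => n; rewrite -indE// sub0r normrN (ger0_norm (cmod_ge0 _)) /ind /G -cofRB cmod_cofR.
- move=> n x Qx; have h := cmodB (ind (obox a b) x) (G n x).
  have h1 := ind_bd (obox a b) x.
  have h2 : cmod (G n x) <= 1 by rewrite cmod_cofR ger0_norm; case/andP: (G01 n x).
  have := cmod_ge0 (ind (obox a b) x - G n x); nra.
- exact: cst_int.
Qed.

(** Approximable sets form a Dynkin system: relative to [Qin], complements are differences, and
    disjoint unions follow by dominated convergence. *)
Lemma apx_ind A : measurable A -> apx (ind (A `&` Qin)).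
Proof.
rewrite obox_gen; move: A; apply: dynkin_induction.
- exact: obox_gen.
- by move=> _ _ [p _ <-] [q _ <-]; rewrite oboxI; eexists (_, _).
- rewrite setTI; apply: apx_obox => i; rewrite !mxE//.
  by have := T0; lra.
- move=> _ [[a b] _ <-] /=; rewrite /Qin oboxI; set a' := \row__ _; set b' := \row__ _.
  have [ab|] := pselect (forall i, a' ord0 i < b' ord0 i).
    apply: apx_obox => // i; rewrite !mxE; first by rewrite le_max lexx orbT.
    by rewrite ge_min lexx orbT.
  move=> /existsNP[i /negP]; rewrite -leNgt => ba.
  have -> : obox a' b' = set0.
    apply/seteqP; split => // x /(_ i) /andP[h1 h2].
    by have := lt_le_trans (lt_trans h1 h2) ba; rewrite ltxx.
  apply: apx_tp; apply: is_tp_eq (is_tp_cst 0) => x.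
  by rewrite /ind indicE in_set0.
- move=> S mS aS.
  have aT : apx (ind Qin).
    apply: apx_obox => i; rewrite !mxE//; by have := T0; lra.
  apply: (apx_eq _ (apx_lin (-1) _ _ aS aT)).
  + move=> x; rewrite /ind !indicE !in_setI in_setC mulN1r -cofRN -cofRD.
    by congr cofR; case: (x \in S); case: (x \in Qin); rewrite /=; ring.
  + by apply: ind_meas; apply: measurableI => //; exact: obox_Rd.
  + by apply: ind_meas; exact: obox_Rd.
- move=> F mF tF aF.
  pose G n : B -> R[i] := fun x => \sum_(k < n) ind (F k `&` Qin) x.
  have mFQ k : cmeasf (ind (F k `&` Qin)).
    by apply: ind_meas; apply: measurableI => //; exact: obox_Rd.
  have GS n : G n.+1 = fun x => 1 * ind (F n `&` Qin) x + G n x.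
    by apply/funext => x; rewrite /G big_ord_recr/= mul1r addrC.
  have G0 : G 0%N = fun=> 0 by apply/funext => x; rewrite /G big_ord0.
  have mG n : cmeasf (G n).
    elim: n => [|n IH]; first by rewrite G0; exact: cmeas_cst.
    by rewrite GS; apply: cmeasD => //; apply: cmeasM => //; exact: cmeas_cst.
  have GE n x : G n x = cofR (\1_(\bigcup_(k < n) (F k `&` Qin)) x).
    elim: n => [|n IH].
      by rewrite G0 indicE memNset// => -[].
    rewrite GS IH mul1r /ind -cofRD; congr cofR; rewrite !indicE.
    have [h|h] := boolP (x \in F n `&` Qin).
      rewrite (@memNset _ (\bigcup_(k < n) _)) ?mem_set ?addr0//.
        by move: h; rewrite inE => h; exists n => /=.
      move=> [k /= kn [Fk _]]; move: h; rewrite inE => -[Fn _].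
      have nk : n = k by apply: (tF n k I I); exists x.
      by move: kn; rewrite nk ltnn.
    rewrite add0r; congr ((nat_of_bool _)%:R); apply/idP/idP; rewrite !inE.
      by move=> [k /= kn Fk]; exists k => //=; exact: ltnW.
    move=> [k /=]; rewrite ltnS leq_eqVlt => /orP[/eqP ->|kn] Fk.
      by move: h; rewrite mem_set.
    by exists k.
  apply: (apx_lim (G := G) (D := fun=> 4)).
  + by apply: ind_meas; apply: measurableI; [exact: bigcupT_measurable|exact: obox_Rd].
  + exact: mG.
  + elim=> [|n IH]; first by rewrite G0; apply: apx_tp; exact: is_tp_cst.
    by rewrite GS; exact: apx_lin.
  + move=> x _; apply: cvg_near_cst.
    have [[[k _ Fk] Qx]|nx] := pselect ((\bigcup_k F k `&` Qin) x).
      exists k.+1 => // n /= kn; rewrite /ind GE !indicE !mem_set ?subrr ?cmod0//.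
        by exists k.
      by split => //; exists k.
    apply: nearW => n; rewrite /ind GE !indicE !memNset ?subrr ?cmod0//.
    by move=> [k _ [Fk Qx]]; apply: nx; split => //; exists k.
  + move=> n x _; have h := cmodB (ind (\bigcup_k F k `&` Qin) x) (G n x).
    have h1 := ind_bd (\bigcup_k F k `&` Qin) x.
    have h2 : cmod (G n x) <= 1 by rewrite GE; exact: ind_bd.
    have := cmod_ge0 (ind (\bigcup_k F k `&` Qin) x - G n x); nra.
  + exact: cst_int.
Qed.

Lemma apx_nonneg f : measurable_fun setT f -> (forall x, 0 <= f x) ->
  (forall x, ~ Qin x -> f x = 0) ->
  lam.-integrable Q (EFin \o (fun x => f x ^+ 2)) -> apx (fun x => cofR (f x)).
Proof.
move=> mf f0 fQ fi.
pose S n k : set B := [set x | k.+1%:R / n.+1%:R <= f x].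
have mS n k : measurable (S n k).
  have := mf measurableT _ (measurable_itv (Interval (BLeft (k.+1%:R / n.+1%:R)) +oo%O)).
  by rewrite setTI; congr measurable; apply/seteqP; split => x; rewrite /= in_itv/= andbT.
(* Levels of mesh 1 / (n+1) up to height n+1: [F n] is [f] rounded down to the mesh and capped at
   n+1. *)
pose N n := (n.+1 * n.+1)%N.
pose F n x : R := n.+1%:R^-1 * \sum_(k < N n) \1_(S n k `&` Qin) x.
have FE n x : F n x = n.+1%:R^-1 * \sum_(k < N n) ((k.+1%:R <= n.+1%:R * f x)%R%:R : R).
  congr (_ * _); apply: eq_bigr => k _; rewrite indicE; congr (_%:R).
  have eS : (x \in S n k) = (k.+1%:R <= n.+1%:R * f x).
    by apply/idP/idP; rewrite inE /S /= ler_pdivrMr// mulrC.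
  rewrite in_setI eS; case: (boolP (x \in Qin)) => xQ; rewrite ?andbT// andbF.
  rewrite fQ ?mulr0; last by move=> h; move: xQ; rewrite mem_set.
  by rewrite leNgt ltr0n.
have Fbd n x : [/\ 0 <= F n x, F n x <= f x & f x <= n.+1%:R -> f x - F n x <= n.+1%:R^-1].
  have n0 : 0 < n.+1%:R :> R by [].
  rewrite FE; have [|c1 c2 c3] := @count_le R (N n) (n.+1%:R * f x); first by rewrite mulr_ge0.
  split.
  - by rewrite mulr_ge0// ?invr_ge0//; apply: sumr_ge0.
  - by rewrite ler_pdivrMl.
  move=> fn; have c3' : n.+1%:R * f x - 1 <= \sum_(k < N n) ((k.+1%:R <= n.+1%:R * f x)%R%:R : R).
    case: c3 => // c3; apply: le_trans c3; rewrite lerBlDr.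
    rewrite (@le_trans _ _ (n.+1%:R * n.+1%:R))// ?ler_wpM2l// /N natrM.
    by rewrite lerDl.
  rewrite lerBlDr -[X in X + _]mulr1 -mulrDr ler_pdivlMl//.
  by move: c3'; rewrite lerBlDr addrC.
apply: (apx_lim (G := fun n x => cofR (F n x)) (D := fun x => f x ^+ 2)) => //.
- move=> n; split; last exact: measurable_cst.
  apply: measurable_funM; first exact: measurable_cst.
  apply: measurable_sum => k; apply: measurable_indic; apply: measurableI => //.
  exact: obox_Rd.
- move=> n; have mI k : cmeasf (ind (S n k `&` Qin)).
    by apply: ind_meas; apply: measurableI => //; exact: obox_Rd.
  have aS m : apx (fun x => cofR (\sum_(k < m) \1_(S n k `&` Qin) x)) /\
      cmeasf (fun x => cofR (\sum_(k < m) \1_(S n k `&` Qin) x)).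
    elim: m => [|m [IH1 IH2]].
      have -> : (fun x : B => cofR (\sum_(k < 0) \1_(S n k `&` Qin) x)) = (fun=> 0 : R[i]).
        by apply/funext => x; rewrite big_ord0.
      by split; [apply: apx_tp; exact: is_tp_cst|exact: cmeas_cst].
    have -> : (fun x : B => cofR (\sum_(k < m.+1) \1_(S n k `&` Qin) x)) =
        fun x => 1 * ind (S n m `&` Qin) x + cofR (\sum_(k < m) \1_(S n k `&` Qin) x).
      by apply/funext => x; rewrite big_ord_recr/= mul1r /ind -cofRD addrC.
    split; first by apply: apx_lin => //; exact: apx_ind.
    by apply: cmeasD => //; apply: cmeasM => //; exact: cmeas_cst.
  have [a1 a2] := aS (N n).
  apply: (apx_eq _ (apx_lin (cofR n.+1%:R^-1) a2 (cmeas_cst 0) a1 (apx_tp (is_tp_cst 0)))).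
  by move=> x; rewrite addr0 -cofRM.
- move=> x Qx; apply/cvgrPdist_le => e e0.
  have lim : (fun n => n.+1%:R^-1 : R) @ \oo --> (0 : R) by exact: cvg_harmonic.
  have [n0 _ hn0] := cvgr_le _ lim _ e0.
  exists (maxn n0 (Num.bound (f x))) => // n /=; rewrite geq_max => /andP[nn0 nf].
  have [F0 Ff Fn] := Fbd n x.
  rewrite sub0r normrN (ger0_norm (cmod_ge0 _)) -cofRB cmod_cofR ger0_norm ?subr_ge0//.
  apply: le_trans (Fn _) (hn0 n nn0); rewrite (le_trans (ltW (archi_boundP (f0 x))))//.
  by rewrite ler_nat leqW.
- move=> n x Qx; have [F0 Ff _] := Fbd n x.
  rewrite -cofRB cmod_cofR ger0_norm ?subr_ge0// ler_sqr ?nnegrE ?subr_ge0//.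
  by rewrite lerBlDr lerDl.
Qed.

Lemma apx_real f h : measurable_fun setT f -> cmeasf h -> (forall x, ~ Qin x -> f x = 0) ->
  lam.-integrable Q (EFin \o sq h) -> (forall x, `|f x| <= cmod (h x)) ->
  apx (fun x => cofR (f x)).
Proof.
move=> mf mh fQ hi fh.
pose fp x := Num.max (f x) 0; pose fn x := Num.max (- f x) 0.
have mfp : measurable_fun setT fp by apply: measurable_maxr => //; exact: measurable_cst.
have mfn : measurable_fun setT fn.
  by apply: measurable_maxr; [exact: measurableT_comp|exact: measurable_cst].
have int_le (p : B -> R) : measurable_fun setT p -> (forall x, 0 <= p x) ->
    (forall x, p x <= `|f x|) -> lam.-integrable Q (EFin \o (fun x => p x ^+ 2)).
  move=> mp p0 pf; apply: (le_integrable mQ _ _ hi).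
    apply/measurable_EFinP; apply: measurable_funX; exact: measurable_funS mp.
  move=> x _ /=; rewrite lee_fin !ger0_norm ?sqr_ge0// /sq ler_sqr ?nnegrE ?cmod_ge0//.
  by rewrite (le_trans (pf x)).
have ap : apx (fun x => cofR (fp x)).
  apply: apx_nonneg => //.
  - by move=> x; rewrite le_max lexx orbT.
  - by move=> x /fQ; rewrite /fp => ->; rewrite maxxx.
  apply: int_le => // x; first by rewrite le_max lexx orbT.
  by rewrite ge_max ler_norm normr_ge0.
have an : apx (fun x => cofR (fn x)).
  apply: apx_nonneg => //.
  - by move=> x; rewrite le_max lexx orbT.
  - by move=> x /fQ; rewrite /fn => ->; rewrite oppr0 maxxx.
  apply: int_le => // x; first by rewrite le_max lexx orbT.
  by rewrite ge_max normr_ge0 andbT -normrN ler_norm.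
have cm (p : B -> R) : measurable_fun setT p -> cmeasf (fun x => cofR (p x)).
  by move=> mp; split; [exact: mp|exact: measurable_cst].
apply: (apx_eq _ (apx_lin (-1) (cm _ mfn) (cm _ mfp) an ap)) => x.
rewrite mulN1r -cofRN -cofRD /fp /fn; congr cofR.
by case: (leP (f x) 0) => h0; case: (leP (- f x) 0) => h1; lra.
Qed.

Lemma apx_L2 h : cmeasf h -> lam.-integrable Q (EFin \o sq h) ->
  (forall x, ~ Qin x -> h x = 0) -> apx h.
Proof.
move=> mh hi hQ; have [mR mI] := mh.
have aR : apx (fun x => cofR (cRe (h x))).
  apply: (apx_real mR mh) => //; last by move=> x; exact: Re_le_cmod.
  by move=> x /hQ ->.
have aI : apx (fun x => cofR (cIm (h x))).
  apply: (apx_real mI mh) => //; last by move=> x; exact: Im_le_cmod.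
  by move=> x /hQ ->.
have cm (p : B -> R) : measurable_fun setT p -> cmeasf (fun x => cofR (p x)).
  by move=> mp; split; [exact: mp|exact: measurable_cst].
apply: (apx_eq _ (apx_lin (cI R) (cm _ mI) (cm _ mR) aI aR)) => x.
case: (h x) => a b; apply/eqP; rewrite eq_complex /cRe /cIm /=.
by apply/andP; split; apply/eqP; ring.
Qed.

End Completeness.

(** * Symmetric convex bodies *)

Section Body.
Context {R : realType} {d : nat}.
Local Notation V := (Vec R d).
Local Notation B := (Rd R d).
Implicit Types (L : set V).

(** Symmetry moves the signs into the vectors and convexity merges the rescaled weights; [y0] serves
    when all weights vanish. *)
Lemma convex_sym_comb L (k : nat) (c : 'I_k -> R) (v : 'I_k -> V) (y0 : V) :
  convex_Rd L -> symmetric_set L -> L y0 -> (forall i, L (v i)) ->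
  exists2 y, L y & \sum_i c i *: v i = (\sum_i `|c i|) *: y.
Proof.
move=> cL sL Ly0; elim: k c v => [|k IH] c v Lv.
  by exists y0 => //; rewrite !big_ord0 scale0r.
rewrite !big_ord_recl; have [|y Ly ->] := IH (fun i => c (lift ord0 i)) (fun i => v (lift ord0 i)).
  by move=> i; exact: Lv.
set S := \sum_(i < k) _; have S0 : 0 <= S by apply: sumr_ge0.
set v0 := v ord0; have Lv0 : L v0 by exact: Lv.
have [z Lz ->] : exists2 z, L z & c ord0 *: v0 = `|c ord0| *: z.
  have [c0|c0] := leP 0 (c ord0).
    by exists v0 => //; rewrite ger0_norm.
  by exists (- v0); [exact: sL|rewrite ltr0_norm// scaleNr scalerN opprK].
set t := `|c ord0|; have t0 : 0 <= t by exact: normr_ge0.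
have [tS|tS] := eqVneq (t + S) 0.
  have -> : t = 0 by lra.
  have -> : S = 0 by lra.
  by exists y0 => //; rewrite !addr0 !scale0r addr0.
have tSp : 0 < t + S by rewrite lt_neqAle eq_sym tS addr_ge0.
exists ((t / (t + S)) *: z + (1 - t / (t + S)) *: y).
  apply: cL => //; apply/andP; split; first by rewrite divr_ge0// ltW.
  by rewrite ler_pdivrMr// mul1r lerDl.
rewrite scalerDr !scalerA; congr (_ *: _ + _ *: _); first by field.
by field.
Qed.

Lemma convex_sym_scale L (y : V) (s : R) : convex_Rd L -> symmetric_set L -> L y ->
  0 <= s <= 1 -> L (s *: y).
Proof.
move=> cL sL Ly s01; have L0 : L 0.
  have := cL y (- y) (2^-1) Ly (sL _ Ly); rewrite scalerN.
  have -> : 1 - 2^-1 = 2^-1 :> R by lra.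
  by rewrite subrr; apply; apply/andP; split; lra.
by have := cL y 0 s Ly L0 s01; rewrite scaler0 addr0.
Qed.

(** While k < d, some nonzero [w] is orthogonal to the rows found so far; a vector of [L] that pairs
    with [w] to a nonzero number is independent of them. *)
Lemma spanning_rows L :
  (forall w, w != 0 -> exists2 v, L v & dotp v w != 0) ->
  forall k, (k <= d)%N -> exists2 A : 'M[R]_(k, d), (forall i, L (row i A)) & row_free A.
Proof.
move=> Lw; elim=> [|k IH] kd.
  exists 0; first by case.
  by rewrite /row_free mxrank0.
have [A LA fA] := IH (ltnW kd).
pose w := nz_row (kermx A^T).
have w0 : w != 0.
  rewrite nz_row_eq0 -mxrank_eq0 mxrank_ker mxrank_tr (eqP fA) subn_eq0 -ltnNge.
  exact: kd.
have Aw : w *m A^T = 0 by apply/sub_kermxP; exact: nz_row_sub.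
have [v Lv vw] := Lw _ w0.
have Aw0 i : dotp (row i A) w = 0.
  move/matrixP: Aw => /(_ ord0 i); rewrite !mxE => Awi; rewrite -{}[RHS]Awi.
  by apply: eq_bigr => j _; rewrite !mxE mulrC.
have dA (a : 'rV[R]_k) : dotp (a *m A) w = 0.
  rewrite mulmx_sum_row /dotp.
  under eq_bigr do rewrite summxE mulr_suml.
  rewrite exchange_big big1// => i _; under eq_bigr do rewrite mxE -mulrA.
  by rewrite -mulr_sumr -/(dotp (row i A) w) Aw0 mulr0.
exists (col_mx (v : 'M[R]_(1, d)) A).
  move=> i; rewrite -(splitK (i : 'I_(1 + k))); case: (fintype.split (i : 'I_(1 + k))) => j /=.
    by rewrite [row _ _]rowKu row_id.
  by rewrite [row _ _]rowKd.
suff H (u : 'rV[R]_(1 + k)) : u *m col_mx (v : 'M[R]_(1, d)) A = 0 -> u = 0.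
  by apply: inj_row_free => u; exact: H.
rewrite -[X in X *m _]hsubmxK -[X in _ -> X = _]hsubmxK mul_row_col; set a := lsubmx u; set b := rsubmx u => ab0.
have a0 : a = 0.
  have /(congr1 (fun z : V => dotp z w)) := ab0.
  rewrite dotpDl dA addr0 dotp0l [a]mx11_scalar mul_scalar_mx dotpZl => /eqP.
  by rewrite mulf_eq0 (negbTE vw) orbF => /eqP ->; rewrite raddf0.
move: ab0; rewrite a0 mul0mx add0r -(mul0mx _ A) => /(row_free_inj fA) ->.
by rewrite row_mx0.
Qed.

Lemma convex_sym_cube L : convex_Rd L -> symmetric_set L -> (exists y, L y) ->
  (forall w, w != 0 -> exists2 v, L v & dotp v w != 0) ->
  exists2 rho : R, 0 < rho & cube rho `<=` L.
Proof.
move=> cL sL [y0 Ly0] Lw; have [A LA] := spanning_rows Lw (leqnn d).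
rewrite row_free_unit => uA.
(* In the basis of rows of [A], a point of [cube M^-1] has coordinates of absolute sum at most 1. *)
pose M := 1 + \sum_i \sum_j `|invmx A i j|.
have M0 : 0 < M by rewrite ltr_pwDl// sumr_ge0// => i _; rewrite sumr_ge0.
exists M^-1; first by rewrite invr_gt0.
move=> x xM; pose c := x *m invmx A.
have [y Ly yE] := convex_sym_comb (c ord0) cL sL Ly0 LA.
have -> : x = \sum_i c ord0 i *: row i A by rewrite -mulmx_sum_row mulmxKV.
rewrite yE; apply: convex_sym_scale => //; rewrite sumr_ge0//=.
apply: (@le_trans _ _ (\sum_i \sum_j M^-1 * `|invmx A j i|)).
  apply: ler_sum => i _; rewrite mxE; apply: le_trans (ler_norm_sum _ _ _) _.
  by apply: ler_sum => j _; rewrite normrM ler_wpM2r.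
rewrite exchange_big /=; under eq_bigr do rewrite -mulr_sumr.
by rewrite -mulr_sumr mulrC ler_pdivrMr// mul1r lerDr.
Qed.

Lemma compact_Rd_bounded L : compact L -> exists2 r : R, 0 < r & forall x, L x -> `|x| <= r.
Proof.
move=> /compact_bounded [M [_ HM]]; exists (`|M| + 1); first by rewrite ltr_wpDl.
by move=> x Lx; apply: (HM (`|M| + 1)) => //; rewrite (le_lt_trans (ler_norm M))// ltrDl.
Qed.

Lemma compact_Rd_measurable L : compact L -> measurable (L : set B).
Proof. by move=> cL; apply: closed_Rd; apply: compact_closed => //; exact: norm_hausdorff. Qed.

Lemma convex_body_cube (lam : {measure set B -> \bar R}) L : is_lebesgue lam ->
  compact L -> convex_Rd L -> symmetric_set L -> lam L <> 0%E ->
  exists2 rho : R, 0 < rho & cube rho `<=` L.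
Proof.
move=> Hlam kL cL sL L0; apply: convex_sym_cube => //.
  by apply/set0P/eqP => L00; apply: L0; rewrite L00 measure0.
move=> w w0; apply: contrapT => nw; apply: L0.
have [r _ Lr] := compact_Rd_bounded kL.
apply: (hyperplane_null Hlam w0 _ Lr); first exact: compact_Rd_measurable.
by move=> x Lx; apply/eqP; apply: contrapT => /negP wx; apply: nw; exists x.
Qed.

End Body.

(** * Frame bounds *)

Section Frame.
Context {R : realType} {d : nat}.
Local Notation V := (Vec R d).
Local Notation B := (Rd R d).
Variables (lam : {measure set B -> \bar R}) (Hlam : is_lebesgue lam).
Implicit Types (F : V -> R[i]) (L E : set V).

Lemma Rintegral_supp (D1 D2 : set B) (h : B -> R) : D1 `<=` D2 ->
  (forall x, ~ D1 x -> h x = 0) -> Rintegral lam D1 h = Rintegral lam D2 h.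
Proof.
move=> D12 h0; rewrite Rintegral_mkcond [RHS]Rintegral_mkcond; congr (Rintegral _ _ _).
apply/funext => x; rewrite /patch; have [xD1|xD1] := boolP (x \in D1).
  by rewrite ifT// inE; apply: D12; move: xD1; rewrite inE.
by case: ifP => // _; rewrite h0// => /mem_set; exact/negP.
Qed.

Section Compact.
Variables (L : set V) (T : R).
Hypotheses (T0 : 0 < T) (mL : measurable (L : set B)) (LQ : L `<=` Qin T).
Let LQb : L `<=` Qbox T. Proof. by move=> x /LQ; exact: QinQ. Qed.
Let mQ : measurable (Qbox T : set B). Proof. exact: Qbox_Rd. Qed.

Lemma L2_meas F : L2_on lam L F -> cmeasf F. Proof. by case. Qed.

Lemma L2_sqQ F : L2_on lam L F -> lam.-integrable (Qbox T) (EFin \o sq F).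
Proof. by case=> _ _ Fi _; exact: (integrableS measurableT mQ _ Fi). Qed.

Lemma ift_hat F y : L2_on lam L F -> ift lam L F y = hat lam T F y.
Proof.
case=> _ _ _ F0; rewrite /ift /hat /cint; congr Complex.
  rewrite (Rintegral_supp LQb); last by move=> x /F0 ->; rewrite mul0r.
  by congr Rintegral; apply/funext => x; rewrite /chr dotpC.
rewrite (Rintegral_supp LQb); last by move=> x /F0 ->; rewrite mul0r.
by congr Rintegral; apply/funext => x; rewrite /chr dotpC.
Qed.

Lemma L2sq_Q F : L2_on lam L F -> L2sq lam L F = Rintegral lam (Qbox T) (sq F).
Proof.
by case=> _ _ _ F0; apply: Rintegral_supp => // x /F0 ->; rewrite cmod0 expr0n.
Qed.

(** |F| <= 1 + |F|^2 bounds the L^1 norm over the period cube; the factor 2 comes from real and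
    imaginary parts. *)
Lemma spec_ift F : L2_on lam L F -> exists M, spec L M (ift lam L F).
Proof.
move=> LF; exists (2 * Rintegral lam (Qbox T) (fun x => 1 + sq F x)).
have mF := L2_meas LF; have iF := L2_sqQ LF.
apply: (@spec_eq _ _ _ _ (hat lam T F)); last by move=> y; rewrite ift_hat.
split=> s S S0 sS.
have i1 : lam.-integrable (Qbox T) (EFin \o (fun x => 1 + sq F x)).
  by apply: integrableDR => //; exact: cst_int.
have cs p : cintegrable lam (Qbox T) (fun x => p.1 * (F x * chr p.2 x)).
  by case: (cintegrableZ p.1 mQ (chrP_int Hlam T0 p.2 mF iF)).
have [c1 c2] := cintegrable_sum s mQ cs.
have -> : papp s (hat lam T F) =
    cint lam (Qbox T) (fun x => \sum_(p <- s) p.1 * (F x * chr p.2 x)).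
  rewrite c2; apply: eq_bigr => p _.
  by case: (cintegrableZ p.1 mQ (chrP_int Hlam T0 p.2 mF iF)).
rewrite -mulrA -RintegralZr//; apply: cint_bound => //.
  by apply: integrable_eqR (integrableZR S mQ i1) => x; rewrite mulrC.
move=> x _; have -> : \sum_(p <- s) p.1 * (F x * chr p.2 x) = F x * papp s (chr x).
  rewrite /papp mulr_sumr; apply: eq_bigr => p _.
  by rewrite mulrCA /chr dotpC.
rewrite cmodM; have [Lx|Lx] := pselect (L x).
  apply: ler_pM => //; [exact: cmod_ge0|exact: cmod_ge0| |exact: sS].
  by rewrite /sq; have := sqr_ge0 (cmod (F x) - 1); have := cmod_ge0 (F x); nra.
case: LF => _ _ _ F0; rewrite F0// cmod0 mul0r mulr_ge0// addr_ge0//.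
by rewrite /sq sqr_ge0.
Qed.

Lemma energy_lattice_le F : L2_on lam L F ->
  (energy (lattice T) (ift lam L F) <= (T ^+ d * L2sq lam L F)%:E)%E.
Proof.
move=> LF; apply: esum_le_seq => Y uY YE; rewrite sumEFin lee_fin (L2sq_Q LF).
under eq_bigr do rewrite ift_hat//.
by apply: bessel => //; [exact: L2_meas LF|exact: L2_sqQ].
Qed.

(** Completeness enters here: [F] vanishes off [Qin T], hence is approximable by lattice
    polynomials. *)
Lemma lattice_energy_ge F (a : R) : L2_on lam L F ->
  (energy (lattice T) (ift lam L F) <= a%:E)%E -> L2sq lam L F <= (T ^+ d)^-1 * a.
Proof.
move=> LF Ea; apply/ler_addgt0Pr => e e0.
have mF := L2_meas LF; have iF := L2_sqQ LF.
have aF : apx lam T F.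
  apply: apx_L2 => // x Qx; case: LF => _ _ _ F0; apply: F0.
  by move=> /LQ.
have [Y [uY YE]] := parseval_le Hlam T0 mF iF aF e0.
rewrite (L2sq_Q LF) => h; apply: (le_trans h); rewrite lerD2r.
rewrite ler_wpM2l ?invr_ge0 ?exprn_ge0 ?(ltW T0)// -lee_fin; apply: le_trans Ea.
rewrite -sumEFin; under eq_bigr do rewrite -ift_hat//.
apply: (esum_seq_le (a := fun y => (cmod (ift lam L F y) ^+ 2)%:E)) => //.
by move=> y; rewrite lee_fin sqr_ge0.
Qed.

End Compact.

Lemma frame_bounds E L : separated_set E -> compact L -> convex_Rd L -> symmetric_set L ->
  balayage_possible E L -> lam L <> 0%E ->
  exists a b : R, [/\ 0 < a, 0 < b & forall F, L2_on lam L F ->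
    ((a * L2sq lam L F)%:E <= sample_energy lam L E F)%E /\
    (sample_energy lam L E F <= (b * L2sq lam L F)%:E)%E].
Proof.
move=> Esep kL cL sL bal lamL.
have [rho rho0 rhoL] := convex_body_cube Hlam kL cL sL lamL.
have [r r0 Lr] := compact_Rd_bounded kL.
have Lcube : L `<=` cube r.
  by move=> x Lx i; rewrite (le_trans (coord_le_norm x i))// Lr.
have [K K0 EK] := balayage_samp Esep sL bal.
have [e e0 Efat] := samp_fat cL rho0 rhoL (ltW r0) Lcube K0 EK.
have fatc : fat L e `<=` cube (r + e).
  move=> _ [x [y [Lx ye ->]]] i; rewrite mxE (le_trans (ler_normD _ _))// lerD//.
  exact: Lcube.
have re0 : 0 <= r + e by rewrite addr_ge0// ltW.
have [T1 T10 sampT] := @samp_lattice R d _ re0.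
(* Above [T1] for sampling the enlarged spectrum, and above 4 r so that [L] fits in [Qin T]. *)
pose T := T1 + 4 * r + 1.
have T0 : 0 < T by rewrite /T; have := T10; have := r0; lra.
have LQ : L `<=` Qin T.
  move=> x /Lcube xr i; have := xr i; rewrite ler_norml !mxE => /andP[h1 h2].
  by have h3 := T10; rewrite /T; apply/andP; split; lra.
have mL := compact_Rd_measurable kL.
have Tfat : samp (lattice T) (fat L e) 2.
  move=> M f S Lf; apply: (sampT T) (spec_sub Lf fatc).
  by rewrite /T; have := r0; lra.
have [C1 C10 EC1] := sep_ker_bessel e0 Esep.
have [C2 C20 EC2] := sep_ker_bessel e0 (separated_lattice (d := d) T0).
have K20 : 0 < 2 * K by rewrite mulr_gt0.
have Td : 0 < T ^+ d by rewrite exprn_gt0.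
pose D := (T ^+ d)^-1 * ((2 * K) ^+ 2 * C2) + 1.
have D0 : 0 < D by rewrite ltr_wpDl// mulr_ge0 ?invr_ge0 ?mulr_ge0 ?sqr_ge0// ltW.
exists D^-1, (2 ^+ 2 * C1 * T ^+ d + 1); split.
- by rewrite invr_gt0.
- by rewrite ltr_wpDl// !mulr_ge0 ?sqr_ge0// ltW.
move=> F LF; have s0 : 0 <= L2sq lam L F by apply: Rintegral_ge0 => x _; exact: sqr_ge0.
have [M uM] := spec_ift T0 LQ LF.
have e1 := energy_lattice_le T0 LQ LF.
have e2 := energy_le e0 (ltr0n R 2) C10 Tfat EC1 uM.
have e3 := energy_le e0 K20 C20 Efat EC2 uM.
have e2' : (energy E (ift lam L F) <= (2 ^+ 2 * C1 * (T ^+ d * L2sq lam L F))%:E)%E.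
  by apply: (le_trans e2); rewrite [leRHS]EFinM lee_wpmul2l// lee_fin mulr_ge0.
split; last first.
  apply: (le_trans e2'); rewrite lee_fin mulrA mulrDl mul1r lerDl//.
have en0 : (0 <= energy E (ift lam L F))%E.
  by apply: esum_ge0 => x _; rewrite lee_fin sqr_ge0.
(* The upper bound makes the energy on [E] finite, so the lower bound can be argued with a real
   number. *)
have enf : energy E (ift lam L F) \is a fin_num.
  by rewrite ge0_fin_numE// (le_lt_trans e2')// ltry.
rewrite /sample_energy -/(energy E (ift lam L F)).
move: e3 en0; rewrite -(fineK enf); set en := fine _ => e3 en0.
have h := lattice_energy_ge T0 LQ LF e3.
rewrite lee_fin ler_pdivrMl//; apply: (le_trans h).
by rewrite mulrA [leRHS]mulrDl mul1r lerDl -lee_fin.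
Qed.

Lemma cmod_mul_real (z : R[i]) (r : R) : cmod (z * cofR r) ^+ 2 = cmod z ^+ 2 * r ^+ 2.
Proof. by rewrite cmodM cmod_cofR exprMn real_normK// num_real. Qed.

(** * Multiplication by the weight *)

Section Weight.
Variables (L : set V) (G : V -> R).
Hypotheses (mL : measurable (L : set B)) (mG : measurable_fun setT (G : B -> R)).
Hypotheses (G0 : forall x, 0 <= G x) (Gfin : (Linf_norm lam G < +oo)%E).
Let g := fine (Linf_norm lam G).
Local Notation FG F := (fun x => F x * cofR (G x)).

Lemma ae_le_Linf : {ae lam, forall x : B, G x ^+ 2 <= g ^+ 2}.
Proof.
apply: filterS (ess_sup_ge lam (fun x : B => `|G x|%:E)) => x.
rewrite -/(Linf_norm lam G) ger0_norm//; move: Gfin; rewrite /g.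
case: (Linf_norm lam G) => //= t _; rewrite lee_fin => Gt.
by rewrite ler_sqr ?nnegrE// (le_trans _ Gt).
Qed.

Lemma L2_weight F : L2_on lam L F ->
  L2_on lam L (FG F) /\ L2sq lam L (FG F) <= g ^+ 2 * L2sq lam L F.
Proof.
case=> FR FI Fi F0.
have mFG : cmeasf (FG F : B -> R[i]).
  by apply: cmeasM; [|split; [exact: mG|exact: measurable_cst]].
have mS := sq_meas mFG; have mF : measurable_fun setT (sq F) by apply: sq_meas.
(* Proved for extended-valued integrals first; the integrability of |F G|^2 is then read off from
   it. *)
have le D : measurable D -> (\int[lam]_(x in D) (sq (FG F) x)%:E <=
    (g ^+ 2)%:E * \int[lam]_(x in D) (sq F x)%:E)%E.
  move=> mD; rewrite -ge0_integralZl//; last 3 first.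
  - by apply/measurable_EFinP; exact: measurable_funS mF.
  - by move=> x _; rewrite lee_fin sqr_ge0.
  - by rewrite lee_fin sqr_ge0.
  apply: ae_ge0_le_integral => //.
  - by move=> x _; rewrite lee_fin sqr_ge0.
  - by apply/measurable_EFinP; exact: measurable_funS mS.
  - by move=> x _; rewrite -EFinM lee_fin mulr_ge0 ?sqr_ge0.
  - apply: measurable_funeM; apply/measurable_EFinP; exact: measurable_funS mF.
  apply: filterS ae_le_Linf => x h _.
  by rewrite -EFinM lee_fin /sq cmod_mul_real mulrC ler_wpM2r// sqr_ge0.
have iFG : lam.-integrable setT (EFin \o sq (FG F)).
  apply/integrableP; split; first exact/measurable_EFinP.
  rewrite (eq_integral (fun x => (sq (FG F) x)%:E)); last first.
    by move=> x _; rewrite /= ger0_norm// sqr_ge0.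
  apply: le_lt_trans (le _ measurableT) _.
  by have := integrable_fin_num measurableT Fi; rewrite /sq => /fineK <-; rewrite -EFinM ltry.
split; first by case: mFG => m1 m2; split => // x /F0 ->; rewrite mul0r.
have fin (h : B -> R) : lam.-integrable setT (EFin \o h) ->
    (\int[lam]_(x in L) (h x)%:E)%E \is a fin_num.
  by move=> ih; apply: integrable_fin_num => //; exact: integrableS ih.
rewrite -lee_fin EFinM /L2sq /Rintegral !fineK; first exact: le.
  exact: (fin (sq F)).
exact: (fin (sq (FG F))).
Qed.

(** The variance of [G] with respect to [|F|^2 dlam] is nonnegative. *)
Lemma weight_cauchy_schwarz F : L2_on lam L F -> 0 < L2sq lam L F ->
  (Rintegral lam L (fun x : B => cmod (F x) ^+ 2 * G x)) ^+ 2 / L2sq lam L F <=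
  L2sq lam L (FG F).
Proof.
move=> LF s0; have [[_ _ iFG _] _] := L2_weight LF; case: LF => FR FI Fi F0.
have {Fi} i0 : lam.-integrable L (EFin \o (fun x : B => cmod (F x) ^+ 2)).
  exact: integrableS Fi.
have {iFG} i2 : lam.-integrable L (EFin \o (fun x : B => cmod (F x * cofR (G x)) ^+ 2)).
  exact: integrableS iFG.
have mF : measurable_fun setT (sq F) by apply: sq_meas.
have i1 : lam.-integrable L (EFin \o (fun x : B => cmod (F x) ^+ 2 * G x)).
  apply: (le_integrable mL _ _ (integrableDR mL i0 i2)).
    apply/measurable_EFinP; apply: (@measurable_funS _ _ _ _ setT) => //.
    by apply: measurable_funM.
  move=> x _ /=; rewrite lee_fin cmod_mul_real.
  rewrite (ger0_norm (mulr_ge0 (sqr_ge0 _) (G0 x))) ger0_norm; last first.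
    by apply: addr_ge0; [exact: sqr_ge0|apply: mulr_ge0; exact: sqr_ge0].
  rewrite -[X in _ <= X + _]mulr1 -mulrDr ler_wpM2l ?sqr_ge0//.
  by have := sqr_ge0 (G x - 1); have := G0 x; nra.
move: s0; rewrite /L2sq; set s := Rintegral _ _ _ => s0.
set t := Rintegral _ _ _; set w := Rintegral _ _ _.
have : 0 <= Rintegral lam L (fun x : B => cmod (F x * cofR (G x)) ^+ 2 -
    (2 * (t / s) * (cmod (F x) ^+ 2 * G x) - (t / s) ^+ 2 * cmod (F x) ^+ 2)).
  apply: Rintegral_ge0 => x _; rewrite cmod_mul_real.
  have -> : cmod (F x) ^+ 2 * G x ^+ 2 - (2 * (t / s) * (cmod (F x) ^+ 2 * G x) -
    (t / s) ^+ 2 * cmod (F x) ^+ 2) = cmod (F x) ^+ 2 * (G x - t / s) ^+ 2 by ring.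
  by rewrite mulr_ge0 ?sqr_ge0.
have j1 := integrableZR (2 * (t / s)) mL i1; have j0 := integrableZR ((t / s) ^+ 2) mL i0.
rewrite (RintegralB mL i2 (integrableBR mL j1 j0)) (RintegralB mL j1 j0).
rewrite (RintegralZl _ mL i1) (RintegralZl _ mL i0) -/s -/t -/w.
have -> : 2 * (t / s) * t - (t / s) ^+ 2 * s = t ^+ 2 / s by field; rewrite gt_eqF.
by rewrite subr_ge0.
Qed.

End Weight.

End Frame.

Theorem theorem4p4 (R : realType) (d : nat)
  (lam : {measure set Rd R d -> \bar R}) (Hlam : is_lebesgue lam)
  (E Lam : set (Vec R d)) (G : Vec R d -> R) :
  separated_set E ->
  S_set lam Lam -> strict_multiplicity Lam ->
  compact Lam -> convex_Rd Lam -> symmetric_set Lam ->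
  measurable_fun setT (G : Rd R d -> R) -> (forall x, 0 <= G x) ->
  (Linf_norm lam G < +oo)%E ->
  balayage_possible E Lam ->
  (exists A B : R, 0 < A /\ 0 < B /\
     forall F : Vec R d -> R[i], L2_on lam Lam F -> 0 < L2sq lam Lam F ->
       ((A * (Rintegral lam Lam (fun g : Rd R d => (cmod (F g)) ^+ 2 * G g)) ^+ 2
           / L2sq lam Lam F)%:E
          <= sample_energy lam Lam E (fun g => (F g * cofR (G g))%R))%E /\
       (sample_energy lam Lam E (fun g => (F g * cofR (G g))%R)
          <= (B * L2sq lam Lam F)%:E)%E) /\
  (forall B1 : R,
     (forall F : Vec R d -> R[i], L2_on lam Lam F ->
        (sample_energy lam Lam E F <= (B1 * L2sq lam Lam F)%:E)%E) ->
     forall F : Vec R d -> R[i], L2_on lam Lam F -> 0 < L2sq lam Lam F ->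
       (sample_energy lam Lam E (fun g => (F g * cofR (G g))%R)
          <= (B1 * (fine (Linf_norm lam G)) ^+ 2 * L2sq lam Lam F)%:E)%E).
Proof.
move=> Esep _ _ kL cL sL mG G0 Gfin bal; have mL := compact_Rd_measurable kL.
split; last first.
  move=> B1 HB F LF s0; have [LFG FGs] := L2_weight mL mG G0 Gfin LF.
  apply: (le_trans (HB _ LFG)); rewrite lee_fin -mulrA ler_wpM2l//.
  (* B1 >= 0 follows from its own inequality at [F], whose left side is nonnegative. *)
  rewrite -(pmulr_lge0 _ s0) -lee_fin; apply: le_trans (HB _ LF).
  by apply: esum_ge0 => x _; rewrite lee_fin sqr_ge0.
have [lamL|lamL] := pselect (lam Lam = 0%E).
  exists 1, 1; split => //; split => // F [FR FI Fi F0] s0; move: s0.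
  rewrite /L2sq /Rintegral null_set_integral ?ltxx//.
  by apply/measurable_EFinP; apply: (@measurable_funS _ _ _ _ setT) => //; exact: sq_meas.
have [a [b [a0 b0 Hab]]] := frame_bounds Hlam Esep kL cL sL bal lamL.
(* The [+ 1] keeps [B] positive when the norm of [G] is 0. *)
exists a, (b * fine (Linf_norm lam G) ^+ 2 + 1); split => //; split.
  by rewrite ltr_wpDl// mulr_ge0 ?sqr_ge0// ltW.
move=> F LF s0; have [LFG FGs] := L2_weight mL mG G0 Gfin LF.
have [h1 h2] := Hab _ LFG; split.
  apply: le_trans h1; rewrite lee_fin -mulrA ler_wpM2l ?(ltW a0)//.
  exact: weight_cauchy_schwarz.
apply: (le_trans h2); rewrite lee_fin mulrDl -mulrA mul1r.
by apply: (@le_trans _ _ (b * (fine (Linf_norm lam G) ^+ 2 * L2sq lam Lam F)));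
  rewrite ?ler_wpM2l ?(ltW b0)// lerDl ltW.
Qed.
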